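(* Let $j(z)$ be the classical modular invariant. For any positive integer $N>2$, the value $j^{nor}((\overline{N}))$ at the quadratic irrationality $w=(\overline{N})$ is real, and $$\lim_{N\to\infty} j^{nor}((\overline{N}))=744.$$
   Context: Negative continued fractions: $(a_0,a_1,a_2,\ldots)=a_0-\cfrac{1}{a_1-\cfrac{1}{a_2-\cdots}}$ with $a_i\in\mathbb{Z}$, $a_i\geq 2$ for $i\geq1$; $(\overline{N})=N-\cfrac{1}{N-\cfrac{1}{N-\cdots}}=\frac{N+\sqrt{N^2-4}}{2}$. Values at real quadratics: for a real quadratic irrationality $w$, take $a,b,c\in\mathbb{Z}$ with $\gcd(a,b,c)=1$, $aw^2+bw+c=0$, $w=\frac{-b+\sqrt D}{2a}$, $D=b^2-4ac>0$; $Q_w(x,y)=ax^2+bxy+cy^2$; $(t,u)$ the smallest positive solution of $t^2-Du^2=4$, $\varepsilon=(t+u\sqrt D)/2$, $A_w=\begin{pmatrix}\frac12(t-bu)&-cu\\ au&\frac12(t+bu)\end{pmatrix}$. For a modular function $f$ for $\mathrm{SL}_2(\mathbb{Z})$ (holomorphic on the upper half-plane $\mathbb{H}$, meromorphic at the cusp), $f(w):=\int_{z_0}^{A_w z_0}\frac{\sqrt D f(z)}{Q_w(z,1)}\,dz$ (independent of $z_0\in\mathbb{H}$ and of the path) and $f^{nor}(w):=\frac{f(w)}{2\log\varepsilon}$. Here $j(z)=q^{-1}+744+196884q+\cdots$, $q=e^{2\pi iz}$.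
   Formalization: The integral defining f(w) is taken from A_w z_0 to z_0 instead of from z_0 to A_w z_0; with the orientation as written the constant function 1 has normalized value -1 and the limit would be -744. *)

(* Defs.v *)
From Stdlib Require Import Reals ZArith List.
From Coquelicot Require Import Coquelicot.

Open Scope R_scope.

(* Sums, products and limits of complex sequences are taken componentwise. *)

Definition C_lim_seq (u : nat -> C) : C :=
  (real (Lim_seq (fun n => Re (u n))), real (Lim_seq (fun n => Im (u n)))).

Definition C_series (u : nat -> C) : C :=
  (Series (fun n => Re (u n)), Series (fun n => Im (u n))).

Fixpoint C_prod (u : nat -> C) (n : nat) : C :=
  match n with
  | O => RtoC 1
  | S m => Cmult (C_prod u m) (u m)
  end.

Definition C_exp (z : C) : C :=
  (exp (Re z) * cos (Im z), exp (Re z) * sin (Im z)).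

Definition upper_half_plane (z : C) : Prop := 0 < Im z.

Definition nome (z : C) : C := C_exp (Cmult (0, 2 * PI) z).

Definition sigma (k n : nat) : nat :=
  list_sum (map (fun d => Nat.pow d k)
                (filter (fun d => Nat.eqb (Nat.modulo n d) 0) (seq 1 n))).

Definition E4 (z : C) : C :=
  Cplus (RtoC 1)
    (Cmult (RtoC 240)
       (C_series (fun n => Cmult (RtoC (INR (sigma 3 (S n))))
                                 (Cpow (nome z) (S n))))).

(* q * prod_(n >= 1) (1 - q^n)^24 *)
Definition Delta (z : C) : C :=
  Cmult (nome z)
    (C_lim_seq
       (C_prod (fun n => Cpow (Cminus (RtoC 1) (Cpow (nome z) (S n))) 24))).

(* j = q^-1 + 744 + 196884 q + ... *)
Definition j (z : C) : C := Cdiv (Cpow (E4 z) 3) (Delta z).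

(* a_0 - 1/(a_1 - 1/(... - 1/a_n)) *)
Fixpoint ncf_convergent (a : nat -> Z) (n : nat) : R :=
  match n with
  | O => IZR (a O)
  | S m => IZR (a O) - 1 / ncf_convergent (fun i => a (S i)) m
  end.

Definition ncf (a : nat -> Z) : R := real (Lim_seq (ncf_convergent a)).

Definition irrational (w : R) : Prop :=
  forall p q : Z, q <> 0%Z -> w <> IZR p / IZR q.

Definition disc (a b c : Z) : Z := (b * b - 4 * a * c)%Z.

(* The last conjunct selects, of (a,b,c) and (-a,-b,-c), the one
   for which w is the root with + sqrt D. *)
Definition quadratic_coefs (w : R) (a b c : Z) : Prop :=
  irrational w /\ a <> 0%Z /\
  Z.gcd (Z.gcd a b) c = 1%Z /\
  IZR a * w ^ 2 + IZR b * w + IZR c = 0 /\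
  (0 < disc a b c)%Z /\
  w = (- IZR b + sqrt (IZR (disc a b c))) / (2 * IZR a).

Definition pell4 (D t u : Z) : Prop :=
  (0 < t)%Z /\ (0 < u)%Z /\ (t * t - D * (u * u) = 4)%Z.

Definition smallest_pell4 (D t u : Z) : Prop :=
  pell4 D t u /\
  forall t' u' : Z, pell4 D t' u' -> (t <= t')%Z /\ (u <= u')%Z.

Definition Q_form (a b c : Z) (x y : C) : C :=
  Cplus (Cplus (Cmult (RtoC (IZR a)) (Cpow x 2))
               (Cmult (RtoC (IZR b)) (Cmult x y)))
        (Cmult (RtoC (IZR c)) (Cpow y 2)).

Definition moebius (p q r s : R) (z : C) : C :=
  Cdiv (Cplus (Cmult (RtoC p) z) (RtoC q))
       (Cplus (Cmult (RtoC r) z) (RtoC s)).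

(* Action on z of A_w = ((t-bu)/2, -cu; au, (t+bu)/2). *)
Definition A_act (a b c t u : Z) (z : C) : C :=
  moebius ((IZR t - IZR b * IZR u) / 2) (- (IZR c * IZR u))
          (IZR a * IZR u) ((IZR t + IZR b * IZR u) / 2) z.

(* g is a C^1 path in the upper half-plane from z0 to z1, with velocity dg. *)
Definition C1_path_in_H (z0 z1 : C) (g dg : R -> C) : Prop :=
  g 0 = z0 /\ g 1 = z1 /\
  forall s : R, 0 <= s <= 1 ->
    upper_half_plane (g s) /\
    is_derive (K := R_AbsRing) (V := C_R_NormedModule) g s (dg s) /\
    continuous (T := R_UniformSpace) (U := C_UniformSpace) dg s.

Definition is_path_integral (f : C -> C) (g dg : R -> C) (v : C) : Prop :=
  is_RInt (V := C_R_NormedModule) (fun s => Cmult (f (g s)) (dg s)) 0 1 v.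

(* v is the integral of sqrt D f(z) / Q_w(z,1) dz between z0 and A_w z0, for
   every base point z0 and every path.

   Orientation: with these Q_w and A_w, w is the attracting fixed point of A_w
   and d/dz log ((z - w) / (z - w')) = sqrt D / Q_w(z,1), so that the integral
   of sqrt D / Q_w(z,1) from z0 to A_w z0 is - 2 log eps.  The path therefore
   runs from A_w z0 to z0 (that is, along the inverse generator of the
   stabilizer of w); this is the orientation for which the normalized value of
   the constant function 1 is 1 rather than -1, and for which the normalized
   value of j at the golden ratio is 706.3248... *)
Definition is_cycle_integral (f : C -> C) (a b c t u : Z) (v : C) : Prop :=
  forall (z0 : C) (g dg : R -> C),
    upper_half_plane z0 ->
    C1_path_in_H (A_act a b c t u z0) z0 g dg ->
    is_path_integral
      (fun z => Cdiv (Cmult (RtoC (sqrt (IZR (disc a b c)))) (f z))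
                     (Q_form a b c z (RtoC 1)))
      g dg v.

Definition epsilon (D t u : Z) : R := (IZR t + IZR u * sqrt (IZR D)) / 2.

(* "f^nor(w) = v" *)
Definition is_nor_value (f : C -> C) (w : R) (v : C) : Prop :=
  exists (a b c t u : Z) (x : C),
    quadratic_coefs w a b c /\
    smallest_pell4 (disc a b c) t u /\
    is_cycle_integral f a b c t u x /\
    v = Cdiv x (RtoC (2 * ln (epsilon (disc a b c) t u))).

(* Main.v *)
(* Put f(z) = sqrt D j(z) / Q_w(z,1), with w = (N + sqrt(N^2-4)) / 2, w' = 1/w, so that
   Q_w(z,1) = (z - w)(z - w') and A_w z = N - 1/z.  Since j is holomorphic and invariant under
   SL_2(Z), f has a primitive F on the upper half-plane and F(A_w z) - F(z) is constant; hence
   the cycle integral is F(i) - F(i + N).  It is real because z |-> N - conj z exchanges i and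
   i + N.  On the line Im z = 1 write j = 744 + P' with P bounded and 1-periodic (744 is the
   constant term of j).  The constant contributes exactly 744 * 2 log w, and integration by parts
   bounds the contribution of P' independently of N, so dividing by 2 log w -> infinity gives 744.

   The invariance of j under z |-> -1/z comes from Eisenstein series.  Herglotz' trick gives
   sum_n 1/(z+n)^2 = pi^2/sin^2(pi z), and its derivatives and primitive give the other exponents;
   exchanging the order of summation in sum_{m,n} 1/(mz+n)^k yields E4(-1/z) = z^4 E4(z) and, with
   a telescoping correction, E2(-1/z) = z^2 E2(z) + 6z/(pi i).  The latter is the logarithmic
   derivative of Delta(-1/z) = z^12 Delta(z). *)
Require Import Defs.
From Stdlib Require Import Reals ZArith Lra Lia Psatz List IndefiniteDescription.
From Coquelicot Require Import Coquelicot.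

(** * Complex derivatives *)

(** The one rigidity principle is that a function with zero complex derivative on a convex set is
    constant. Identities are differentiated, and the constant is read off where both sides are
    known: at the cusp for 1 - q = exp(- sum q^n / n), at 1/2 for the cotangent series, at the fixed
    point i for [Delta].

    The delicate case is weight 2. The double sum of 1/(mz+n)^2 does not converge absolutely and its
    two orders of summation differ. Each term is compared with the integral of 1/(mz+t)^2 over the
    unit interval centred at n: the differences are O(1/(m^2 n^2)) and may be summed in either
    order, while the integrals telescope in closed form and carry the whole discrepancy, the term
    6z/(pi i).

    The exact factor 2 log w has a simple source: x |-> N - x exchanges w and w' = 1/w, and (w^2 +
    1)/(w'^2 + 1) = w^2. The remainder is uniform in N because, on Im z = 1, the derivative of the
    kernel is dominated by derivatives of two arctangents, whose total variation is at most 2 pi. *)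

Definition is_Cderive (f : C -> C) (z l : C) : Prop :=
  is_derive (K := C_AbsRing) (V := AbsRing_NormedModule C_AbsRing) f z l.

(** Bridge from the filter-based derivative to an estimate in [Cmod], the form in which later
    remainder bounds are proved. *)
Lemma is_Cderive_eps (f : C -> C) (z l : C) :
  is_Cderive f z l <->
  forall eps : posreal, exists delta : posreal, forall w : C,
    Cmod (w - z) < delta -> Cmod (f w - f z - l * (w - z)) <= eps * Cmod (w - z).
Proof.
  split.
  - intros [_ H] eps.
    destruct (H z (fun P HP => HP) eps) as [d Hd].
    exists d. intros w Hw.
    generalize (Hd w Hw). simpl. unfold minus, plus, opp, scal, norm; simpl.
    unfold abs; simpl. unfold mult; simpl.
    replace (f w - f z - l * (w - z))%C with (f w + - f z + - ((w + - z) * l))%C by ring.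
    easy.
  - intros H. split.
    + apply is_linear_scal_l.
    + intros x Hx eps.
      (* The filter definition quantifies over all limits of the neighbourhood filter of [z]; the
         only one is [z]. *)
      assert (Hxz : z = x) by exact (is_filter_lim_locally_unique (V := AbsRing_NormedModule C_AbsRing) z x Hx).
      subst x.
      destruct (H eps) as [d Hd]. exists d. intros w Hw.
      generalize (Hd w Hw). simpl. unfold minus, plus, opp, scal, norm; simpl.
      unfold abs; simpl. unfold mult; simpl.
      replace (f w - f z - l * (w - z))%C with (f w + - f z + - ((w + - z) * l))%C by ring.
      easy.
Qed.

Lemma is_Cderive_ext_loc (f g : C -> C) (z l : C) (r : R) :
  0 < r -> (forall w, Cmod (w - z) < r -> f w = g w) ->
  is_Cderive f z l -> is_Cderive g z l.
Proof.
  intros Hr H. apply is_derive_ext_loc. exists (mkposreal r Hr). exact H.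
Qed.

Lemma is_Cderive_ext (f g : C -> C) (z l : C) :
  (forall w, f w = g w) -> is_Cderive f z l -> is_Cderive g z l.
Proof. intros H. now apply is_derive_ext. Qed.

Lemma is_Cderive_eq (f : C -> C) (z l l' : C) :
  is_Cderive f z l -> l = l' -> is_Cderive f z l'.
Proof. now intros H <-. Qed.

Lemma is_Cderive_const (c z : C) : is_Cderive (fun _ => c) z 0.
Proof. exact (is_derive_const (V := AbsRing_NormedModule C_AbsRing) c z). Qed.

Lemma is_Cderive_id (z : C) : is_Cderive (fun w => w) z 1.
Proof. exact (is_derive_id (K := C_AbsRing) z). Qed.

Lemma is_Cderive_plus (f g : C -> C) (z l m : C) :
  is_Cderive f z l -> is_Cderive g z m -> is_Cderive (fun w => f w + g w)%C z (l + m).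
Proof. exact (is_derive_plus (V := AbsRing_NormedModule C_AbsRing) f g z l m). Qed.

Lemma is_Cderive_opp (f : C -> C) (z l : C) :
  is_Cderive f z l -> is_Cderive (fun w => - f w)%C z (- l).
Proof. exact (is_derive_opp (V := AbsRing_NormedModule C_AbsRing) f z l). Qed.

Lemma is_Cderive_minus (f g : C -> C) (z l m : C) :
  is_Cderive f z l -> is_Cderive g z m -> is_Cderive (fun w => f w - g w)%C z (l - m).
Proof. intros Hf Hg. now apply is_Cderive_plus, is_Cderive_opp. Qed.

Lemma is_Cderive_mult (f g : C -> C) (z l m : C) :
  is_Cderive f z l -> is_Cderive g z m ->
  is_Cderive (fun w => f w * g w)%C z (l * g z + f z * m).
Proof.
  intros Hf Hg. exact (is_derive_mult (K := C_AbsRing) f g z l m Hf Hg Cmult_comm).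
Qed.

Lemma is_Cderive_scal (c : C) (f : C -> C) (z l : C) :
  is_Cderive f z l -> is_Cderive (fun w => c * f w)%C z (c * l).
Proof.
  intros Hf. eapply is_Cderive_eq.
  - apply is_Cderive_mult; [ apply is_Cderive_const | exact Hf ].
  - cbv beta; ring.
Qed.

Lemma is_Cderive_comp (f g : C -> C) (z l m : C) :
  is_Cderive f (g z) l -> is_Cderive g z m ->
  is_Cderive (fun w => f (g w)) z (l * m).
Proof.
  intros Hf Hg. rewrite Cmult_comm.
  exact (is_derive_comp (K := C_AbsRing) (V := AbsRing_NormedModule C_AbsRing) f g z l m Hf Hg).
Qed.

Lemma Cmod_sub_sym (a b : C) : Cmod (a - b) = Cmod (b - a).
Proof. rewrite <- (Cmod_opp (a - b)). f_equal. ring. Qed.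

Lemma Cmod_triangle_sub (a b : C) : Cmod a - Cmod b <= Cmod (a - b).
Proof.
  generalize (Cmod_triangle (a - b) b). replace (a - b + b)%C with a by ring. lra.
Qed.

Lemma Cmod_minus_le (a b : C) : Cmod (a - b) <= Cmod a + Cmod b.
Proof. unfold Cminus. rewrite <- (Cmod_opp b). apply Cmod_triangle. Qed.

Lemma is_Cderive_continuous (f : C -> C) (z l : C) :
  is_Cderive f z l -> forall eps : posreal, exists delta : posreal,
  forall w, Cmod (w - z) < delta -> Cmod (f w - f z) < eps.
Proof.
  intros H eps. apply is_Cderive_eps with (eps := mkposreal 1 Rlt_0_1) in H.
  destruct H as [d Hd]; simpl in Hd.
  assert (Hl := Cmod_ge_0 l).
  assert (He : 0 < Rmin d (eps / (2 + Cmod l))).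
  { apply Rmin_pos. apply cond_pos. apply Rdiv_lt_0_compat. apply cond_pos. lra. }
  exists (mkposreal _ He). intros w Hw; simpl in Hw.
  assert (H1 := Rlt_le_trans _ _ _ Hw (Rmin_l _ _)).
  assert (H2 := Rlt_le_trans _ _ _ Hw (Rmin_r _ _)).
  specialize (Hd w H1).
  replace (f w - f z)%C with ((f w - f z - l * (w - z)) + l * (w - z))%C by ring.
  eapply Rle_lt_trans. apply Cmod_triangle. rewrite Cmod_mult.
  assert (H3 := Cmod_ge_0 (w - z)).
  apply Rmult_lt_compat_r with (r := 2 + Cmod l) in H2; [ | lra ].
  unfold Rdiv in H2. rewrite Rmult_assoc, Rinv_l, Rmult_1_r in H2 by lra.
  nra.
Qed.

Lemma Cinv_sub_bound (z w : C) : z <> 0 -> Cmod (w - z) < Cmod z / 2 ->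
  Cmod z / 2 < Cmod w.
Proof.
  intros Hz H. generalize (Cmod_triangle_sub z w). rewrite Cmod_sub_sym. lra.
Qed.

Lemma is_Cderive_Cinv (z : C) : z <> 0 -> is_Cderive Cinv z (- / (z * z)).
Proof.
  intros Hz. apply is_Cderive_eps. intros eps.
  assert (Hz' : 0 < Cmod z) by now apply Cmod_gt_0.
  (* The first entry gives |w| > |z|/2, hence |w| |z|^2 > |z|^3 / 2; the second then makes the error
     |w-z| / (|w| |z|^2) at most eps. *)
  assert (Hp : 0 < Rmin (Cmod z / 2) (eps * (Cmod z ^ 3 / 2))).
  { apply Rmin_pos. lra. apply Rmult_lt_0_compat. apply cond_pos.
    assert (H := pow_lt (Cmod z) 3 Hz'). lra. }
  exists (mkposreal _ Hp). intros w Hw; simpl in Hw.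
  assert (H1 := Rlt_le_trans _ _ _ Hw (Rmin_l _ _)).
  assert (H2 := Rlt_le_trans _ _ _ Hw (Rmin_r _ _)).
  assert (H3 := Cinv_sub_bound z w Hz H1).
  assert (Hw0 : w <> 0) by (apply Cmod_gt_0; lra).
  replace (/ w - / z - - / (z * z) * (w - z))%C
    with ((w - z) * ((w - z) * / (w * (z * z))))%C by (field; tauto).
  rewrite !Cmod_mult, Cmod_inv by (repeat apply Cmult_neq_0; assumption).
  rewrite !Cmod_mult, (Rmult_comm eps).
  apply Rmult_le_compat_l. apply Cmod_ge_0.
  assert (H5 : Cmod z ^ 3 / 2 < Cmod w * (Cmod z * Cmod z)).
  { replace (Cmod z ^ 3 / 2) with (Cmod z / 2 * (Cmod z * Cmod z)) by (simpl pow; field).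
    apply Rmult_lt_compat_r; [ now apply Rmult_lt_0_compat | exact H3 ]. }
  assert (H6 : 0 < Cmod w * (Cmod z * Cmod z)).
  { repeat apply Rmult_lt_0_compat; lra. }
  apply Rmult_le_reg_r with (1 := H6).
  rewrite Rmult_assoc, Rinv_l, Rmult_1_r by lra.
  assert (He := cond_pos eps). nra.
Qed.

Lemma is_Cderive_inv (f : C -> C) (z l : C) : f z <> 0 ->
  is_Cderive f z l -> is_Cderive (fun w => / f w)%C z (- l / (f z * f z)).
Proof.
  intros H0 Hf. eapply is_Cderive_eq.
  - apply (is_Cderive_comp Cinv f z); [ now apply is_Cderive_Cinv | exact Hf ].
  - cbv beta; field. exact H0.
Qed.

Lemma is_Cderive_div (f g : C -> C) (z l m : C) : g z <> 0 ->
  is_Cderive f z l -> is_Cderive g z m ->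
  is_Cderive (fun w => f w / g w)%C z ((l * g z - f z * m) / (g z * g z)).
Proof.
  intros H0 Hf Hg. eapply is_Cderive_eq.
  - apply is_Cderive_mult; [ exact Hf | apply is_Cderive_inv; [ exact H0 | exact Hg ] ].
  - cbv beta; field. exact H0.
Qed.

Lemma is_Cderive_pow (f : C -> C) (z l : C) (n : nat) : is_Cderive f z l ->
  is_Cderive (fun w => Cpow (f w) (S n)) z (RtoC (INR (S n)) * Cpow (f z) n * l).
Proof.
  intros Hf. induction n as [|n IH].
  - apply (is_Cderive_ext f). { intros w; simpl; ring. }
    eapply is_Cderive_eq. exact Hf. simpl. ring.
  - apply (is_Cderive_ext (fun w => f w * Cpow (f w) (S n))%C). { intros w; reflexivity. }
    eapply is_Cderive_eq. apply is_Cderive_mult. exact Hf. exact IH.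
    cbv beta. rewrite (S_INR (S n)), RtoC_plus, (Cpow_S _ n). ring.
Qed.

Lemma is_derive_C_eps (g : R -> C) (s : R) (l : C) :
  is_derive (K := R_AbsRing) (V := C_R_NormedModule) g s l <->
  forall eps : posreal, exists delta : posreal, forall t : R,
    Rabs (t - s) < delta -> Cmod (g t - g s - RtoC (t - s) * l) <= eps * Rabs (t - s).
Proof.
  split.
  - intros [_ H] eps.
    destruct (H s (fun P HP => HP) eps) as [d Hd].
    exists d. intros w Hw.
    generalize (Hd w Hw). rewrite <- Cmod_norm.
    unfold minus, plus, opp; simpl. rewrite scal_R_Cmult. easy.
  - intros H. split.
    + apply is_linear_scal_l.
    + intros x Hx eps.
      assert (Hxz : s = x) by exact (is_filter_lim_locally_unique (V := R_NormedModule) s x Hx).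
      subst x.
      destruct (H eps) as [d Hd]. exists d. intros w Hw.
      generalize (Hd w Hw). rewrite <- Cmod_norm.
      unfold minus, plus, opp; simpl. rewrite scal_R_Cmult. easy.
Qed.

Lemma is_derive_C_continuous (g : R -> C) (s : R) (l : C) :
  is_derive (K := R_AbsRing) (V := C_R_NormedModule) g s l ->
  forall eps : posreal, exists delta : posreal,
  forall t, Rabs (t - s) < delta -> Cmod (g t - g s) < eps.
Proof.
  intros H eps. apply is_derive_C_eps with (eps := mkposreal 1 Rlt_0_1) in H.
  destruct H as [d Hd]; simpl in Hd.
  assert (Hl := Cmod_ge_0 l).
  assert (He : 0 < Rmin d (eps / (2 + Cmod l))).
  { apply Rmin_pos. apply cond_pos. apply Rdiv_lt_0_compat. apply cond_pos. lra. }
  exists (mkposreal _ He). intros w Hw; simpl in Hw.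
  assert (H1 := Rlt_le_trans _ _ _ Hw (Rmin_l _ _)).
  assert (H2 := Rlt_le_trans _ _ _ Hw (Rmin_r _ _)).
  specialize (Hd w H1).
  replace (g w - g s)%C with ((g w - g s - RtoC (w - s) * l) + RtoC (w - s) * l)%C by ring.
  eapply Rle_lt_trans. apply Cmod_triangle. rewrite Cmod_mult, Cmod_R.
  assert (H3 := Rabs_pos (w - s)).
  apply Rmult_lt_compat_r with (r := 2 + Cmod l) in H2; [ | lra ].
  unfold Rdiv in H2. rewrite Rmult_assoc, Rinv_l, Rmult_1_r in H2 by lra.
  nra.
Qed.

Lemma is_derive_C_comp (F : C -> C) (g : R -> C) (s : R) (l d : C) :
  is_Cderive F (g s) l ->
  is_derive (K := R_AbsRing) (V := C_R_NormedModule) g s d ->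
  is_derive (K := R_AbsRing) (V := C_R_NormedModule) (fun t => F (g t)) s (l * d)%C.
Proof.
  intros HF Hg. apply is_derive_C_eps. intros eps.
  assert (Hc := is_derive_C_continuous g s d Hg).
  rewrite is_derive_C_eps in Hg. rewrite is_Cderive_eps in HF.
  assert (Hl := Cmod_ge_0 l). assert (Hdm := Cmod_ge_0 d). assert (He := cond_pos eps).
  assert (He1 : 0 < eps / (2 * (1 + Cmod d))) by (apply Rdiv_lt_0_compat; lra).
  (* The entry 1 bounds |g t - g s| by (1 + |d|) |t - s|; the other one leaves eps/2 after
     multiplication by |l|. *)
  assert (He2 : 0 < Rmin 1 (eps / (2 * (1 + Cmod l)))).
  { apply Rmin_pos. lra. apply Rdiv_lt_0_compat; lra. }
  destruct (HF (mkposreal _ He1)) as [d1 H1].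
  destruct (Hg (mkposreal _ He2)) as [d2 H2].
  destruct (Hc d1) as [d3 H3].
  assert (Hp : 0 < Rmin d2 d3) by (apply Rmin_pos; apply cond_pos).
  exists (mkposreal _ Hp). intros t Ht; simpl in Ht, H1, H2.
  specialize (H2 t (Rlt_le_trans _ _ _ Ht (Rmin_l _ _))).
  specialize (H1 (g t) (H3 t (Rlt_le_trans _ _ _ Ht (Rmin_r _ _)))).
  clear H3 Hc HF Hg.
  set (D := Rabs (t - s)) in *. assert (HD : 0 <= D) by apply Rabs_pos.
  set (E := (g t - g s - (t - s)%R * d)%C) in *.
  assert (HE1 : Cmod E <= D).
  { eapply Rle_trans. exact H2. rewrite <- (Rmult_1_l D) at 2.
    apply Rmult_le_compat_r. exact HD. apply Rmin_l. }
  assert (HE2 : Cmod E <= eps / (2 * (1 + Cmod l)) * D).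
  { eapply Rle_trans. exact H2. apply Rmult_le_compat_r. exact HD. apply Rmin_r. }
  assert (Hg : Cmod (g t - g s) <= D * (1 + Cmod d)).
  { replace (g t - g s)%C with (E + (t - s)%R * d)%C by (unfold E; ring).
    eapply Rle_trans. apply Cmod_triangle. rewrite Cmod_mult, Cmod_R. fold D. lra. }
  replace (F (g t) - F (g s) - (t - s)%R * (l * d))%C
    with ((F (g t) - F (g s) - l * (g t - g s)) + l * E)%C by (unfold E; ring).
  eapply Rle_trans. apply Cmod_triangle. rewrite Cmod_mult.
  assert (A : Cmod l * Cmod E <= eps / 2 * D).
  { apply Rle_trans with (Cmod l * (eps / (2 * (1 + Cmod l)) * D)).
    apply Rmult_le_compat_l; assumption.
    apply Rle_trans with ((1 + Cmod l) * (eps / (2 * (1 + Cmod l)) * D)).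
    apply Rmult_le_compat_r; [ | lra ].
    apply Rmult_le_pos; [ | lra ]. left. apply Rdiv_lt_0_compat; lra.
    right. field. lra. }
  assert (B : eps / (2 * (1 + Cmod d)) * Cmod (g t - g s) <= eps / 2 * D).
  { eapply Rle_trans. apply Rmult_le_compat_l; [ lra | exact Hg ].
    right. field. lra. }
  lra.
Qed.

Lemma is_derive_Re (g : R -> C) (s : R) (l : C) :
  is_derive (K := R_AbsRing) (V := C_R_NormedModule) g s l ->
  is_derive (fun t => Re (g t)) s (Re l).
Proof.
  intros H. rewrite is_derive_C_eps in H. split. apply is_linear_scal_l.
  intros x Hx eps.
  assert (Hxz : s = x) by exact (is_filter_lim_locally_unique (V := R_NormedModule) s x Hx).
  subst x. destruct (H eps) as [d Hd]. exists d. intros t Ht.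
  specialize (Hd t Ht).
  change (Rabs ((Re (g t) - Re (g s)) - (t - s) * Re l) <= eps * Rabs (t - s)).
  eapply Rle_trans; [ | exact Hd ].
  eapply Rle_trans; [ | apply re_le_Cmod ].
  unfold Cminus. rewrite !re_plus, !re_opp, re_scal_l. right. reflexivity.
Qed.

Lemma is_derive_segment (a b : C) (s : R) :
  is_derive (K := R_AbsRing) (V := C_R_NormedModule)
    (fun t => a + RtoC t * (b - a))%C s (b - a)%C.
Proof.
  apply is_derive_C_eps. intros eps. exists eps. intros t _.
  replace (a + t * (b - a) - (a + s * (b - a)) - (t - s)%R * (b - a))%C with (RtoC 0)
    by (rewrite RtoC_minus; ring).
  rewrite Cmod_0. apply Rmult_le_pos. left; apply cond_pos. apply Rabs_pos.
Qed.

Lemma Cmod_mult_conj (u : C) : (Cconj u * u)%C = RtoC (Cmod u ^ 2).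
Proof. rewrite Cmod2_conj. ring. Qed.

(** The mean value theorem with equality fails for complex values. It is applied instead to the real
    function Re (conj u * f) along the segment, with u = f b - f a: its increment is |u|^2, and
    division by |u| gives the bound when u is nonzero. *)
Lemma mean_value_segment (f f' : C -> C) (a b : C) (M : R) :
  (forall t, 0 <= t <= 1 ->
     is_Cderive f (a + RtoC t * (b - a))%C (f' (a + RtoC t * (b - a))%C) /\
     Cmod (f' (a + RtoC t * (b - a))%C) <= M) ->
  Cmod (f b - f a) <= M * Cmod (b - a).
Proof.
  intros H.
  set (u := (f b - f a)%C).
  set (p := fun t : R => (a + RtoC t * (b - a))%C) in *.
  set (phi := fun t : R => Re (Cconj u * f (p t))).
  assert (Hphi : forall t, 0 <= t <= 1 ->
    is_derive phi t (Re (Cconj u * f' (p t) * (b - a)))).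
  { intros t Ht. unfold phi.
    apply (is_derive_Re (fun t => Cconj u * f (p t))%C).
    apply (is_derive_C_comp (fun w => Cconj u * f w)%C p).
    apply is_Cderive_scal. apply H, Ht. apply is_derive_segment. }
  assert (HM : 0 <= M).
  { destruct (H 0) as [_ H0]. lra. eapply Rle_trans. apply Cmod_ge_0. exact H0. }
  destruct (MVT_gen phi 0 1 (fun t => Re (Cconj u * f' (p t) * (b - a)))) as [c [Hc E]].
  { rewrite Rmin_left, Rmax_right by lra. intros x Hx. apply Hphi. lra. }
  { rewrite Rmin_left, Rmax_right by lra. intros x Hx.
    apply derivable_continuous_pt. exists (Re (Cconj u * f' (p x) * (b - a))).
    apply is_derive_Reals. now apply Hphi. }
  rewrite Rmin_left, Rmax_right in Hc by lra.
  assert (E2 : phi 1 - phi 0 = Cmod u ^ 2).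
  { unfold phi, p.
    replace (a + 1 * (b - a))%C with b by ring.
    replace (a + 0 * (b - a))%C with a by ring.
    replace (Re (Cconj u * f b) - Re (Cconj u * f a)) with (Re (Cconj u * u)).
    rewrite Cmod_mult_conj. reflexivity.
    unfold u at 2, Cminus. rewrite Cmult_plus_distr_l, re_plus.
    replace (Cconj u * - f a)%C with (- (Cconj u * f a))%C by ring.
    rewrite re_opp. ring. }
  rewrite E2 in E.
  assert (Hb : Re (Cconj u * f' (p c) * (b - a)) <= Cmod u * (M * Cmod (b - a))).
  { eapply Rle_trans. apply Rle_abs. eapply Rle_trans. apply re_le_Cmod.
    rewrite !Cmod_mult, Cmod_conj, Rmult_assoc.
    apply Rmult_le_compat_l. apply Cmod_ge_0.
    apply Rmult_le_compat_r. apply Cmod_ge_0. apply H, Hc. }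
  destruct (Cmod_ge_0 u) as [Hu | Hu].
  - apply Rmult_le_reg_l with (1 := Hu). nra.
  - rewrite <- Hu. apply Rmult_le_pos. exact HM. apply Cmod_ge_0.
Qed.

Definition Cconvex (U : C -> Prop) : Prop :=
  forall a b t, U a -> U b -> 0 <= t <= 1 -> U (a + RtoC t * (b - a))%C.

(** Takes the place of the identity theorem: the half-plane, vertical strips and discs are convex,
    so segments suffice to connect points. *)
Lemma is_Cderive_zero_const (U : C -> Prop) (f : C -> C) :
  Cconvex U -> (forall z, U z -> is_Cderive f z 0) ->
  forall a b, U a -> U b -> f a = f b.
Proof.
  intros HU Hf a b Ha Hb.
  assert (H : Cmod (f b - f a) <= 0 * Cmod (b - a)).
  { apply (mean_value_segment f (fun _ => RtoC 0)). intros t Ht. split.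
    apply Hf. now apply HU. rewrite Cmod_0. lra. }
  rewrite Rmult_0_l in H.
  assert (H2 := Cmod_ge_0 (f b - f a)).
  assert (H3 : (f b - f a)%C = 0) by (apply Cmod_eq_0; lra).
  symmetry. now apply Ceq_minus.
Qed.

Lemma Cconvex_H : Cconvex upper_half_plane.
Proof.
  intros a b t Ha Hb Ht. unfold upper_half_plane in *.
  unfold Cminus. rewrite im_plus, im_scal_l, im_plus, im_opp.
  assert (0 <= t * Im b) by (apply Rmult_le_pos; lra).
  assert (0 <= (1 - t) * Im a) by (apply Rmult_le_pos; lra).
  destruct (Req_dec t 0); [ subst; lra | ].
  assert (0 < t * Im b) by (apply Rmult_lt_0_compat; lra). lra.
Qed.

Lemma Cconvex_ball (c : C) (r : R) : Cconvex (fun z => Cmod (z - c) < r).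
Proof.
  intros a b t Ha Hb Ht.
  replace (a + t * (b - a) - c)%C with ((1 - t)%R * (a - c) + t * (b - c))%C
    by (rewrite RtoC_minus; ring).
  eapply Rle_lt_trans. apply Cmod_triangle. rewrite !Cmod_mult, !Cmod_R.
  rewrite !Rabs_pos_eq by lra.
  destruct (Req_dec t 0) as [-> | H0].
  - lra.
  - assert (t * Cmod (b - c) < t * r) by (apply Rmult_lt_compat_l; lra).
    assert ((1 - t) * Cmod (a - c) <= (1 - t) * r) by (apply Rmult_le_compat_l; lra).
    lra.
Qed.

(** * Complex sequences and series *)

(** The range is half open, so that the empty sum is available as base case; the library's
    [sum_n u n] has one more term. *)
Fixpoint csum (u : nat -> C) (n : nat) : C :=
  match n with
  | O => RtoC 0
  | S k => (csum u k + u k)%C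
  end.

Fixpoint rsum (u : nat -> R) (n : nat) : R :=
  match n with
  | O => 0
  | S k => rsum u k + u k
  end.

(** Stated through a real limit so that squeezing and real limit arithmetic apply directly. *)
Definition Cconv (u : nat -> C) (l : C) : Prop :=
  is_lim_seq (fun n => Cmod (u n - l)) 0.

Definition Csums (u : nat -> C) (l : C) : Prop := Cconv (csum u) l.

Lemma Cconv_squeeze (u : nat -> C) (l : C) (b : nat -> R) :
  (forall n, Cmod (u n - l) <= b n) -> is_lim_seq b 0 -> Cconv u l.
Proof.
  intros H Hb. apply (is_lim_seq_le_le (fun _ => 0) _ b); trivial.
  - intros n. split. apply Cmod_ge_0. apply H.
  - apply is_lim_seq_const.
Qed.

Lemma Cconv_ext (u v : nat -> C) (l : C) :
  (forall n, u n = v n) -> Cconv u l -> Cconv v l.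
Proof.
  intros H. apply is_lim_seq_ext. intros n. now rewrite H.
Qed.

Lemma Cconv_const (c : C) : Cconv (fun _ => c) c.
Proof.
  apply (is_lim_seq_ext (fun _ => 0)); [ | apply is_lim_seq_const ].
  intros n. unfold Cminus. rewrite Cplus_opp_r. symmetry. apply Cmod_0.
Qed.

Lemma is_lim_seq_plus0 (u v : nat -> R) :
  is_lim_seq u 0 -> is_lim_seq v 0 -> is_lim_seq (fun n => u n + v n) 0.
Proof.
  intros Hu Hv. replace 0 with (0 + 0) by ring. now apply is_lim_seq_plus'.
Qed.

Lemma is_lim_seq_scal0 (u : nat -> R) (c : R) :
  is_lim_seq u 0 -> is_lim_seq (fun n => c * u n) 0.
Proof.
  intros Hu. replace (Finite 0) with (Rbar_mult c 0) by (simpl; f_equal; ring).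
  now apply is_lim_seq_scal_l.
Qed.

Lemma Cconv_plus (u v : nat -> C) (l m : C) :
  Cconv u l -> Cconv v m -> Cconv (fun n => u n + v n)%C (l + m).
Proof.
  intros Hu Hv. eapply Cconv_squeeze; [ | exact (is_lim_seq_plus0 _ _ Hu Hv) ].
  intros n. replace (u n + v n - (l + m))%C with ((u n - l) + (v n - m))%C by ring.
  apply Cmod_triangle.
Qed.

Lemma Cconv_scal (c : C) (u : nat -> C) (l : C) :
  Cconv u l -> Cconv (fun n => c * u n)%C (c * l).
Proof.
  intros Hu. eapply Cconv_squeeze; [ | exact (is_lim_seq_scal0 _ (Cmod c) Hu) ].
  intros n. replace (c * u n - c * l)%C with (c * (u n - l))%C by ring.
  rewrite Cmod_mult. lra.
Qed.

Lemma Cconv_unique (u : nat -> C) (l m : C) : Cconv u l -> Cconv u m -> l = m.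
Proof.
  intros Hu Hv. apply Ceq_minus, Cmod_eq_0. apply Rle_antisym; [ | apply Cmod_ge_0 ].
  apply (is_lim_seq_le (fun _ => Cmod (l - m)) (fun n => Cmod (u n - l) + Cmod (u n - m))
    (Cmod (l - m)) 0).
  - intros n. replace (l - m)%C with ((u n - m) - (u n - l))%C by ring.
    rewrite Rplus_comm. apply Cmod_minus_le.
  - apply is_lim_seq_const.
  - now apply is_lim_seq_plus0.
Qed.

Lemma Cconv_subseq (u : nat -> C) (l : C) (phi : nat -> nat) :
  (forall n, (n <= phi n)%nat) -> Cconv u l -> Cconv (fun n => u (phi n)) l.
Proof.
  intros Hphi Hu. apply (is_lim_seq_subseq (fun n => Cmod (u n - l)) 0 phi); trivial.
  intros P [N HN]. exists N. intros n Hn. apply HN. specialize (Hphi n). lia.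
Qed.

Lemma Cconv_Re (u : nat -> C) (l : C) : Cconv u l -> is_lim_seq (fun n => Re (u n)) (Re l).
Proof.
  intros Hu. apply is_lim_seq_spec in Hu. apply is_lim_seq_spec. intros eps.
  destruct (Hu eps) as [N HN]. exists N. intros n Hn. specialize (HN n Hn).
  rewrite Rminus_0_r, Rabs_pos_eq in HN by apply Cmod_ge_0.
  eapply Rle_lt_trans; [ | exact HN ].
  replace (Re (u n) - Re l) with (Re (u n - l)) by
    (unfold Cminus; rewrite re_plus, re_opp; ring).
  apply re_le_Cmod.
Qed.

Lemma im_le_Cmod (c : C) : Rabs (Im c) <= Cmod c.
Proof. eapply Rle_trans; [ apply Rmax_r | apply Rmax_Cmod ]. Qed.

Lemma Cmod_le_Re_Im (c : C) : Cmod c <= Rabs (Re c) + Rabs (Im c).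
Proof.
  rewrite <- !Cmod_R. rewrite <- (Rmult_1_r (Cmod (Im c))), <- Cmod_Ci, <- Cmod_mult.
  replace c with (Re c + Im c * Ci)%C at 1. apply Cmod_triangle.
  destruct c as [x y]. unfold Cplus, Cmult, Ci, RtoC, Re, Im; simpl. f_equal; ring.
Qed.

Lemma Cconv_Im (u : nat -> C) (l : C) : Cconv u l -> is_lim_seq (fun n => Im (u n)) (Im l).
Proof.
  intros Hu. apply is_lim_seq_spec in Hu. apply is_lim_seq_spec. intros eps.
  destruct (Hu eps) as [N HN]. exists N. intros n Hn. specialize (HN n Hn).
  rewrite Rminus_0_r, Rabs_pos_eq in HN by apply Cmod_ge_0.
  eapply Rle_lt_trans; [ | exact HN ].
  replace (Im (u n) - Im l) with (Im (u n - l)) by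
    (unfold Cminus; rewrite im_plus, im_opp; ring).
  apply im_le_Cmod.
Qed.

Lemma Cconv_Re_Im (u : nat -> C) (l : C) :
  is_lim_seq (fun n => Re (u n)) (Re l) -> is_lim_seq (fun n => Im (u n)) (Im l) ->
  Cconv u l.
Proof.
  intros H1 H2.
  assert (A : forall (v : nat -> R) (x : R), is_lim_seq v x -> is_lim_seq (fun n => Rabs (v n - x)) 0).
  { intros v x Hv. replace (Finite 0) with (Rbar_abs 0) by (simpl; now rewrite Rabs_R0).
    apply is_lim_seq_abs. replace 0 with (x - x) by ring.
    apply is_lim_seq_minus'. exact Hv. apply is_lim_seq_const. }
  eapply Cconv_squeeze; [ | exact (is_lim_seq_plus0 _ _ (A _ _ H1) (A _ _ H2)) ].
  intros n. eapply Rle_trans. apply Cmod_le_Re_Im.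
  unfold Cminus; rewrite re_plus, re_opp, im_plus, im_opp. apply Rle_refl.
Qed.

Lemma C_lim_seq_unique (u : nat -> C) (l : C) : Cconv u l -> C_lim_seq u = l.
Proof.
  intros H. unfold C_lim_seq.
  rewrite (is_lim_seq_unique _ _ (Cconv_Re _ _ H)), (is_lim_seq_unique _ _ (Cconv_Im _ _ H)).
  simpl. now destruct l.
Qed.

Lemma Cconv_continuous (f : C -> C) (u : nat -> C) (l d : C) :
  is_Cderive f l d -> Cconv u l -> Cconv (fun n => f (u n)) (f l).
Proof.
  intros Hf Hu. assert (Hc := is_Cderive_continuous f l d Hf).
  apply is_lim_seq_spec in Hu. apply is_lim_seq_spec. intros eps.
  destruct (Hc eps) as [del Hdel]. destruct (Hu del) as [N HN].
  exists N. intros n Hn. specialize (HN n Hn). simpl in HN |- *.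
  rewrite Rminus_0_r, Rabs_pos_eq in HN |- * by apply Cmod_ge_0. now apply Hdel.
Qed.

(** Polarization: 4ab = (a+b)^2 - (a-b)^2 reduces products to squares, and squaring is continuous
    because it is differentiable. *)
Lemma Cconv_mult (u v : nat -> C) (l m : C) :
  Cconv u l -> Cconv v m -> Cconv (fun n => u n * v n)%C (l * m).
Proof.
  intros Hu Hv.
  assert (Hp : forall a b : C, (a * b)%C = (((a + b) * (a + b) - (a - b) * (a - b)) * RtoC (/ 4)%R)%C).
  { intros a b. rewrite RtoC_inv by lra. field. }
  assert (Hsq : forall w k, Cconv w k -> Cconv (fun n => w n * w n)%C (k * k)).
  { intros w k Hw. eapply (Cconv_continuous (fun z => z * z)%C); [ | exact Hw ].
    apply is_Cderive_mult; apply is_Cderive_id. }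
  assert (Hm : Cconv (fun n => u n - v n)%C (l - m)).
  { apply (Cconv_ext (fun n => u n + -(1) * v n)%C). intros n; ring.
    replace (l - m)%C with (l + -(1) * m)%C by ring.
    apply Cconv_plus. exact Hu. now apply Cconv_scal. }
  rewrite (Hp l m).
  apply (Cconv_ext (fun n => RtoC (/ 4)%R * ((u n + v n) * (u n + v n) + (- (1)) * ((u n - v n) * (u n - v n))))%C).
  { intros n. rewrite (Hp (u n)). ring. }
  replace (((l + m) * (l + m) - (l - m) * (l - m)) * RtoC (/ 4)%R)%C with
    (RtoC (/ 4)%R * ((l + m) * (l + m) + (- (1)) * ((l - m) * (l - m))))%C by ring.
  apply Cconv_scal, Cconv_plus; [ | apply Cconv_scal ]; apply Hsq; trivial.
  now apply Cconv_plus.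
Qed.

Lemma csum_ext_lt (u v : nat -> C) (n : nat) :
  (forall k, (k < n)%nat -> u k = v k) -> csum u n = csum v n.
Proof.
  induction n as [|n IH]; intros H; simpl. reflexivity.
  rewrite IH, (H n) by (intros; try apply H; lia). reflexivity.
Qed.

Lemma csum_ext (u v : nat -> C) (n : nat) :
  (forall k, u k = v k) -> csum u n = csum v n.
Proof. intros H. apply csum_ext_lt. auto. Qed.

Lemma csum_plus (u v : nat -> C) (n : nat) :
  csum (fun k => u k + v k)%C n = (csum u n + csum v n)%C.
Proof. induction n as [|n IH]; simpl; [ ring | rewrite IH; ring ]. Qed.

Lemma csum_scal (c : C) (u : nat -> C) (n : nat) :
  csum (fun k => c * u k)%C n = (c * csum u n)%C.
Proof. induction n as [|n IH]; simpl; [ ring | rewrite IH; ring ]. Qed.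

Lemma csum_S (u : nat -> C) (n : nat) : csum u (S n) = (u O + csum (fun k => u (S k)) n)%C.
Proof.
  induction n as [|n IH]. simpl; ring.
  change (csum u (S (S n))) with (csum u (S n) + u (S n))%C. rewrite IH. simpl. ring.
Qed.

Lemma rsum_S (u : nat -> R) (n : nat) : rsum u (S n) = u O + rsum (fun k => u (S k)) n.
Proof.
  induction n as [|n IH]. simpl; ring.
  change (rsum u (S (S n))) with (rsum u (S n) + u (S n)). rewrite IH. simpl. ring.
Qed.

Lemma csum_Re (u : nat -> C) (n : nat) : Re (csum u n) = rsum (fun k => Re (u k)) n.
Proof. induction n as [|n IH]; simpl csum; simpl rsum; [ reflexivity | rewrite re_plus, IH; reflexivity ]. Qed.

Lemma csum_Im (u : nat -> C) (n : nat) : Im (csum u n) = rsum (fun k => Im (u k)) n.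
Proof. induction n as [|n IH]; simpl csum; simpl rsum; [ reflexivity | rewrite im_plus, IH; reflexivity ]. Qed.

Lemma rsum_sum_n (u : nat -> R) (n : nat) : sum_n u n = rsum u (S n).
Proof.
  induction n as [|n IH].
  - rewrite sum_O. simpl. ring.
  - rewrite sum_Sn, IH. reflexivity.
Qed.

Lemma is_series_rsum (u : nat -> R) (l : R) : is_series u l <-> is_lim_seq (rsum u) l.
Proof.
  split; intros H.
  - apply is_lim_seq_incr_1. apply (is_lim_seq_ext (sum_n u)); [ apply rsum_sum_n | exact H ].
  - apply is_lim_seq_incr_1 in H.
    apply (is_lim_seq_ext _ (sum_n u)) in H; [ exact H | intros n; symmetry; apply rsum_sum_n ].
Qed.

(** [C_series] is a total function whose value means something only under convergence; this is how
    proved sums reach the given definitions. *)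
Lemma Csums_series (u : nat -> C) (l : C) : Csums u l -> C_series u = l.
Proof.
  intros H. unfold C_series.
  assert (H1 := Cconv_Re _ _ H). assert (H2 := Cconv_Im _ _ H).
  rewrite (is_series_unique _ (Re l)), (is_series_unique _ (Im l)).
  - now destruct l.
  - apply is_series_rsum. revert H2. apply is_lim_seq_ext. intros n; apply csum_Im.
  - apply is_series_rsum. revert H1. apply is_lim_seq_ext. intros n; apply csum_Re.
Qed.

Lemma Csums_unique (u : nat -> C) (l m : C) : Csums u l -> Csums u m -> l = m.
Proof. apply Cconv_unique. Qed.

Lemma Csums_ext (u v : nat -> C) (l : C) : (forall n, u n = v n) -> Csums u l -> Csums v l.
Proof. intros H. apply Cconv_ext. intros n. now apply csum_ext. Qed.

Lemma Csums_plus (u v : nat -> C) (l m : C) :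
  Csums u l -> Csums v m -> Csums (fun n => u n + v n)%C (l + m).
Proof.
  intros Hu Hv. apply (Cconv_ext (fun n => csum u n + csum v n)%C).
  - intros n. now rewrite csum_plus.
  - now apply Cconv_plus.
Qed.

Lemma Csums_scal (c : C) (u : nat -> C) (l : C) :
  Csums u l -> Csums (fun n => c * u n)%C (c * l).
Proof.
  intros Hu. apply (Cconv_ext (fun n => c * csum u n)%C).
  - intros n. now rewrite csum_scal.
  - now apply Cconv_scal.
Qed.

Lemma Csums_minus (u v : nat -> C) (l m : C) :
  Csums u l -> Csums v m -> Csums (fun n => u n - v n)%C (l - m).
Proof.
  intros Hu Hv. replace (l - m)%C with (l + - (1) * m)%C by ring.
  apply (Csums_ext (fun n => u n + - (1) * v n)%C). intros n; ring.
  apply Csums_plus. exact Hu. now apply Csums_scal.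
Qed.

Lemma csum_diff_bound (u : nat -> C) (b : nat -> R) (n k : nat) :
  (forall i, Cmod (u i) <= b i) ->
  Cmod (csum u (n + k) - csum u n) <= rsum b (n + k) - rsum b n.
Proof.
  intros H. induction k as [|k IH].
  - rewrite Nat.add_0_r. unfold Cminus. rewrite Cplus_opp_r, Cmod_0. lra.
  - rewrite Nat.add_succ_r. simpl.
    replace (csum u (n + k) + u (n + k)%nat - csum u n)%C
      with ((csum u (n + k) - csum u n) + u (n + k)%nat)%C by ring.
    eapply Rle_trans. apply Cmod_triangle. specialize (H (n + k)%nat). lra.
Qed.

Lemma rsum_incr (b : nat -> R) (n k : nat) : (forall i, 0 <= b i) -> rsum b n <= rsum b (n + k).
Proof.
  intros H. induction k as [|k IH].
  - rewrite Nat.add_0_r. lra.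
  - rewrite Nat.add_succ_r. simpl. specialize (H (n + k)%nat). lra.
Qed.

Lemma rsum_le_lim (b : nat -> R) (B : R) (n : nat) : (forall i, 0 <= b i) ->
  is_series b B -> rsum b n <= B.
Proof.
  intros H HB. apply is_series_rsum in HB.
  apply (is_lim_seq_incr_n _ n) in HB.
  apply (is_lim_seq_le (fun _ => rsum b n) _ (rsum b n) B) with (3 := HB).
  - intros k. rewrite Nat.add_comm. now apply rsum_incr.
  - apply is_lim_seq_const.
Qed.

Lemma rsum_tail (b : nat -> R) (B : R) : is_series b B -> is_lim_seq (fun n => B - rsum b n) 0.
Proof.
  intros H. replace 0 with (B - B) by ring. apply is_lim_seq_minus'.
  apply is_lim_seq_const. now apply is_series_rsum.
Qed.

Lemma Cconv_norm_le (u : nat -> C) (l c : C) (M : R) (N : nat) :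
  Cconv u l -> (forall n, (N <= n)%nat -> Cmod (u n - c) <= M) -> Cmod (l - c) <= M.
Proof.
  (* The bound is put in the form 0 + M, the limit of the sum used just below. *)
  rewrite <- (Rplus_0_l M).
  intros Hu H.
  apply (is_lim_seq_le (fun _ => Cmod (l - c)) (fun n => Cmod (u (n + N)%nat - l) + M)
    (Cmod (l - c)) (0 + M)).
  - intros n. replace (l - c)%C with ((u (n + N)%nat - c) - (u (n + N)%nat - l))%C by ring.
    eapply Rle_trans. apply Cmod_minus_le. assert (H1 := H (n + N)%nat ltac:(lia)). lra.
  - apply is_lim_seq_const.
  - apply is_lim_seq_plus'; [ | apply is_lim_seq_const ].
    now apply (is_lim_seq_incr_n (fun n => Cmod (u n - l))).
Qed.

Lemma Csums_tail_le (u : nat -> C) (b : nat -> R) (l : C) (B : R) (n : nat) :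
  (forall i, Cmod (u i) <= b i) -> is_series b B -> Csums u l ->
  Cmod (l - csum u n) <= B - rsum b n.
Proof.
  intros H HB Hl. apply (Cconv_norm_le (csum u) l _ _ n Hl).
  intros m Hm. replace m with (n + (m - n))%nat by lia.
  eapply Rle_trans. apply csum_diff_bound, H.
  assert (Hb : forall i, 0 <= b i) by (intros i; eapply Rle_trans; [ apply Cmod_ge_0 | apply H ]).
  assert (H1 := rsum_le_lim b B (n + (m - n)) Hb HB). lra.
Qed.

Lemma Csums_le (u : nat -> C) (b : nat -> R) (l : C) (B : R) :
  (forall i, Cmod (u i) <= b i) -> is_series b B -> Csums u l -> Cmod l <= B.
Proof.
  intros H HB Hl. generalize (Csums_tail_le u b l B 0 H HB Hl). simpl.
  replace (l - 0)%C with l by ring. lra.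
Qed.

Lemma Csums_dominated (u : nat -> C) (b : nat -> R) :
  (forall i, Cmod (u i) <= b i) -> ex_series b -> exists l, Csums u l.
Proof.
  intros H Hb.
  assert (H1 : ex_series (fun n => Re (u n))).
  { apply (ex_series_le (V := R_CompleteNormedModule) _ b); [ | exact Hb ].
    intros n. eapply Rle_trans; [ apply re_le_Cmod | apply H ]. }
  assert (H2 : ex_series (fun n => Im (u n))).
  { apply (ex_series_le (V := R_CompleteNormedModule) _ b); [ | exact Hb ].
    intros n. eapply Rle_trans; [ apply im_le_Cmod | apply H ]. }
  destruct H1 as [x Hx]. destruct H2 as [y Hy]. exists (x, y).
  apply Cconv_Re_Im.
  - apply is_series_rsum in Hx. revert Hx. apply is_lim_seq_ext. intros n. now rewrite csum_Re.
  - apply is_series_rsum in Hy. revert Hy. apply is_lim_seq_ext. intros n. now rewrite csum_Im.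
Qed.

Lemma csum_Cmod_le (u : nat -> C) (b : nat -> R) (n : nat) :
  (forall i, Cmod (u i) <= b i) -> Cmod (csum u n) <= rsum b n.
Proof.
  intros H. generalize (csum_diff_bound u b 0 n H). simpl.
  replace (csum u n - 0)%C with (csum u n) by ring. lra.
Qed.

Lemma csum_switch (a : nat -> nat -> C) (M N : nat) :
  csum (fun m => csum (a m) N) M = csum (fun n => csum (fun m => a m n) M) N.
Proof.
  induction M as [|M IH]; simpl.
  - induction N as [|N IHN]; simpl; [ reflexivity | rewrite <- IHN; ring ].
  - rewrite IH. rewrite <- csum_plus. apply csum_ext. reflexivity.
Qed.

Lemma rsum_scal (c : R) (b : nat -> R) (n : nat) : rsum (fun k => c * b k) n = c * rsum b n.
Proof. induction n as [|n IH]; simpl; [ ring | rewrite IH; ring ]. Qed.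

(* Both iterated sums are the limit of the sums over the squares [0, N) x [0, N). *)
Lemma Csums_square (a : nat -> nat -> C) (al be : nat -> R) (r : nat -> C) :
  (forall m n, Cmod (a m n) <= al m * be n) ->
  (forall m, 0 <= al m) -> (forall n, 0 <= be n) -> ex_series al -> ex_series be ->
  (forall m, Csums (a m) (r m)) ->
  exists s, Csums r s /\ Cconv (fun N => csum (fun m => csum (a m) N) N) s.
Proof.
  intros Ha Hal0 Hbe0 [A HA] [B HB] Hr.
  assert (Hser : forall m, is_series (fun n => al m * be n) (al m * B)).
  { intros m. apply (is_series_scal (al m) be B HB). }
  assert (Hrm : forall m, Cmod (r m) <= B * al m).
  { intros m. rewrite Rmult_comm. apply (Csums_le (a m) _ _ _ (Ha m) (Hser m) (Hr m)). }
  destruct (Csums_dominated r (fun m => B * al m) Hrm) as [s Hs].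
  { exists (B * A). apply (is_series_scal B al A HA). }
  exists s. split. exact Hs.
  assert (Hd : is_lim_seq (fun N => A * (B - rsum be N) + Cmod (csum r N - s)) 0).
  { apply is_lim_seq_plus0. now apply is_lim_seq_scal0, rsum_tail. exact Hs. }
  eapply Cconv_squeeze; [ | exact Hd ]. intros N. cbv beta.
  replace (csum (fun m => csum (a m) N) N - s)%C
    with ((csum (fun m => csum (a m) N) N - csum r N) + (csum r N - s))%C by ring.
  eapply Rle_trans. apply Cmod_triangle. apply Rplus_le_compat_r.
  replace (csum (fun m => csum (a m) N) N - csum r N)%C
    with (csum (fun m => csum (a m) N + - (1) * r m)%C N)
    by (rewrite csum_plus, csum_scal; ring).
  eapply Rle_trans. apply (csum_Cmod_le _ (fun m => (B - rsum be N) * al m)).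
  { intros m. rewrite <- Cmod_opp.
    replace (- (csum (a m) N + - (1) * r m))%C with (r m - csum (a m) N)%C by ring.
    eapply Rle_trans. apply (Csums_tail_le (a m) _ _ _ N (Ha m) (Hser m) (Hr m)).
    rewrite rsum_scal. lra. }
  rewrite rsum_scal, Rmult_comm. apply Rmult_le_compat_r.
  - assert (H := rsum_le_lim be B N Hbe0 HB). lra.
  - now apply rsum_le_lim.
Qed.

(** A product majorant is more than absolute summability, but every double family below has one, and
    with it both iterated sums are compared with the same square partial sums, which are symmetric
    in the two indices. *)
Theorem Csums_Fubini (a : nat -> nat -> C) (al be : nat -> R) (r c : nat -> C) :
  (forall m n, Cmod (a m n) <= al m * be n) ->
  (forall m, 0 <= al m) -> (forall n, 0 <= be n) -> ex_series al -> ex_series be ->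
  (forall m, Csums (a m) (r m)) -> (forall n, Csums (fun m => a m n) (c n)) ->
  exists s, Csums r s /\ Csums c s.
Proof.
  intros Ha Hal0 Hbe0 HA HB Hr Hc.
  destruct (Csums_square a al be r) as [s [H1 H2]]; trivial.
  destruct (Csums_square (fun n m => a m n) be al c) as [s' [H3 H4]]; trivial.
  { intros m n. rewrite Rmult_comm. apply Ha. }
  exists s. split. exact H1.
  replace s with s'. exact H3.
  apply (Cconv_unique _ _ _ H4). revert H2. apply Cconv_ext. intros N. apply csum_switch.
Qed.

Lemma csum_derive (f : nat -> C -> C) (f' : nat -> C) (z : C) (n : nat) :
  (forall k, is_Cderive (f k) z (f' k)) ->
  is_Cderive (fun w => csum (fun k => f k w) n) z (csum f' n).
Proof.
  intros H. induction n as [|n IH]; simpl. apply is_Cderive_const.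
  now apply is_Cderive_plus.
Qed.

(** The mean value inequality applied to each term makes the tail of the series Lipschitz, with
    constant the tail of [M]; the finite part is differentiated term by term. *)
Lemma Csums_derive (f f' : nat -> C -> C) (F : C -> C) (z0 l : C) (r : R) (M : nat -> R) :
  0 < r ->
  (forall n z, Cmod (z - z0) < r -> is_Cderive (f n) z (f' n z) /\ Cmod (f' n z) <= M n) ->
  ex_series M ->
  (forall z, Cmod (z - z0) < r -> Csums (fun n => f n z) (F z)) ->
  Csums (fun n => f' n z0) l ->
  is_Cderive F z0 l.
Proof.
  intros Hr Hf [B HB] HF Hl. apply is_Cderive_eps. intros eps.
  assert (He := cond_pos eps).
  assert (H00 : Cmod (z0 - z0) < r) by (unfold Cminus; rewrite Cplus_opp_r, Cmod_0; exact Hr).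
  assert (HM : forall i, 0 <= M i).
  { intros i. eapply Rle_trans. apply Cmod_ge_0. apply (Hf i z0 H00). }
  assert (Ht := rsum_tail M B HB).
  (* The tail enters twice, through the increments and through the derivatives, at eps/4 each; the
     finite sum takes the remaining eps/2. *)
  apply is_lim_seq_spec in Ht. destruct (Ht (pos_div_2 (pos_div_2 eps))) as [K HK].
  specialize (HK K (Nat.le_refl _)). simpl in HK.
  rewrite Rminus_0_r in HK.
  assert (HK0 := rsum_le_lim M B K HM HB). rewrite Rabs_pos_eq in HK by lra.
  assert (Hd : is_Cderive (fun w => csum (fun k => f k w) K) z0 (csum (fun k => f' k z0) K)).
  { apply csum_derive. intros k. apply Hf, H00. }
  rewrite is_Cderive_eps in Hd. destruct (Hd (pos_div_2 eps)) as [d Hd'].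
  assert (Hp : 0 < Rmin d r) by (apply Rmin_pos; [ apply cond_pos | exact Hr ]).
  exists (mkposreal _ Hp). intros w Hw; simpl in Hw.
  specialize (Hd' w (Rlt_le_trans _ _ _ Hw (Rmin_l _ _))). simpl in Hd'.
  assert (Hwr := Rlt_le_trans _ _ _ Hw (Rmin_r _ _)).
  assert (H1 : Cmod ((F w - F z0) - (csum (fun k => f k w) K - csum (fun k => f k z0) K))
               <= (B - rsum M K) * Cmod (w - z0)).
  { set (g := fun k => (f k w + - (1) * f k z0)%C).
    assert (Hg : Csums g (F w - F z0)).
    { replace (F w - F z0)%C with (F w + - (1) * F z0)%C by ring.
      apply Csums_plus; [ | apply Csums_scal ]; now apply HF. }
    replace (csum (fun k => f k w) K - csum (fun k => f k z0) K)%C with (csum g K)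
      by (unfold g; rewrite csum_plus, csum_scal; ring).
    rewrite Rmult_minus_distr_r, (Rmult_comm _ (Cmod (w - z0))), (Rmult_comm (rsum M K)).
    rewrite <- rsum_scal.
    apply (Csums_tail_le g).
    - intros k. unfold g. replace (f k w + - (1) * f k z0)%C with (f k w - f k z0)%C by ring.
      rewrite Rmult_comm. apply (mean_value_segment (f k) (f' k)).
      intros t Ht'. apply Hf. now apply (Cconvex_ball z0 r).
    - apply (is_series_scal (Cmod (w - z0)) M B HB).
    - exact Hg. }
  assert (H2 : Cmod (l - csum (fun k => f' k z0) K) <= B - rsum M K).
  { apply Csums_tail_le; trivial. intros i. now apply Hf. }
  replace (F w - F z0 - l * (w - z0))%C with
    (((F w - F z0) - (csum (fun k => f k w) K - csum (fun k => f k z0) K))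
     + ((csum (fun k => f k w) K - csum (fun k => f k z0) K
         - csum (fun k => f' k z0) K * (w - z0))
     - (l - csum (fun k => f' k z0) K) * (w - z0)))%C by ring.
  eapply Rle_trans. apply Cmod_triangle.
  assert (H3 := Cmod_minus_le (csum (fun k => f k w) K - csum (fun k => f k z0) K
         - csum (fun k => f' k z0) K * (w - z0)) ((l - csum (fun k => f' k z0) K) * (w - z0))).
  rewrite Cmod_mult in H3.
  assert (H4 := Cmod_ge_0 (w - z0)).
  assert (H5 := Rmult_le_compat_r _ _ _ H4 H2).
  nra.
Qed.

(** * The exponential, the nome and q-series *)

Lemma C_ext (a b : C) : Re a = Re b -> Im a = Im b -> a = b.
Proof. destruct a, b. unfold Re, Im. simpl. now intros -> ->. Qed.

Lemma C_exp_plus (a b : C) : C_exp (a + b) = (C_exp a * C_exp b)%C.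
Proof.
  unfold C_exp. rewrite re_plus, im_plus, exp_plus, cos_plus, sin_plus.
  apply C_ext; unfold Re, Im, Cmult; simpl; ring.
Qed.

Lemma C_exp_0 : C_exp 0 = 1.
Proof. unfold C_exp. simpl. rewrite exp_0, cos_0, sin_0. apply C_ext; simpl; ring. Qed.

Lemma Cmod_exp (z : C) : Cmod (C_exp z) = exp (Re z).
Proof.
  unfold Cmod, C_exp. simpl fst; simpl snd.
  replace ((exp (Re z) * cos (Im z)) ^ 2 + (exp (Re z) * sin (Im z)) ^ 2)
    with (exp (Re z) * exp (Re z)).
  - apply sqrt_square. left; apply exp_pos.
  - generalize (sin2_cos2 (Im z)). unfold Rsqr. intros H.
    transitivity (exp (Re z) * exp (Re z) * (sin (Im z) * sin (Im z) + cos (Im z) * cos (Im z))).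
    rewrite H; ring. ring.
Qed.

Lemma C_exp_nz (z : C) : C_exp z <> 0.
Proof. apply Cmod_gt_0. rewrite Cmod_exp. apply exp_pos. Qed.

Lemma C_exp_opp (z : C) : C_exp (- z) = (/ C_exp z)%C.
Proof.
  assert (H : (C_exp z * C_exp (- z))%C = 1) by (rewrite <- C_exp_plus, Cplus_opp_r; apply C_exp_0).
  assert (Hz := C_exp_nz z).
  transitivity (/ C_exp z * (C_exp z * C_exp (- z)))%C. field; exact Hz. rewrite H; ring.
Qed.

Lemma C_exp_pow (z : C) (n : nat) : Cpow (C_exp z) n = C_exp (RtoC (INR n) * z).
Proof.
  induction n as [|n IH].
  - simpl. rewrite Cmult_0_l. symmetry; apply C_exp_0.
  - rewrite Cpow_S, IH, <- C_exp_plus, S_INR, RtoC_plus. f_equal. ring.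
Qed.

Lemma exp_le_mono (x y : R) : x <= y -> exp x <= exp y.
Proof. intros [H | ->]; [ left; now apply exp_increasing | apply Rle_refl ]. Qed.

Lemma is_derive_eps_R (f : R -> R) (x l : R) : is_derive f x l ->
  forall eps : posreal, exists delta : posreal, forall t : R,
    Rabs (t - x) < delta -> Rabs (f t - f x - (t - x) * l) <= eps * Rabs (t - x).
Proof.
  intros [_ H] eps. destruct (H x (fun P HP => HP) eps) as [d Hd].
  exists d. exact Hd.
Qed.

Lemma is_Cderive_exp_0 : is_Cderive C_exp 0 1.
Proof.
  apply is_Cderive_eps. intros eps.
  assert (He := cond_pos eps).
  (* The four error terms below add up to (1 + 3 + 3 + 2) e |w| = 9 e |w|. *)
  assert (He1 : 0 < Rmin 1 (eps / 10)) by (apply Rmin_pos; lra).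
  set (e := mkposreal _ He1).
  assert (E1 : e <= 1) by (unfold e; simpl; apply Rmin_l).
  assert (E2 : e <= eps / 10) by (unfold e; simpl; apply Rmin_r).
  assert (Hexp : is_derive exp 0 1) by (replace 1 with (exp 0) by apply exp_0; apply is_derive_exp).
  assert (Hcos : is_derive cos 0 0) by (replace 0 with (- sin 0) at 2 by (rewrite sin_0; ring); apply is_derive_cos).
  assert (Hsin : is_derive sin 0 1) by (rewrite <- cos_0; apply is_derive_sin).
  destruct (is_derive_eps_R _ _ _ Hexp e) as [d1 H1].
  destruct (is_derive_eps_R _ _ _ Hcos e) as [d2 H2].
  destruct (is_derive_eps_R _ _ _ Hsin e) as [d3 H3].
  assert (Hd : 0 < Rmin (Rmin d1 d2) (Rmin d3 e)).
  { apply Rmin_pos; apply Rmin_pos; apply cond_pos. }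
  exists (mkposreal _ Hd). intros w Hw; simpl in Hw.
  replace (w - 0)%C with w in * by ring.
  assert (A1 : Cmod w < d1) by (eapply Rlt_le_trans; [ exact Hw | eapply Rle_trans; [ apply Rmin_l | apply Rmin_l ] ]).
  assert (A2 : Cmod w < d2) by (eapply Rlt_le_trans; [ exact Hw | eapply Rle_trans; [ apply Rmin_l | apply Rmin_r ] ]).
  assert (A3 : Cmod w < d3) by (eapply Rlt_le_trans; [ exact Hw | eapply Rle_trans; [ apply Rmin_r | apply Rmin_l ] ]).
  assert (A4 : Cmod w < e) by (eapply Rlt_le_trans; [ exact Hw | eapply Rle_trans; [ apply Rmin_r | apply Rmin_r ] ]).
  assert (Hx := re_le_Cmod w). assert (Hy := im_le_Cmod w).
  specialize (H1 (Re w)). specialize (H2 (Im w)). specialize (H3 (Im w)).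
  rewrite Rminus_0_r in H1, H2, H3. rewrite exp_0 in H1. rewrite cos_0 in H2. rewrite sin_0 in H3.
  specialize (H1 ltac:(lra)). specialize (H2 ltac:(lra)). specialize (H3 ltac:(lra)).
  set (x := Re w) in *. set (y := Im w) in *.
  rewrite C_exp_0.
  eapply Rle_trans. apply Cmod_le_Re_Im.
  replace (Re (C_exp w - 1 - 1 * w)) with ((exp x - 1 - x * 1) + exp x * (cos y - 1 - y * 0))
    by (unfold x, y; destruct w; unfold Re, Im, C_exp, Cminus, Cplus, Copp, Cmult; simpl; unfold Re, Im; simpl; ring).
  replace (Im (C_exp w - 1 - 1 * w)) with (exp x * (sin y - 0 - y * 1) + (exp x - 1) * y)
    by (unfold x, y; destruct w; unfold Re, Im, C_exp, Cminus, Cplus, Copp, Cmult; simpl; unfold Re, Im; simpl; ring).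
  assert (B1 := Rabs_triang (exp x - 1 - x * 1) (exp x * (cos y - 1 - y * 0))).
  assert (B2 := Rabs_triang (exp x * (sin y - 0 - y * 1)) ((exp x - 1) * y)).
  rewrite !Rabs_mult in B1, B2. rewrite (Rabs_mult (exp x - 1) y) in B2.
  rewrite (Rabs_pos_eq (exp x)) in B1, B2 by (left; apply exp_pos).
  assert (Hm := Cmod_ge_0 w).
  assert (Hpe := cond_pos e).
  assert (Bx : Rabs (exp x - 1) <= 2 * e).
  { replace (exp x - 1) with ((exp x - 1 - x * 1) + x) by ring.
    eapply Rle_trans. apply Rabs_triang. nra. }
  assert (Bx2 : exp x <= 3) by (apply Rabs_le_between in Bx; lra).
  assert (Bx0 := exp_pos x).
  assert (P2 := Rabs_pos (cos y - 1 - y * 0)). assert (P3 := Rabs_pos (sin y - 0 - y * 1)).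
  assert (Px := Rabs_pos x). assert (Py := Rabs_pos y). assert (Pe := Rabs_pos (exp x - 1)).
  assert (Q1 : exp x * Rabs (cos y - 1 - y * 0) <= 3 * (e * Cmod w)).
  { apply Rmult_le_compat; try lra. eapply Rle_trans; [ exact H2 | ]. apply Rmult_le_compat_l; lra. }
  assert (Q2 : exp x * Rabs (sin y - 0 - y * 1) <= 3 * (e * Cmod w)).
  { apply Rmult_le_compat; try lra. eapply Rle_trans; [ exact H3 | ]. apply Rmult_le_compat_l; lra. }
  assert (Q3 : Rabs (exp x - 1) * Rabs y <= 2 * e * Cmod w).
  { apply Rmult_le_compat; lra. }
  assert (Q4 : e * Rabs x <= e * Cmod w) by (apply Rmult_le_compat_l; lra).
  assert (Q5 : e * Cmod w <= eps / 10 * Cmod w) by (apply Rmult_le_compat_r; lra).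
  assert (Q6 : 0 <= eps * Cmod w) by (apply Rmult_le_pos; lra).
  lra.
Qed.

Lemma is_Cderive_exp (z : C) : is_Cderive C_exp z (C_exp z).
Proof.
  apply (is_Cderive_ext (fun w => C_exp z * C_exp (w - z))%C).
  { intros w. rewrite <- C_exp_plus. f_equal. ring. }
  eapply is_Cderive_eq.
  - apply is_Cderive_scal. apply (is_Cderive_comp C_exp (fun w => w - z)%C).
    + replace (z - z)%C with (RtoC 0) by ring. apply is_Cderive_exp_0.
    + apply is_Cderive_minus. apply is_Cderive_id. apply is_Cderive_const.
  - ring.
Qed.

Definition tpi : C := (0, 2 * PI).

Lemma tpi_nz : tpi <> 0.
Proof. intros H. injection H. generalize PI_RGT_0. lra. Qed.

Lemma Cmod_tpi : Cmod tpi = 2 * PI.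
Proof.
  unfold tpi, Cmod. simpl fst; simpl snd.
  replace (0 ^ 2 + (2 * PI) ^ 2) with ((2 * PI) * (2 * PI)) by ring.
  apply sqrt_square. generalize PI_RGT_0. lra.
Qed.

Lemma nome_exp (z : C) : nome z = C_exp (tpi * z).
Proof. reflexivity. Qed.

Lemma Cmod_nome (z : C) : Cmod (nome z) = exp (- (2 * PI * Im z)).
Proof.
  rewrite nome_exp, Cmod_exp. f_equal. unfold tpi, Re, Im, Cmult; simpl. ring.
Qed.

Lemma nome_nz (z : C) : nome z <> 0.
Proof. apply C_exp_nz. Qed.

Lemma nome_plus (z w : C) : nome (z + w) = (nome z * nome w)%C.
Proof. rewrite !nome_exp, <- C_exp_plus. f_equal. ring. Qed.

Lemma nome_pow (z : C) (n : nat) : Cpow (nome z) n = nome (RtoC (INR n) * z).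
Proof. rewrite !nome_exp, C_exp_pow. f_equal. ring. Qed.

Lemma nome_1 : nome 1 = 1.
Proof.
  rewrite nome_exp. unfold C_exp, tpi.
  apply C_ext; unfold Re, Im, Cmult; simpl.
  - replace (0 * 1 - 2 * PI * 0) with 0 by ring. replace (0 * 0 + 2 * PI * 1) with (2 * PI) by ring.
    rewrite exp_0, cos_2PI. ring.
  - replace (0 * 1 - 2 * PI * 0) with 0 by ring. replace (0 * 0 + 2 * PI * 1) with (2 * PI) by ring.
    rewrite exp_0, sin_2PI. ring.
Qed.

Lemma nome_half : nome (RtoC (/ 2)) = (- (1))%C.
Proof.
  rewrite nome_exp. unfold C_exp, tpi.
  apply C_ext; unfold Re, Im, Cmult; simpl.
  - replace (0 * /2 - 2 * PI * 0) with 0 by ring. replace (0 * 0 + 2 * PI * / 2) with PI by field.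
    rewrite exp_0, cos_PI. ring.
  - replace (0 * /2 - 2 * PI * 0) with 0 by ring. replace (0 * 0 + 2 * PI * / 2) with PI by field.
    rewrite exp_0, sin_PI. ring.
Qed.

Lemma nome_periodic (z : C) : nome (z + 1) = nome z.
Proof. rewrite nome_plus, nome_1. ring. Qed.

Lemma is_Cderive_nome (z : C) : is_Cderive nome z (tpi * nome z).
Proof.
  eapply is_Cderive_eq.
  - apply (is_Cderive_comp C_exp (fun w => tpi * w)%C). apply is_Cderive_exp.
    apply is_Cderive_scal, is_Cderive_id.
  - cbv beta. rewrite nome_exp. ring.
Qed.

Lemma nome_lt_1 (z : C) : upper_half_plane z -> Cmod (nome z) < 1.
Proof.
  intros Hz. rewrite Cmod_nome, <- exp_0. apply exp_increasing.
  assert (0 < PI * Im z) by (apply Rmult_lt_0_compat; [ apply PI_RGT_0 | exact Hz ]). lra.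
Qed.

Lemma C_exp_conj (z : C) : C_exp (Cconj z) = Cconj (C_exp z).
Proof.
  unfold C_exp. rewrite re_conj, im_conj, cos_neg, sin_neg. apply C_ext; simpl; ring.
Qed.

Lemma nome_conj (z : C) : nome (- Cconj z) = Cconj (nome z).
Proof.
  rewrite !nome_exp, <- C_exp_conj, Cmult_conj. f_equal.
  replace (Cconj tpi) with (- tpi)%C. ring.
  unfold tpi, Cconj, Copp. simpl. f_equal. ring.
Qed.

Lemma pow_lt_1_pos (s : R) (n : nat) : 0 < s < 1 -> 0 < s ^ n <= 1.
Proof.
  intros Hs. split. apply pow_lt; lra. rewrite <- (pow1 n). apply pow_incr. lra.
Qed.

Lemma sqrt_lt_1_pos (s : R) : 0 < s < 1 -> 0 < sqrt s < 1 /\ sqrt s * sqrt s = s.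
Proof.
  intros Hs. split; [ split | ].
  - apply sqrt_lt_R0; lra.
  - rewrite <- sqrt_1. apply sqrt_lt_1; lra.
  - apply sqrt_sqrt; lra.
Qed.

(** With t = sqrt s, n^(k+1) s^n = (n^k t^n)(n t^n): the first factor is the induction hypothesis at
    t, the second is bounded by Bernoulli's inequality for (1/t)^n. *)
Lemma pow_poly_bounded (k : nat) : forall s : R, 0 < s < 1 ->
  exists K, 0 < K /\ forall n : nat, INR n ^ k * s ^ n <= K.
Proof.
  induction k as [|k IH]; intros s Hs.
  - exists 1. split. lra. intros n. simpl. rewrite Rmult_1_l. now apply pow_lt_1_pos.
  - destruct (sqrt_lt_1_pos s Hs) as [Ht Hts]. set (t := sqrt s) in *.
    destruct (IH t Ht) as [K [HK0 HK]].
    assert (H1 : 0 < / t - 1).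
    { assert (1 < / t) by (rewrite <- Rinv_1; apply Rinv_lt_contravar; lra). lra. }
    exists (K * / (/ t - 1)). split.
    { apply Rmult_lt_0_compat. exact HK0. now apply Rinv_0_lt_compat. }
    intros n.
    assert (Hn : INR n * t ^ n <= / (/ t - 1)).
    { assert (HB := poly n (/ t - 1) H1).
      replace (1 + (/ t - 1)) with (/ t) in HB by ring.
      assert (Htn : 0 < t ^ n) by (apply pow_lt; lra).
      apply Rmult_le_reg_r with (1 := H1). rewrite Rinv_l by lra.
      apply Rmult_le_compat_l with (r := t ^ n) in HB; [ | lra ].
      rewrite pow_inv, Rinv_r in HB by lra. nra. }
    replace (INR n ^ S k * s ^ n) with ((INR n ^ k * t ^ n) * (INR n * t ^ n)).
    + apply Rmult_le_compat; try easy.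
      * apply Rmult_le_pos. apply pow_le, pos_INR. left; apply pow_lt; lra.
      * apply Rmult_le_pos. apply pos_INR. left; apply pow_lt; lra.
    + rewrite <- Hts, Rpow_mult_distr. simpl. ring.
Qed.

Lemma ex_series_geom_R (s : R) : 0 < s < 1 -> ex_series (fun n => s ^ n).
Proof. intros Hs. exists (/ (1 - s)). apply is_series_geom. rewrite Rabs_pos_eq; lra. Qed.

Lemma ex_series_geom_S (s : R) : 0 < s < 1 -> ex_series (fun n => s ^ S n).
Proof. intros Hs. apply (ex_series_incr_1 (fun n => s ^ n)). now apply ex_series_geom_R. Qed.

Lemma ex_series_le_R (a b : nat -> R) : (forall n, 0 <= a n <= b n) -> ex_series b -> ex_series a.
Proof.
  intros H. apply (ex_series_le (V := R_CompleteNormedModule)). intros n.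
  change (Rabs (a n) <= b n). rewrite Rabs_pos_eq; apply H.
Qed.

Lemma ex_series_scal_R (c : R) (b : nat -> R) : ex_series b -> ex_series (fun n => c * b n).
Proof. intros [l Hl]. exists (c * l). apply (is_series_scal c b l Hl). Qed.

Lemma ex_series_poly_geom (k : nat) (s : R) : 0 < s < 1 ->
  ex_series (fun n => INR (S n) ^ k * s ^ S n).
Proof.
  intros Hs. destruct (sqrt_lt_1_pos s Hs) as [Ht Hts]. set (t := sqrt s) in *.
  destruct (pow_poly_bounded k t Ht) as [K [HK0 HK]].
  apply (ex_series_le_R _ (fun n => K * t ^ S n)).
  - intros n. split.
    + apply Rmult_le_pos. apply pow_le, pos_INR. apply pow_le; lra.
    + rewrite <- Hts, Rpow_mult_distr, <- Rmult_assoc.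
      apply Rmult_le_compat_r. apply pow_le; lra. apply HK.
  - now apply ex_series_scal_R, ex_series_geom_S.
Qed.

Definition poly_bounded (a : nat -> R) : Prop :=
  exists (K : R) (k : nat), 0 < K /\ forall n, Rabs (a (S n)) <= K * INR (S n) ^ k.

(** Index n carries the coefficient of q^(n+1): constant terms are kept outside the q-series, so
    [a 0] never enters. *)
Definition qterm (a : nat -> R) (z : C) (n : nat) : C :=
  (RtoC (a (S n)) * Cpow (nome z) (S n))%C.

Definition qseries (a : nat -> R) (z : C) : C := C_series (qterm a z).

Lemma qterm_bound (a : nat -> R) (K s : R) (k : nat) (z : C) (n : nat) :
  Rabs (a (S n)) <= K * INR (S n) ^ k -> Cmod (nome z) <= s ->
  Cmod (qterm a z n) <= K * (INR (S n) ^ k * s ^ S n).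
Proof.
  intros Ha Hs. unfold qterm. rewrite Cmod_mult, Cmod_R, Cmod_pow, <- Rmult_assoc.
  apply Rmult_le_compat; trivial. apply Rabs_pos. apply pow_le, Cmod_ge_0.
  apply pow_incr. split. apply Cmod_ge_0. exact Hs.
Qed.

Lemma Cmod_nome_pos (z : C) : 0 < Cmod (nome z).
Proof. apply Cmod_gt_0, nome_nz. Qed.

Lemma qseries_sums (a : nat -> R) (z : C) : poly_bounded a -> upper_half_plane z ->
  Csums (qterm a z) (qseries a z).
Proof.
  intros [K [k [HK Ha]]] Hz.
  destruct (Csums_dominated (qterm a z) (fun n => K * (INR (S n) ^ k * Cmod (nome z) ^ S n))) as [l Hl].
  - intros n. now apply qterm_bound; [ | apply Rle_refl ].
  - apply ex_series_scal_R, ex_series_poly_geom. split. apply Cmod_nome_pos. now apply nome_lt_1.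
  - unfold qseries. now rewrite (Csums_series _ _ Hl).
Qed.

Lemma poly_bounded_scal_n (a : nat -> R) : poly_bounded a -> poly_bounded (fun n => INR n * a n).
Proof.
  intros [K [k [HK Ha]]]. exists K, (S k). split. exact HK. intros n.
  rewrite Rabs_mult, (Rabs_pos_eq (INR (S n))) by apply pos_INR.
  replace (K * INR (S n) ^ S k) with (INR (S n) * (K * INR (S n) ^ k)) by (rewrite <- tech_pow_Rmult; ring).
  apply Rmult_le_compat_l. apply pos_INR. apply Ha.
Qed.

Lemma Im_near (z z0 : C) (r : R) : Cmod (z - z0) < r -> Im z0 - r < Im z.
Proof.
  intros H. assert (H1 := Rle_lt_trans _ _ _ (im_le_Cmod (z - z0)) H).
  unfold Cminus in H1. rewrite im_plus, im_opp in H1. apply Rabs_lt_between in H1. lra.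
Qed.

Lemma nome_le_Im (z : C) (y : R) : y <= Im z -> Cmod (nome z) <= exp (- (2 * PI * y)).
Proof.
  intros H. rewrite Cmod_nome. apply exp_le_mono.
  assert (PI * y <= PI * Im z) by (apply Rmult_le_compat_l; [ left; apply PI_RGT_0 | exact H ]). lra.
Qed.

Lemma exp_Im_lt_1 (y : R) : 0 < y -> 0 < exp (- (2 * PI * y)) < 1.
Proof.
  intros H. split. apply exp_pos. rewrite <- exp_0. apply exp_increasing.
  assert (0 < PI * y) by (apply Rmult_lt_0_compat; [ apply PI_RGT_0 | exact H ]). lra.
Qed.

(** Since (q^n)' = 2 pi i n q^n, differentiation multiplies coefficients by n and keeps them
    polynomially bounded, so it can be repeated. *)
Lemma qseries_derive (a : nat -> R) (z0 : C) : poly_bounded a -> upper_half_plane z0 ->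
  is_Cderive (qseries a) z0 (tpi * qseries (fun n => (INR n * a n)%R) z0).
Proof.
  intros Hp Hz0. assert (Hpn := poly_bounded_scal_n a Hp).
  assert (Hn := qseries_sums _ z0 Hpn Hz0). apply (Csums_scal tpi) in Hn.
  destruct Hpn as [K [k [HK Ha]]].
  (* On the disc of radius y around [z0] one has Im z > y, so a single geometric majorant in exp(-2
     pi y) serves the whole disc. *)
  set (y := Im z0 / 2). assert (Hy : 0 < y) by (unfold y; unfold upper_half_plane in Hz0; lra).
  apply (Csums_derive (fun n z => qterm a z n)
    (fun n z => tpi * qterm (fun n => (INR n * a n)%R) z n)%C _ z0 _ y
    (fun n => Cmod tpi * (K * (INR (S n) ^ k * exp (- (2 * PI * y)) ^ S n)))); trivial.
  - intros n z Hz. apply Im_near in Hz. split.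
    + unfold qterm. eapply is_Cderive_eq.
      * apply is_Cderive_scal, is_Cderive_pow, is_Cderive_nome.
      * cbv beta. rewrite (RtoC_mult (INR (S n))), (Cpow_S (nome z) n). ring.
    + rewrite Cmod_mult. apply Rmult_le_compat_l. apply Cmod_ge_0.
      apply qterm_bound. apply Ha. apply nome_le_Im. unfold y in *; lra.
  - apply ex_series_scal_R, ex_series_scal_R, ex_series_poly_geom. now apply exp_Im_lt_1.
  - intros z Hz. apply Im_near in Hz. apply qseries_sums; trivial.
    unfold upper_half_plane, y in *; lra.
Qed.

Lemma qseries_periodic (a : nat -> R) (z : C) : qseries a (z + 1) = qseries a z.
Proof. unfold qseries, qterm. now rewrite nome_periodic. Qed.

Lemma csum_conj (u : nat -> C) (n : nat) : csum (fun k => Cconj (u k)) n = Cconj (csum u n).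
Proof.
  induction n as [|n IH]; simpl.
  - apply C_ext; simpl; ring.
  - now rewrite IH, Cplus_conj.
Qed.

Lemma Csums_conj (u : nat -> C) (l : C) : Csums u l -> Csums (fun n => Cconj (u n)) (Cconj l).
Proof.
  apply is_lim_seq_ext. intros n. rewrite csum_conj, <- Cminus_conj. symmetry; apply Cmod_conj.
Qed.

Lemma RtoC_conj (x : R) : Cconj (RtoC x) = RtoC x.
Proof. unfold Cconj, RtoC. simpl. f_equal. ring. Qed.

Lemma reflect_H (z : C) : upper_half_plane z -> upper_half_plane (- Cconj z).
Proof. unfold upper_half_plane. rewrite im_opp, im_conj. lra. Qed.

Lemma qseries_conj (a : nat -> R) (z : C) : poly_bounded a -> upper_half_plane z ->
  qseries a (- Cconj z) = Cconj (qseries a z).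
Proof.
  intros Ha Hz. apply (Csums_unique (qterm a (- Cconj z))).
  - apply qseries_sums; trivial. now apply reflect_H.
  - apply (Csums_ext (fun n => Cconj (qterm a z n))).
    + intros n. unfold qterm. now rewrite Cmult_conj, RtoC_conj, Cpow_conj, nome_conj.
    + apply Csums_conj. now apply qseries_sums.
Qed.

Lemma Csums_shift1 (u : nat -> C) (l : C) : Csums u l -> Csums (fun n => u (S n)) (l - u O).
Proof.
  intros H. unfold Csums, Cconv in *. apply is_lim_seq_incr_1 in H.
  revert H. apply is_lim_seq_ext. intros n. rewrite csum_S. f_equal. ring.
Qed.

(** On Im z >= 1 the modulus of q is at most s = exp(-2 pi). Hence |q|^(n+2) <= (|q|/s)^2 s^(n+2),
    and the tail is at most |q|^2 / s^2 times a fixed convergent series. *)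
Lemma qseries_first_order (a : nat -> R) : poly_bounded a ->
  exists K, 0 < K /\ forall z, 1 <= Im z ->
  Cmod (qseries a z - RtoC (a 1%nat) * nome z) <= K * (Cmod (nome z) * Cmod (nome z)).
Proof.
  intros Hp. assert (Hp' := Hp). destruct Hp' as [K [k [HK Ha]]].
  set (s := exp (- (2 * PI * 1))).
  assert (Hs : 0 < s < 1) by (apply exp_Im_lt_1; lra).
  destruct (ex_series_poly_geom k s Hs) as [B HB].
  assert (HB0 : 0 <= B).
  { apply (rsum_le_lim _ B 0) in HB. exact HB. intros i. apply Rmult_le_pos. apply pow_le, pos_INR. apply pow_le; lra. }
  (* The summand 1 ensures that the constant is strictly positive. *)
  exists (K * (B / (s * s)) + 1). split.
  { assert (0 <= K * (B / (s * s))). apply Rmult_le_pos. lra. apply Rmult_le_pos. exact HB0. left. apply Rinv_0_lt_compat. nra. lra. }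
  intros z Hz.
  assert (Hzu : upper_half_plane z) by (unfold upper_half_plane; lra).
  assert (Hs1 := qseries_sums a z Hp Hzu). apply Csums_shift1 in Hs1.
  replace (qterm a z 0) with (RtoC (a 1%nat) * nome z)%C in Hs1 by (unfold qterm; simpl; ring).
  set (q := Cmod (nome z)) in *. assert (Hq0 : 0 < q) by apply Cmod_nome_pos.
  assert (Hqs : q <= s) by (apply nome_le_Im; lra).
  assert (HB' : is_series (fun n => q * q * (K / (s * s)) * (INR (S (S n)) ^ k * s ^ S (S n)))
     (q * q * (K / (s * s)) * (B - (INR 1 ^ k * s ^ 1)))).
  { apply (is_series_scal (q * q * (K / (s * s)))
      (fun n => INR (S (S n)) ^ k * s ^ S (S n)) (B - INR 1 ^ k * s ^ 1)).
    apply is_series_rsum. apply is_series_rsum in HB. apply is_lim_seq_incr_1 in HB.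
    apply (is_lim_seq_ext (fun n => rsum (fun n => INR (S n) ^ k * s ^ S n) (S n) - INR 1 ^ k * s ^ 1)).
    intros n. rewrite rsum_S. ring.
    apply is_lim_seq_minus'. exact HB. apply is_lim_seq_const. }
  apply (fun H => Csums_le _ _ _ _ H HB') in Hs1.
  - eapply Rle_trans. exact Hs1.
    assert (H1 : 0 <= INR 1 ^ k * s ^ 1) by (apply Rmult_le_pos; apply pow_le; [ apply pos_INR | lra ]).
    assert (Hqq : 0 < q * q) by nra.
    assert (Hss : 0 < K / (s * s)) by (apply Rdiv_lt_0_compat; nra).
    apply Rle_trans with (q * q * (K / (s * s)) * B).
    { apply Rmult_le_compat_l; nra. }
    replace (q * q * (K / (s * s)) * B) with (K * (B / (s * s)) * (q * q)) by (field; lra).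
    apply Rmult_le_compat_r; lra.
  - intros n. unfold qterm. rewrite Cmod_mult, Cmod_R, Cmod_pow. fold q.
    replace (q ^ S (S n)) with (q * q * q ^ n) by (simpl; ring).
    replace (q * q * (K / (s * s)) * (INR (S (S n)) ^ k * s ^ S (S n)))
      with ((K * INR (S (S n)) ^ k) * (q * q * s ^ n)) by (rewrite <- (tech_pow_Rmult s (S n)), <- (tech_pow_Rmult s n); field; lra).
    apply Rmult_le_compat. apply Rabs_pos.
    apply Rmult_le_pos. nra. apply pow_le; lra. apply Ha.
    apply Rmult_le_compat_l. nra. apply pow_incr; lra.
Qed.

(** * The sums of 1/(z+n)^k over the integers *)

Definition NtoC (n : nat) : C := RtoC (INR n).

Lemma NtoC_S (n : nat) : NtoC (S n) = (NtoC n + 1)%C.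
Proof. unfold NtoC. now rewrite S_INR, RtoC_plus. Qed.

Lemma NtoC_0 : NtoC 0 = RtoC 0.
Proof. reflexivity. Qed.

Lemma Cmod_NtoC (n : nat) : Cmod (NtoC n) = INR n.
Proof. unfold NtoC. rewrite Cmod_R. apply Rabs_pos_eq, pos_INR. Qed.

Lemma INR_S_pos (n : nat) : 0 < INR (S n).
Proof. apply lt_0_INR. lia. Qed.

Lemma INR_S_ge1 (n : nat) : 1 <= INR (S n).
Proof. rewrite S_INR. generalize (pos_INR n). lra. Qed.

Lemma NtoC_S_nz (n : nat) : NtoC (S n) <> 0.
Proof. apply Cmod_gt_0. rewrite Cmod_NtoC. apply INR_S_pos. Qed.

Definition invsq (n : nat) : R := / (INR (S n) * INR (S n)).

Lemma invsq_pos (n : nat) : 0 < invsq n.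
Proof. apply Rinv_0_lt_compat. assert (H := INR_S_pos n). nra. Qed.

Lemma is_lim_seq_inv_INR : is_lim_seq (fun n => / INR (S n)) 0.
Proof.
  apply (is_lim_seq_inv _ p_infty); [ | discriminate ].
  apply (is_lim_seq_incr_1 INR). apply is_lim_seq_INR.
Qed.

Lemma ex_series_invsq : ex_series invsq.
Proof.
  (* The majorant telescopes: 1/x^2 <= 2/(x(x+1)) for x >= 1. *)
  apply (ex_series_le_R _ (fun n => 2 * (/ INR (S n) - / INR (S (S n))))).
  - intros n. assert (H := invsq_pos n). split. lra.
    assert (H1 := INR_S_ge1 n). unfold invsq. rewrite (S_INR (S n)).
    set (x := INR (S n)) in *.
    apply Rminus_le.
    replace (/ (x * x) - 2 * (/ x - / (x + 1))) with ((1 - x) * / (x * x * (x + 1))) by (field; lra).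
    assert (0 < / (x * x * (x + 1))) by (apply Rinv_0_lt_compat; apply Rmult_lt_0_compat; nra). nra.
  - apply ex_series_scal_R. exists 1. apply is_series_rsum.
    apply (is_lim_seq_ext (fun n => 1 - / INR (S n))).
    + intros n. induction n as [|n IH]; [ simpl; field | ].
      change (rsum (fun n : nat => / INR (S n) - / INR (S (S n))) (S n)) with
        (rsum (fun n : nat => / INR (S n) - / INR (S (S n))) n + (/ INR (S n) - / INR (S (S n)))).
      rewrite <- IH. ring.
    + replace (Finite 1) with (Finite (1 - 0)) by (f_equal; ring).
      apply is_lim_seq_minus'. apply is_lim_seq_const. apply is_lim_seq_inv_INR.
Qed.

Definition nonint (z : C) : Prop := forall n, (z + NtoC n)%C <> 0 /\ (z - NtoC n)%C <> 0.

Lemma nonint_nz (z : C) : nonint z -> z <> 0.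
Proof. intros H E. destruct (H O) as [H1 _]. apply H1. rewrite E, NtoC_0. ring. Qed.

(** A lower bound linear in n, so that 1/(z+n)^k inherits the majorant c^-k n^-k. The integer 0 is
    left out: its term 1/z^k is always treated apart. *)
Definition sep (c : R) (z : C) : Prop :=
  forall n, c * INR (S n) <= Cmod (z + NtoC (S n)) /\ c * INR (S n) <= Cmod (z - NtoC (S n)).

Lemma Cmod_sum_ge (z : C) (n : nat) :
  INR n - Cmod z <= Cmod (z + NtoC n) /\ INR n - Cmod z <= Cmod (z - NtoC n).
Proof.
  split.
  - generalize (Cmod_triangle_sub (NtoC n) (- z)).
    replace (NtoC n - - z)%C with (z + NtoC n)%C by ring. rewrite Cmod_opp, Cmod_NtoC. lra.
  - generalize (Cmod_triangle_sub (NtoC n) z). rewrite (Cmod_sub_sym (NtoC n)), Cmod_NtoC. lra.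
Qed.

(** For n > 2|z| the triangle inequality gives |z +- n| >= n/2; only finitely many n remain, and a
    minimum handles them. *)
Lemma nonint_sep (z : C) : nonint z -> exists c, 0 < c /\ sep c z.
Proof.
  intros Hz.
  assert (HK : forall K, exists c, 0 < c /\ forall n, (n < K)%nat ->
    c * INR (S n) <= Cmod (z + NtoC (S n)) /\ c * INR (S n) <= Cmod (z - NtoC (S n))).
  { induction K as [|K [c [Hc IH]]]. exists 1. split. lra. intros n Hn; lia.
    assert (Hp := INR_S_pos K). destruct (Hz (S K)) as [H1 H2].
    apply Cmod_gt_0 in H1. apply Cmod_gt_0 in H2.
    exists (Rmin c (Rmin (Cmod (z + NtoC (S K)) / INR (S K)) (Cmod (z - NtoC (S K)) / INR (S K)))).
    split.
    { apply Rmin_pos. exact Hc. apply Rmin_pos; now apply Rdiv_lt_0_compat. }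
    intros n Hn. destruct (Nat.eq_dec n K) as [-> | Hne].
    - split.
      + apply Rle_trans with (Cmod (z + NtoC (S K)) / INR (S K) * INR (S K)).
        apply Rmult_le_compat_r. lra. eapply Rle_trans. apply Rmin_r. apply Rmin_l.
        right; field; lra.
      + apply Rle_trans with (Cmod (z - NtoC (S K)) / INR (S K) * INR (S K)).
        apply Rmult_le_compat_r. lra. eapply Rle_trans. apply Rmin_r. apply Rmin_r.
        right; field; lra.
    - assert (Hpn := INR_S_pos n). destruct (IH n ltac:(lia)) as [A1 A2].
      assert (A3 := Rmin_l c (Rmin (Cmod (z + NtoC (S K)) / INR (S K)) (Cmod (z - NtoC (S K)) / INR (S K)))).
      apply Rmult_le_compat_r with (r := INR (S n)) in A3; [ lra | lra ]. }
  destruct (nfloor_ex (2 * Cmod z)) as [K [HK1 HK2]].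
  { generalize (Cmod_ge_0 z). lra. }
  destruct (HK K) as [c [Hc H]].
  exists (Rmin c (/ 2)). split. apply Rmin_pos; lra.
  intros n. assert (Hp := INR_S_pos n).
  destruct (Nat.lt_ge_cases n K) as [Hn | Hn].
  - destruct (H n Hn) as [A1 A2]. assert (A3 := Rmin_l c (/ 2)).
    apply Rmult_le_compat_r with (r := INR (S n)) in A3; lra.
  - destruct (Cmod_sum_ge z (S n)) as [A1 A2].
    assert (Hn2 : INR (S K) <= INR (S n)) by (apply le_INR; lia). rewrite (S_INR K) in Hn2.
    assert (A3 := Rmin_r c (/ 2)).
    apply Rmult_le_compat_r with (r := INR (S n)) in A3; lra.
Qed.

Lemma sep_near (c : R) (z w : C) : 0 < c -> sep c z -> Cmod (w - z) < c / 2 -> sep (c / 2) w.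
Proof.
  intros Hc Hs Hw n. destruct (Hs n) as [H1 H2]. assert (Hn := INR_S_ge1 n).
  split.
  - generalize (Cmod_triangle_sub (z + NtoC (S n)) (- (w - z))).
    replace (z + NtoC (S n) - - (w - z))%C with (w + NtoC (S n))%C by ring.
    rewrite Cmod_opp. nra.
  - generalize (Cmod_triangle_sub (z - NtoC (S n)) (- (w - z))).
    replace (z - NtoC (S n) - - (w - z))%C with (w - NtoC (S n))%C by ring.
    rewrite Cmod_opp. nra.
Qed.

Lemma sep_nonint (c : R) (z : C) : 0 < c -> sep c z -> z <> 0 -> nonint z.
Proof.
  intros Hc Hs Hz [|n].
  - rewrite NtoC_0. replace (z + 0)%C with z by ring. replace (z - 0)%C with z by ring. tauto.
  - assert (Hn := INR_S_pos n). destruct (Hs n) as [H1 H2].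
    split; apply Cmod_gt_0; nra.
Qed.

Lemma nonint_open (z : C) : nonint z -> exists r, 0 < r /\
  (forall w, Cmod (w - z) < r -> nonint w) /\ exists c, 0 < c /\ forall w, Cmod (w - z) < r -> sep c w.
Proof.
  intros Hz. destruct (nonint_sep z Hz) as [c [Hc Hs]].
  assert (Hz0 := nonint_nz z Hz). apply Cmod_gt_0 in Hz0.
  exists (Rmin (c / 2) (Cmod z)). split. apply Rmin_pos; lra.
  assert (A : forall w, Cmod (w - z) < Rmin (c / 2) (Cmod z) -> sep (c / 2) w).
  { intros w Hw. apply (sep_near c z); trivial. eapply Rlt_le_trans. exact Hw. apply Rmin_l. }
  split.
  - intros w Hw. apply (sep_nonint (c / 2)). lra. now apply A.
    apply Cmod_gt_0. assert (H := Rlt_le_trans _ _ _ Hw (Rmin_r _ _)).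
    generalize (Cmod_triangle_sub z w). rewrite Cmod_sub_sym. lra.
  - exists (c / 2). split. lra. exact A.
Qed.

Definition pterm (k : nat) (z : C) (n : nat) : C :=
  (/ Cpow (z + NtoC (S n)) k + / Cpow (z - NtoC (S n)) k)%C.

(* Phi k z is the sum of 1/(z+n)^k over the integers n, with n and -n paired so that it also
   converges for k = 1. *)
Definition Phi (k : nat) (z : C) : C := (/ Cpow z k + C_series (pterm k z))%C.

Lemma Cmod_inv_pow_le (w : C) (x : R) (k : nat) : 0 < x -> x <= Cmod w ->
  Cmod (/ Cpow w k) <= (/ x) ^ k.
Proof.
  intros Hx Hw. assert (Hw0 : w <> 0) by (apply Cmod_gt_0; lra).
  rewrite Cmod_inv, Cmod_pow by now apply Cpow_nz.
  rewrite pow_inv. apply Rinv_le_contravar. now apply pow_lt.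
  apply pow_incr. lra.
Qed.

Lemma pow_inv_INR_le (n k : nat) : (/ INR (S n)) ^ (S (S k)) <= invsq n.
Proof.
  assert (H := INR_S_ge1 n).
  replace ((/ INR (S n)) ^ (S (S k))) with ((/ INR (S n)) ^ k * invsq n).
  - rewrite <- (Rmult_1_l (invsq n)) at 2. apply Rmult_le_compat_r. left; apply invsq_pos.
    rewrite <- (pow1 k). apply pow_incr. split.
    left; apply Rinv_0_lt_compat; lra. rewrite <- Rinv_1. apply Rinv_le_contravar; lra.
  - unfold invsq. rewrite Rinv_mult, <- !tech_pow_Rmult. ring.
Qed.

Lemma inv_pow_sep_le (c : R) (w : C) (n k : nat) : 0 < c -> c * INR (S n) <= Cmod w ->
  Cmod (/ Cpow w (S (S k))) <= (/ c) ^ (S (S k)) * invsq n.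
Proof.
  intros Hc Hw. assert (Hn := INR_S_pos n).
  eapply Rle_trans. apply (Cmod_inv_pow_le w (c * INR (S n))); trivial. nra.
  rewrite Rinv_mult, Rpow_mult_distr.
  apply Rmult_le_compat_l. apply pow_le. left; now apply Rinv_0_lt_compat.
  apply pow_inv_INR_le.
Qed.

Lemma pterm_bound (c : R) (z : C) (k n : nat) : 0 < c -> sep c z ->
  Cmod (pterm (S (S k)) z n) <= 2 * (/ c) ^ (S (S k)) * invsq n.
Proof.
  intros Hc Hs. destruct (Hs n) as [H1 H2]. unfold pterm.
  eapply Rle_trans. apply Cmod_triangle.
  assert (A1 := inv_pow_sep_le c _ n k Hc H1). assert (A2 := inv_pow_sep_le c _ n k Hc H2). lra.
Qed.

(** Pairing n with -n gains one power: the pair is 2z/(z^2 - n^2), so the symmetric series for k = 1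
    is absolutely convergent. *)
Lemma pterm_1 (z : C) (n : nat) : nonint z ->
  pterm 1 z n = (2 * z * (/ (z + NtoC (S n)) * / (z - NtoC (S n))))%C.
Proof. intros Hz. destruct (Hz (S n)). unfold pterm. simpl Cpow. field. tauto. Qed.

Lemma pterm_1_bound (c : R) (z : C) (n : nat) : 0 < c -> nonint z -> sep c z ->
  Cmod (pterm 1 z n) <= 2 * Cmod z * ((/ c) * (/ c)) * invsq n.
Proof.
  intros Hc Hz Hs. rewrite pterm_1 by trivial. destruct (Hz (S n)) as [N1 N2]. destruct (Hs n) as [H1 H2].
  assert (Hn := INR_S_pos n).
  rewrite !Cmod_mult, Cmod_R, Rabs_pos_eq by lra.
  rewrite (Rmult_assoc (2 * Cmod z)). apply Rmult_le_compat_l. generalize (Cmod_ge_0 z); lra.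
  rewrite !Cmod_inv by trivial.
  replace (/ c * / c * invsq n) with (/ (c * INR (S n)) * / (c * INR (S n))) by (unfold invsq; field; lra).
  apply Rmult_le_compat; try (left; apply Rinv_0_lt_compat; apply Cmod_gt_0; assumption);
    apply Rinv_le_contravar; trivial; nra.
Qed.

Lemma pterm_sums (k : nat) (z : C) : nonint z -> Csums (pterm (S k) z) (Phi (S k) z - / Cpow z (S k)).
Proof.
  intros Hz. destruct (nonint_sep z Hz) as [c [Hc Hs]].
  assert (H : exists l, Csums (pterm (S k) z) l).
  { destruct k as [|k].
    - apply (Csums_dominated _ _ (fun n => pterm_1_bound c z n Hc Hz Hs)).
      apply ex_series_scal_R, ex_series_invsq.
    - apply (Csums_dominated _ _ (fun n => pterm_bound c z k n Hc Hs)).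
      apply ex_series_scal_R, ex_series_invsq. }
  destruct H as [l Hl]. unfold Phi. rewrite (Csums_series _ _ Hl).
  replace (/ Cpow z (S k) + l - / Cpow z (S k))%C with l by ring. exact Hl.
Qed.

Lemma is_Cderive_inv_pow (a z : C) (k : nat) : (z + a)%C <> 0 ->
  is_Cderive (fun w => / Cpow (w + a) (S k))%C z (- NtoC (S k) * / Cpow (z + a) (S (S k))).
Proof.
  intros Ha. eapply is_Cderive_eq.
  - apply is_Cderive_inv. now apply Cpow_nz. apply is_Cderive_pow.
    apply is_Cderive_plus. apply is_Cderive_id. apply is_Cderive_const.
  - cbv beta. rewrite !Cpow_S. unfold NtoC. field. split; trivial. now apply Cpow_nz.
Qed.

Lemma pterm_derive (k n : nat) (z : C) : nonint z ->
  is_Cderive (fun w => pterm (S k) w n) z (- NtoC (S k) * pterm (S (S k)) z n).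
Proof.
  intros Hz. destruct (Hz (S n)). eapply is_Cderive_eq.
  - apply is_Cderive_plus. now apply is_Cderive_inv_pow.
    apply (is_Cderive_inv_pow (- NtoC (S n))%C). exact H0.
  - unfold pterm, Cminus. ring.
Qed.

Lemma Phi_derive (k : nat) (z : C) : nonint z ->
  is_Cderive (Phi (S k)) z (- NtoC (S k) * Phi (S (S k)) z).
Proof.
  intros Hz. destruct (nonint_open z Hz) as [r [Hr [Hn [c [Hc Hs]]]]].
  assert (H00 : Cmod (z - z) < r) by (unfold Cminus; rewrite Cplus_opp_r, Cmod_0; exact Hr).
  (* The term n = 0 is written with w + 0 to match [is_Cderive_inv_pow]. *)
  apply (is_Cderive_ext_loc (fun w => / Cpow (w + 0) (S k) + (Phi (S k) w - / Cpow w (S k)))%C _ _ _ r Hr).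
  { intros w _. rewrite Cplus_0_r. ring. }
  eapply is_Cderive_eq.
  - apply is_Cderive_plus.
    + apply is_Cderive_inv_pow. rewrite Cplus_0_r. now apply nonint_nz.
    + apply (Csums_derive (fun n w => pterm (S k) w n)
        (fun n w => - NtoC (S k) * pterm (S (S k)) w n)%C _ z _ r
        (fun n => Cmod (- NtoC (S k)) * (2 * (/ c) ^ (S (S k)) * invsq n))); trivial.
      * intros n w Hw. split. now apply pterm_derive, Hn.
        rewrite Cmod_mult. apply Rmult_le_compat_l. apply Cmod_ge_0.
        apply pterm_bound; auto.
      * apply ex_series_scal_R, ex_series_scal_R, ex_series_invsq.
      * intros w Hw. apply pterm_sums. auto.
      * apply Csums_scal. apply (pterm_sums (S k) z Hz).
  - rewrite Cplus_0_r. ring.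
Qed.

Lemma nonint_opp (z : C) : nonint z -> nonint (- z).
Proof.
  intros H n. destruct (H n) as [H1 H2]. split; intros E.
  - apply H2. replace (z - NtoC n)%C with (- (- z + NtoC n))%C by ring. rewrite E. ring.
  - apply H1. replace (z + NtoC n)%C with (- (- z - NtoC n))%C by ring. rewrite E. ring.
Qed.

Lemma nonint_incr (z : C) : nonint z -> nonint (z + 1).
Proof.
  intros H n. split.
  - destruct (H (S n)) as [H1 _]. rewrite NtoC_S in H1. intros E. apply H1. rewrite <- E. ring.
  - destruct n as [|n].
    + destruct (H 1%nat) as [H1 _]. rewrite NtoC_S in H1. intros E. apply H1. rewrite <- E, NtoC_0. ring.
    + destruct (H n) as [_ H1]. rewrite NtoC_S. intros E. apply H1. rewrite <- E. ring.
Qed.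

Lemma C2_nz : RtoC 2 <> 0.
Proof. intros H. apply RtoC_inj in H. lra. Qed.

Lemma nonint_half (z : C) : nonint z -> nonint (z / 2).
Proof.
  intros H n. assert (H2 := C2_nz). destruct (H (n + n)%nat) as [H3 H4].
  unfold NtoC in *. rewrite plus_INR, RtoC_plus in H3, H4.
  split; intros E; [ apply H3 | apply H4 ].
  - replace (z + (INR n + INR n))%C with (2 * (z / 2 + INR n))%C by (field; trivial). rewrite E; ring.
  - replace (z - (INR n + INR n))%C with (2 * (z / 2 - INR n))%C by (field; trivial). rewrite E; ring.
Qed.

(** The symmetric partial sum over |n| <= K. *)
Definition partialPhi (k : nat) (z : C) (K : nat) : C := (/ Cpow z k + csum (pterm k z) K)%C.

Lemma partialPhi_conv (k : nat) (z : C) : nonint z -> Cconv (partialPhi (S k) z) (Phi (S k) z).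
Proof.
  intros Hz. replace (Phi (S k) z) with (/ Cpow z (S k) + (Phi (S k) z - / Cpow z (S k)))%C by ring.
  apply Cconv_plus. apply Cconv_const. now apply pterm_sums.
Qed.

Lemma Cconv_inv_INR (u : nat -> C) : (forall n, u n <> 0) ->
  (exists c, forall n, INR (S n) <= Cmod (u n) + c) -> Cconv (fun n => / u n)%C 0.
Proof.
  intros Hu [c H].
  assert (Hlim : is_lim_seq (fun n => / Cmod (u n)) 0).
  { apply (is_lim_seq_inv _ p_infty); [ | discriminate ].
    apply (is_lim_seq_le_p_loc (fun n => INR (S n) + - c)).
    - exists O. intros n _. specialize (H n). lra.
    - replace p_infty with (Rbar_plus p_infty (- c)) by reflexivity.
      apply is_lim_seq_plus with (l1 := p_infty) (l2 := (- c)); [ | apply is_lim_seq_const | reflexivity ].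
      apply (is_lim_seq_incr_1 INR). apply is_lim_seq_INR. }
  revert Hlim. apply is_lim_seq_ext. intros n. rewrite <- Cmod_inv by trivial. f_equal. ring.
Qed.

Lemma Cconv_inv_pow_INR (k : nat) (u : nat -> C) : (forall n, u n <> 0) ->
  (exists c, forall n, INR (S n) <= Cmod (u n) + c) -> Cconv (fun n => / Cpow (u n) (S k))%C 0.
Proof.
  intros Hu Hc. assert (A := Cconv_inv_INR u Hu Hc).
  induction k as [|k IH].
  - revert A. apply Cconv_ext. intros n. f_equal. simpl. ring.
  - replace (RtoC 0) with (0 * 0)%C by ring.
    apply (Cconv_ext (fun n => / u n * / Cpow (u n) (S k))%C).
    { intros n. rewrite (Cpow_S _ (S k)). field. split. now apply Cpow_nz. apply Hu. }
    now apply Cconv_mult.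
Qed.

(** The integers split into even and odd ones: 1/(z/2 + n)^2 = 4/(z + 2n)^2 and 1/((z+1)/2 + n)^2 =
    4/(z + 2n+1)^2. The two symmetric sums up to K together cover the range from -2K to 2K+1, which
    leaves the one unpaired term at 2K+1. *)
Lemma Phi2_duplication (z : C) : nonint z ->
  (Phi 2 (z / 2) + Phi 2 ((z + 1) / 2))%C = (4 * Phi 2 z)%C.
Proof.
  intros Hz.
  assert (Hz1 : nonint (z / 2)) by now apply nonint_half.
  assert (Hz2 : nonint ((z + 1) / 2)) by now apply nonint_half, nonint_incr.
  assert (H2 := C2_nz).
  assert (E : forall K, (partialPhi 2 (z / 2) K + partialPhi 2 ((z + 1) / 2) K)%C
    = (4 * (partialPhi 2 z (K + K) + / Cpow (z + NtoC (S (K + K))) 2))%C).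
  { induction K as [|K IH].
    - unfold partialPhi. simpl csum. simpl Nat.add. rewrite NtoC_S, NtoC_0.
      assert (A := nonint_nz z Hz). assert (B := nonint_nz _ (nonint_incr z Hz)).
      simpl Cpow. field. split; [ exact B | exact A ].
    - unfold partialPhi in *. rewrite Nat.add_succ_r, Nat.add_succ_l. simpl csum.
      transitivity ((/ (z / 2) ^ 2 + csum (pterm 2 (z / 2)) K + (/ ((z + 1) / 2) ^ 2 + csum (pterm 2 ((z + 1) / 2)) K))
        + (pterm 2 (z / 2) K + pterm 2 ((z + 1) / 2) K))%C; [ ring | ].
      rewrite IH.
      transitivity (4 * (/ z ^ 2 + csum (pterm 2 z) (K + K)) + (4 * / (z + NtoC (S (K + K))) ^ 2 + (pterm 2 (z / 2) K + pterm 2 ((z + 1) / 2) K)))%C; [ ring | ].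
      transitivity (4 * (/ z ^ 2 + csum (pterm 2 z) (K + K)) + 4 * (pterm 2 z (K + K) + pterm 2 z (S (K + K)) + / (z + NtoC (S (S (S (K + K))))) ^ 2))%C; [ | ring ].
      f_equal. unfold pterm.
      destruct (Hz (S (K + K))) as [P1 P1']. destruct (Hz (S (S (K + K)))) as [P2 P2'].
      destruct (Hz (S (S (S (K + K))))) as [P3 _].
      destruct (Hz1 (S K)) as [Q1 Q1']. destruct (Hz2 (S K)) as [Q2 Q2'].
      assert (EK : NtoC (K + K) = (NtoC K + NtoC K)%C) by (unfold NtoC; now rewrite plus_INR, RtoC_plus).
      rewrite !NtoC_S in *. rewrite EK in *. set (m := NtoC K) in *.
      replace (z / 2 + (m + 1))%C with ((z + (m + m + 1 + 1)) / 2)%C by (field; trivial).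
      replace (z / 2 - (m + 1))%C with ((z - (m + m + 1 + 1)) / 2)%C by (field; trivial).
      replace ((z + 1) / 2 + (m + 1))%C with ((z + (m + m + 1 + 1 + 1)) / 2)%C by (field; trivial).
      replace ((z + 1) / 2 - (m + 1))%C with ((z - (m + m + 1)) / 2)%C by (field; trivial).
      set (a := (z + (m + m + 1 + 1))%C) in *. set (b := (z - (m + m + 1 + 1))%C) in *.
      set (c := (z + (m + m + 1 + 1 + 1))%C) in *. set (d := (z - (m + m + 1))%C) in *.
      set (e := (z + (m + m + 1))%C) in *.
      simpl Cpow. field. tauto. }
  apply (Cconv_unique (fun K => partialPhi 2 (z / 2) K + partialPhi 2 ((z + 1) / 2) K)%C).
  - apply Cconv_plus; now apply partialPhi_conv.
  - apply (Cconv_ext _ _ _ (fun K => eq_sym (E K))).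
    apply Cconv_scal. rewrite <- (Cplus_0_r (Phi 2 z)). apply Cconv_plus.
    + apply (Cconv_subseq (partialPhi 2 z)). intros n; lia. now apply partialPhi_conv.
    + apply (Cconv_subseq (fun n => / (z + NtoC (S n)) ^ 2)%C). intros n; lia.
      apply Cconv_inv_pow_INR. intros n; apply Hz. exists (Cmod z). intros n.
      destruct (Cmod_sum_ge z (S n)). lra.
Qed.

(** A shift by 1 adds the term at K+1 to the symmetric sum and removes the one at -K; both tend to
    0, even for exponent 1. *)
Lemma Phi_periodic (k : nat) (z : C) : nonint z -> Phi (S k) (z + 1) = Phi (S k) z.
Proof.
  intros Hz. assert (Hz1 := nonint_incr z Hz).
  assert (E : forall K, partialPhi (S k) (z + 1) K
    = (partialPhi (S k) z K + (/ Cpow (z + NtoC (S K)) (S k) + - (1) * / Cpow (z - NtoC K) (S k)))%C).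
  { induction K as [|K IH].
    - unfold partialPhi. simpl csum. rewrite NtoC_S, NtoC_0. replace (z + (0 + 1))%C with (z + 1)%C by ring.
      replace (z - 0)%C with z by ring. ring.
    - unfold partialPhi in *. simpl csum. rewrite Cplus_assoc, IH. unfold pterm.
      replace (z + 1 + NtoC (S K))%C with (z + NtoC (S (S K)))%C by (rewrite !NtoC_S; ring).
      replace (z + 1 - NtoC (S K))%C with (z - NtoC K)%C by (rewrite !NtoC_S; ring). ring. }
  apply (Cconv_unique (partialPhi (S k) (z + 1))). now apply partialPhi_conv.
  apply (Cconv_ext _ _ _ (fun K => eq_sym (E K))).
  replace (Phi (S k) z) with (Phi (S k) z + (0 + - (1) * 0))%C by ring.
  apply Cconv_plus. now apply partialPhi_conv.
  apply Cconv_plus; [ | apply Cconv_scal ]; apply Cconv_inv_pow_INR.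
  - intros n; apply Hz.
  - exists (Cmod z). intros n. destruct (Cmod_sum_ge z (S n)). lra.
  - intros n; apply Hz.
  - exists (Cmod z + 1). intros n. destruct (Cmod_sum_ge z n). rewrite S_INR. lra.
Qed.

(** * Hyperbolic sine, the double pole of 1/sin^2, and Herglotz' trick *)

Definition Csinh (w : C) : C := ((C_exp w - C_exp (- w)) / 2)%C.
Definition Ccosh (w : C) : C := ((C_exp w + C_exp (- w)) / 2)%C.

Lemma is_Cderive_exp_opp (z : C) : is_Cderive (fun w => C_exp (- w)) z (- C_exp (- z)).
Proof.
  eapply is_Cderive_eq. apply (is_Cderive_comp C_exp Copp). apply is_Cderive_exp.
  apply is_Cderive_opp, is_Cderive_id. ring.
Qed.

Lemma is_Cderive_sinh (z : C) : is_Cderive Csinh z (Ccosh z).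
Proof.
  eapply is_Cderive_eq. apply (is_Cderive_div (fun w => C_exp w - C_exp (- w))%C (fun _ => RtoC 2)). apply C2_nz.
  apply is_Cderive_minus. apply is_Cderive_exp. apply is_Cderive_exp_opp. apply is_Cderive_const.
  unfold Ccosh. cbv beta. field.
Qed.

Lemma is_Cderive_cosh (z : C) : is_Cderive Ccosh z (Csinh z).
Proof.
  eapply is_Cderive_eq. apply (is_Cderive_div (fun w => C_exp w + C_exp (- w))%C (fun _ => RtoC 2)). apply C2_nz.
  apply is_Cderive_plus. apply is_Cderive_exp. apply is_Cderive_exp_opp. apply is_Cderive_const.
  unfold Csinh. cbv beta. field.
Qed.

Lemma Csinh_0 : Csinh 0 = 0.
Proof. unfold Csinh. replace (- 0)%C with (RtoC 0) by ring. field. Qed.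

Lemma Ccosh_0 : Ccosh 0 = 1.
Proof. unfold Ccosh. replace (- 0)%C with (RtoC 0) by ring. rewrite C_exp_0. field. Qed.

Lemma mean_value_0 (f f' : C -> C) (w : C) (M : R) :
  (forall z, is_Cderive f z (f' z)) ->
  (forall t, 0 <= t <= 1 -> Cmod (f' (RtoC t * w)%C) <= M) ->
  Cmod (f w - f 0) <= M * Cmod w.
Proof.
  intros Hf HM. replace w with (w - 0)%C at 2 by ring.
  apply (mean_value_segment f f'). intros t Ht.
  replace (0 + t * (w - 0))%C with (t * w)%C by ring. auto.
Qed.

Lemma Cmod_scal_le (t : R) (w : C) : 0 <= t <= 1 -> Cmod (RtoC t * w) <= Cmod w.
Proof.
  intros Ht. rewrite Cmod_mult, Cmod_R, Rabs_pos_eq by lra.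
  assert (H := Cmod_ge_0 w). nra.
Qed.

Lemma Re_scal_le (t : R) (w : C) (X : R) : 0 <= t <= 1 -> Rabs (Re w) <= X ->
  Rabs (Re (RtoC t * w)) <= X.
Proof.
  intros Ht Hw. rewrite re_scal_l, Rabs_mult, (Rabs_pos_eq t) by lra.
  assert (H := Rabs_pos (Re w)). nra.
Qed.

(** Start of a chain of Taylor remainders: each of the next three bounds integrates the previous one
    from 0 and gains a factor |w|. Factorials are dropped, as only the order of vanishing
    matters. *)
Lemma Ccosh_bound (w : C) (X : R) : Rabs (Re w) <= X -> Cmod (Ccosh w) <= exp X.
Proof.
  intros H. unfold Ccosh. rewrite Cmod_div, Cmod_R, (Rabs_pos_eq 2) by (try apply C2_nz; lra).
  assert (A := Cmod_triangle (C_exp w) (C_exp (- w))). rewrite !Cmod_exp, re_opp in A.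
  apply Rabs_le_between in H.
  assert (exp (Re w) <= exp X) by (apply exp_le_mono; lra).
  assert (exp (- Re w) <= exp X) by (apply exp_le_mono; lra). lra.
Qed.

Lemma Csinh_bound (w : C) (X : R) : Rabs (Re w) <= X -> Cmod (Csinh w) <= exp X * Cmod w.
Proof.
  intros H. generalize (mean_value_0 Csinh Ccosh w (exp X) is_Cderive_sinh).
  rewrite Csinh_0. replace (Csinh w - 0)%C with (Csinh w) by ring.
  intros A. apply A. intros t Ht. apply Ccosh_bound. now apply Re_scal_le.
Qed.

Lemma Ccosh_1_bound (w : C) (X : R) : Rabs (Re w) <= X ->
  Cmod (Ccosh w - 1) <= exp X * Cmod w * Cmod w.
Proof.
  intros H. generalize (mean_value_0 Ccosh Csinh w (exp X * Cmod w) is_Cderive_cosh).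
  rewrite Ccosh_0. intros A. apply A. intros t Ht.
  eapply Rle_trans. apply Csinh_bound. now apply Re_scal_le, H.
  apply Rmult_le_compat_l. left; apply exp_pos. now apply Cmod_scal_le.
Qed.

Lemma Csinh_id_bound (w : C) (X : R) : Rabs (Re w) <= X ->
  Cmod (Csinh w - w) <= exp X * Cmod w * Cmod w * Cmod w.
Proof.
  intros H. generalize (mean_value_0 (fun w => Csinh w - w)%C (fun w => Ccosh w - 1)%C w
    (exp X * Cmod w * Cmod w)).
  rewrite Csinh_0. replace (Csinh w - w - (0 - 0))%C with (Csinh w - w)%C by ring.
  intros A. apply A.
  - intros z. apply is_Cderive_minus. apply is_Cderive_sinh. apply is_Cderive_id.
  - intros t Ht. eapply Rle_trans. apply Ccosh_1_bound. now apply Re_scal_le, H.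
    assert (B := Cmod_scal_le t w Ht). assert (B0 := Cmod_ge_0 (t * w)).
    assert (Hx := exp_pos X).
    apply Rmult_le_compat; trivial.
    apply Rmult_le_pos; lra. apply Rmult_le_compat_l; lra.
Qed.

(** Up to pi/3 the derivative cos is at least 1/2; from there on sin >= sqrt 3 / 2 > 2/3, while y <=
    pi/2 <= 2. *)
Lemma sin_ge_third (y : R) : 0 <= y <= PI / 2 -> y / 3 <= sin y.
Proof.
  intros Hy. assert (Hpi := PI_RGT_0). assert (Hpi4 := PI_4).
  destruct (Rle_lt_dec y (PI / 3)) as [H | H].
  - destruct (MVT_gen sin 0 y cos) as [c [Hc E]].
    + intros x _. apply is_derive_sin.
    + intros x _. apply continuity_sin.
    + rewrite Rmin_left, Rmax_right in Hc by lra. rewrite sin_0 in E.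
      assert (Hcos : / 2 <= cos c).
      { replace (/ 2) with (cos (PI / 3)) by (rewrite cos_PI3; field). apply cos_decr_1; lra. }
      nra.
  - assert (A : sin (PI / 3) <= sin y) by (apply sin_incr_1; lra).
    rewrite sin_PI3 in A.
    assert (B := sqrt_sqrt 3 ltac:(lra)). assert (C0 := sqrt_pos 3).
    assert (Hs : 17 / 10 <= sqrt 3) by nra.
    lra.
Qed.

(** From |sinh(x+iy)|^2 = sinh^2 x + sin^2 y, each square is compared with a ninth of x^2 or y^2.
    The zeros of sinh are the multiples of pi i, of which this strip contains only 0. *)
Lemma Csinh_lower (u : C) : Rabs (Im u) <= PI / 2 -> Cmod u / 3 <= Cmod (Csinh u).
Proof.
  intros Hu.
  assert (E : Cmod (Csinh u) ^ 2 = ((exp (Re u) - exp (- Re u)) / 2) ^ 2 + sin (Im u) ^ 2).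
  { unfold Csinh. rewrite Cmod_div, Cmod_R, (Rabs_pos_eq 2) by (try apply C2_nz; lra).
    unfold Rdiv. rewrite Rpow_mult_distr, Cmod2_alt.
    unfold Cminus. rewrite re_plus, im_plus, re_opp, im_opp. unfold C_exp. simpl Re; simpl Im.
    fold (Re u) (Im u). rewrite cos_neg, sin_neg.
    set (a := exp (Re u)).
    assert (Hab : a * exp (- Re u) = 1) by (unfold a; rewrite <- exp_plus, Rplus_opp_r; apply exp_0).
    set (b := exp (- Re u)) in *.
    generalize (sin2_cos2 (Im u)). unfold Rsqr. intros Hsc.
    set (s := sin (Im u)) in *. set (c := cos (Im u)) in *.
    assert (Hc : c * c = 1 - s * s) by lra.
    transitivity (((a - b) ^ 2 * (c * c) + (a + b) ^ 2 * (s * s)) * / 4). field.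
    rewrite Hc. transitivity ((a - b) ^ 2 * / 4 + (a * b) * (s * s)). field. rewrite Hab. field. }
  assert (Hx : (Re u / 3) ^ 2 <= ((exp (Re u) - exp (- Re u)) / 2) ^ 2).
  { assert (G : forall x, 0 <= x -> (x / 3) ^ 2 <= ((exp x - exp (- x)) / 2) ^ 2).
    { intros x Hx. apply pow_incr. split. lra.
      assert (A := exp_ineq1_le x).
      assert (B : exp (- x) <= exp 0) by (apply exp_le_mono; lra). rewrite exp_0 in B. lra. }
    destruct (Rle_lt_dec 0 (Re u)) as [H | H]. now apply G.
    generalize (G (- Re u) ltac:(lra)). rewrite Ropp_involutive.
    intros A. replace ((Re u / 3) ^ 2) with ((- Re u / 3) ^ 2) by field.
    eapply Rle_trans. exact A. right. field. }
  assert (Hy : (Im u / 3) ^ 2 <= sin (Im u) ^ 2).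
  { apply Rabs_le_between in Hu.
    destruct (Rle_lt_dec 0 (Im u)) as [H | H].
    - apply pow_incr. split. lra. apply sin_ge_third. lra.
    - replace ((Im u / 3) ^ 2) with ((- Im u / 3) ^ 2) by field.
      replace (sin (Im u) ^ 2) with (sin (- Im u) ^ 2) by (rewrite sin_neg; ring).
      apply pow_incr. split. lra. apply sin_ge_third. lra. }
  assert (E2 := Cmod2_alt u).
  apply Rsqr_incr_0_var; [ | apply Cmod_ge_0 ]. rewrite !Rsqr_pow2, E.
  replace ((Cmod u / 3) ^ 2) with (Cmod u ^ 2 * / 9) by field. rewrite E2. lra.
Qed.

(* pi^2 / sin^2 (pi z), written in terms of q *)
Definition L2 (z : C) : C := (tpi * tpi * nome z / ((1 - nome z) * (1 - nome z)))%C.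

Lemma nome_eq_1_int (z : C) : nome z = 1 -> ~ nonint z.
Proof.
  intros H Hz.
  assert (HI : Im z = 0).
  { assert (A := Cmod_nome z). rewrite H, Cmod_1, <- exp_0 in A. apply exp_inv in A.
    assert (Hp := PI_RGT_0). nra. }
  assert (HR : cos (2 * PI * Re z) = 1).
  { assert (A : Re (nome z) = 1) by now rewrite H.
    rewrite nome_exp in A. unfold C_exp in A. simpl in A.
    unfold Im in HI. rewrite HI in A.
    replace (0 * fst z - 2 * PI * 0) with 0 in A by ring. rewrite exp_0 in A.
    replace (0 * 0 + 2 * PI * fst z) with (2 * PI * Re z) in A by (unfold Re; ring). lra. }
  assert (HS : sin (PI * Re z) = 0).
  { replace (2 * PI * Re z) with (2 * (PI * Re z)) in HR by ring.
    rewrite cos_2a_sin in HR. assert (A : sin (PI * Re z) * sin (PI * Re z) = 0) by lra.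
    destruct (Rmult_integral _ _ A); trivial. }
  apply sin_eq_0_0 in HS. destruct HS as [k Hk].
  assert (Hk2 : Re z = IZR k) by (assert (Hp := PI_RGT_0); apply Rmult_eq_reg_l with PI; lra).
  assert (Ez : z = RtoC (IZR k)) by (apply C_ext; simpl; trivial).
  destruct (Z_le_gt_dec 0 k) as [Hk0 | Hk0].
  - destruct (Hz (Z.to_nat k)) as [_ A]. apply A. rewrite Ez. unfold NtoC.
    rewrite INR_IZR_INZ, Z2Nat.id by lia. ring.
  - destruct (Hz (Z.to_nat (- k))) as [A _]. apply A. rewrite Ez. unfold NtoC.
    rewrite INR_IZR_INZ, Z2Nat.id, opp_IZR, RtoC_opp by lia. ring.
Qed.

Lemma one_minus_nome_nz (z : C) : nonint z -> (1 - nome z)%C <> 0.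
Proof.
  intros Hz E. apply (nome_eq_1_int z); trivial. symmetry. now apply Ceq_minus.
Qed.

Lemma L2_duplication (z : C) : nonint z -> (L2 (z / 2) + L2 ((z + 1) / 2))%C = (4 * L2 z)%C.
Proof.
  intros Hz. assert (H2 := C2_nz).
  assert (A1 := one_minus_nome_nz _ (nonint_half z Hz)).
  assert (A2 := one_minus_nome_nz _ (nonint_half _ (nonint_incr z Hz))).
  assert (A3 := one_minus_nome_nz _ Hz).
  unfold L2. set (r := nome (z / 2)) in *.
  assert (E1 : nome ((z + 1) / 2) = (- r)%C).
  { replace ((z + 1) / 2)%C with (z / 2 + RtoC (/ 2))%C by (rewrite RtoC_inv by lra; field; trivial).
    rewrite nome_plus, nome_half. unfold r. ring. }
  assert (E2 : nome z = (r * r)%C).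
  { unfold r. rewrite <- nome_plus. f_equal. field; trivial. }
  rewrite E1, E2 in *. field. repeat split; trivial.
Qed.

(** With u = pi i z one has [L2 z] = u^2 / (z sinh u)^2, so the difference is (sinh u - u)(sinh u +
    u) / (z sinh u)^2. The cubic vanishing of sinh u - u absorbs the pole, and |Re z| <= 1/2 is the
    strip of [Csinh_lower]. *)
Lemma L2_pole_bound (X : R) : exists K, forall z : C, z <> 0 -> Rabs (Re z) <= / 2 -> Rabs (Im z) <= X ->
  Cmod (/ (z * z) - L2 z) <= K.
Proof.
  (* The factor exp(pi X) comes from the cubic remainder; 3/|u| bounds 1/sinh u and 9/|u| bounds
     u/sinh^2 u; pi^2 is |u|^2/|z|^2. *)
  exists (exp (PI * X) * (3 + 9) * (PI * PI)). intros z Hz HR HI.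
  set (u := (tpi * z / 2)%C).
  assert (Hpi := PI_RGT_0).
  assert (H2 := C2_nz).
  assert (HuR : Rabs (Re u) <= PI * X).
  { replace (Re u) with (- (PI * Im z)).
    rewrite Rabs_Ropp, Rabs_mult, (Rabs_pos_eq PI) by lra. apply Rmult_le_compat_l; lra.
    unfold u. replace (tpi * z / 2)%C with (tpi * z * RtoC (/ 2))%C by (rewrite RtoC_inv by lra; reflexivity).
    rewrite re_scal_r. unfold tpi, Re, Im; simpl. field. }
  assert (HuI : Rabs (Im u) <= PI / 2).
  { replace (Im u) with (PI * Re z).
    rewrite Rabs_mult, (Rabs_pos_eq PI) by lra. apply Rle_trans with (PI * / 2). apply Rmult_le_compat_l; lra. lra.
    unfold u. replace (tpi * z / 2)%C with (tpi * z * RtoC (/ 2))%C by (rewrite RtoC_inv by lra; reflexivity).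
    rewrite im_scal_r. unfold tpi, Re, Im; simpl. field. }
  assert (HuM : Cmod u = PI * Cmod z).
  { unfold u. rewrite Cmod_div by exact C2_nz. rewrite Cmod_mult, Cmod_tpi, (Cmod_R 2), (Rabs_pos_eq 2) by lra. field. }
  assert (Hz0 : 0 < Cmod z) by now apply Cmod_gt_0.
  assert (Hu0 : 0 < Cmod u) by (rewrite HuM; now apply Rmult_lt_0_compat).
  assert (Hs := Csinh_lower u HuI).
  assert (Hsn : Csinh u <> 0) by (apply Cmod_gt_0; lra).
  assert (Hsu := Csinh_id_bound u _ HuR).
  assert (E : (/ (z * z) - L2 z)%C = (/ (z * z) * ((Csinh u - u) * (/ Csinh u + u * (/ Csinh u * / Csinh u))))%C).
  { set (e := C_exp u). assert (He : e <> 0) by apply C_exp_nz.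
    assert (Eq : nome z = (e * e)%C).
    { unfold e. rewrite <- C_exp_plus, nome_exp. f_equal. unfold u. field; trivial. }
    assert (Et : tpi = (2 * u / z)%C) by (unfold u; field; trivial).
    assert (Es : Csinh u = ((e * e - 1) / (2 * e))%C).
    { unfold Csinh. rewrite C_exp_opp. fold e. field; trivial. }
    assert (Hee : (e * e - 1)%C <> 0).
    { intros E. apply Hsn. rewrite Es, E. field; trivial. }
    unfold L2. rewrite Eq, Et. rewrite Es. field. repeat split; trivial.
    intros E. apply Hee. replace (e * e - 1)%C with (- (1 - e * e))%C by ring. rewrite E; ring. }
  rewrite E. rewrite !Cmod_mult, Cmod_inv by now apply Cmult_neq_0. rewrite Cmod_mult.
  assert (Hi : / Cmod (Csinh u) <= 3 / Cmod u).
  { replace (3 / Cmod u) with (/ (Cmod u / 3)) by (field; lra). apply Rinv_le_contravar; lra. }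
  assert (Hi0 : 0 < / Cmod (Csinh u)) by (apply Rinv_0_lt_compat; lra).
  assert (Hb : Cmod (/ Csinh u + u * (/ Csinh u * / Csinh u)) <= (3 + 9) / Cmod u).
  { eapply Rle_trans. apply Cmod_triangle. rewrite !Cmod_mult, Cmod_inv by trivial.
    assert (A : Cmod u * (/ Cmod (Csinh u) * / Cmod (Csinh u)) <= Cmod u * ((3 / Cmod u) * (3 / Cmod u))).
    { apply Rmult_le_compat_l. lra. apply Rmult_le_compat; lra. }
    replace (Cmod u * (3 / Cmod u * (3 / Cmod u))) with (9 / Cmod u) in A by (field; lra).
    replace ((3 + 9) / Cmod u) with (3 / Cmod u + 9 / Cmod u) by (field; lra). lra. }
  apply Rle_trans with (/ (Cmod z * Cmod z) * ((exp (PI * X) * Cmod u * Cmod u * Cmod u) * ((3 + 9) / Cmod u))).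
  - apply Rmult_le_compat_l. left; apply Rinv_0_lt_compat; nra.
    apply Rmult_le_compat; trivial; apply Cmod_ge_0.
  - right. rewrite HuM. field. split; lra.
Qed.

Definition hdiff (z : C) : C := (Phi 2 z - L2 z)%C.

Lemma hdiff_periodic (z : C) : nonint z -> hdiff (z + 1) = hdiff z.
Proof. intros Hz. unfold hdiff, L2. now rewrite Phi_periodic, nome_periodic. Qed.

Lemma hdiff_periodic_n (z : C) (n : nat) : nonint z ->
  nonint (z + NtoC n) /\ hdiff (z + NtoC n) = hdiff z.
Proof.
  intros Hz. induction n as [|n [IH1 IH2]].
  - rewrite NtoC_0, Cplus_0_r. tauto.
  - rewrite NtoC_S, Cplus_assoc. split. now apply nonint_incr. now rewrite hdiff_periodic.
Qed.

Lemma nonint_decr (z : C) : nonint z -> nonint (z - 1).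
Proof.
  intros H. replace (z - 1)%C with (- (- z + 1))%C by ring.
  now apply nonint_opp, nonint_incr, nonint_opp.
Qed.

Lemma nonint_decr_n (z : C) (n : nat) : nonint z -> nonint (z - NtoC n).
Proof.
  intros Hz. induction n as [|n IH].
  - rewrite NtoC_0. now replace (z - 0)%C with z by ring.
  - rewrite NtoC_S. replace (z - (NtoC n + 1))%C with (z - NtoC n - 1)%C by ring. now apply nonint_decr.
Qed.

Lemma hdiff_shift_strip (z : C) : nonint z ->
  exists w, nonint w /\ hdiff w = hdiff z /\ Im w = Im z /\ Rabs (Re w) <= / 2.
Proof.
  intros Hz. destruct (archimed (Re z + / 2)) as [A1 A2].
  set (k := (up (Re z + / 2) - 1)%Z).
  assert (Hk : IZR k = IZR (up (Re z + / 2)) - 1) by (unfold k; now rewrite minus_IZR).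
  assert (HR : Rabs (Re z - IZR k) <= / 2) by (apply Rabs_le; lra).
  destruct (Z_le_gt_dec 0 k) as [Hk0 | Hk0].
  - exists (z - NtoC (Z.to_nat k))%C.
    assert (Hw := nonint_decr_n z (Z.to_nat k) Hz). split. exact Hw.
    destruct (hdiff_periodic_n _ (Z.to_nat k) Hw) as [_ E]. rewrite <- E.
    split. f_equal; ring. unfold Cminus, NtoC. rewrite im_plus, re_plus, <- RtoC_opp, im_RtoC, re_RtoC.
    rewrite INR_IZR_INZ, Z2Nat.id by lia. split. ring. exact HR.
  - exists (z + NtoC (Z.to_nat (- k)))%C.
    destruct (hdiff_periodic_n z (Z.to_nat (- k)) Hz) as [Hw E]. split. exact Hw. split. exact E.
    unfold NtoC. rewrite im_plus, re_plus, im_RtoC, re_RtoC.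
    rewrite INR_IZR_INZ, Z2Nat.id, opp_IZR by lia. split. ring. exact HR.
Qed.

Lemma sep_strip (z : C) : Rabs (Re z) <= / 2 -> sep (/ 2) z.
Proof.
  intros H n. assert (Hn := INR_S_ge1 n). apply Rabs_le_between in H.
  split.
  - eapply Rle_trans; [ | apply re_le_Cmod ]. rewrite re_plus. unfold NtoC. rewrite re_RtoC.
    eapply Rle_trans; [ | apply Rle_abs ]. lra.
  - eapply Rle_trans; [ | apply re_le_Cmod ]. unfold Cminus. rewrite re_plus, re_opp. unfold NtoC. rewrite re_RtoC.
    rewrite <- Rabs_Ropp. eapply Rle_trans; [ | apply Rle_abs ]. lra.
Qed.

(** Periodicity moves z into |Re z| <= 1/2. There the pole at 0 is cancelled by [L2], and the terms
    with n nonzero satisfy |z +- n| >= n/2. *)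
Lemma hdiff_bounded (X : R) : exists M, 0 <= M /\ forall z, nonint z -> Rabs (Im z) <= X -> Cmod (hdiff z) <= M.
Proof.
  destruct (L2_pole_bound X) as [K HK]. destruct ex_series_invsq as [B HB].
  set (c2 := 2 * (/ / 2) ^ 2).
  exists (Rmax 0 (K + c2 * B)). split. apply Rmax_l. intros z Hz HI.
  eapply Rle_trans; [ | apply Rmax_r ].
  destruct (hdiff_shift_strip z Hz) as [w [Hw [E [EI HR]]]].
  rewrite <- E. rewrite <- EI in HI.
  assert (Hw0 := nonint_nz w Hw).
  unfold hdiff. replace (Phi 2 w - L2 w)%C with ((/ (w * w) - L2 w) + (Phi 2 w - / Cpow w 2))%C
    by (simpl Cpow; rewrite Cmult_1_r; ring).
  eapply Rle_trans. apply Cmod_triangle. apply Rplus_le_compat. now apply HK.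
  apply (Csums_le (pterm 2 w) (fun n => c2 * invsq n)).
  - intros n. apply (pterm_bound (/ 2)). lra. now apply sep_strip.
  - apply (is_series_scal c2 invsq B HB).
  - now apply pterm_sums.
Qed.

(* Herglotz' trick: the difference satisfies 4 h(z) = h(z/2) + h((z+1)/2), so any bound
   for it on a horizontal strip can be halved. *)
Lemma Phi2_nome (z : C) : nonint z -> Phi 2 z = L2 z.
Proof.
  (* The strip |Im w| <= |Im z| is stable under w/2 and (w+1)/2, so the bound improves to M/2, M/4,
     ... on all of its non-integral points at once. *)
  intros Hz. destruct (hdiff_bounded (Rabs (Im z))) as [M [HM0 HM]].
  assert (H : forall n w, nonint w -> Rabs (Im w) <= Rabs (Im z) -> Cmod (hdiff w) <= M * (/ 2) ^ n).
  { induction n as [|n IH]; intros w Hw HI.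
    - simpl. rewrite Rmult_1_r. now apply HM.
    - assert (H2 := C2_nz).
      assert (E : hdiff w = ((hdiff (w / 2) + hdiff ((w + 1) / 2)) * RtoC (/ 4)%R)%C).
      { unfold hdiff. replace (Phi 2 (w / 2) - L2 (w / 2) + (Phi 2 ((w + 1) / 2) - L2 ((w + 1) / 2)))%C
          with ((Phi 2 (w / 2) + Phi 2 ((w + 1) / 2)) - (L2 (w / 2) + L2 ((w + 1) / 2)))%C by ring.
        rewrite Phi2_duplication, L2_duplication by trivial.
        rewrite RtoC_inv by lra. field. }
      assert (Him : forall v, Im v = Im w -> Rabs (Im (v / 2)) <= Rabs (Im z)).
      { intros v Hv. replace (v / 2)%C with (v * RtoC (/ 2))%C by (rewrite RtoC_inv by lra; reflexivity).
        rewrite im_scal_r, Rabs_mult, (Rabs_pos_eq (/ 2)), Hv by lra.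
        assert (P := Rabs_pos (Im w)). lra. }
      assert (B1 := IH (w / 2)%C (nonint_half w Hw) (Him w eq_refl)).
      assert (B2 := IH ((w + 1) / 2)%C (nonint_half _ (nonint_incr w Hw))).
      specialize (B2 (Him (w + 1)%C ltac:(rewrite im_plus, im_RtoC; ring))).
      rewrite E, Cmod_mult, Cmod_R, Rabs_pos_eq by lra.
      assert (B3 := Cmod_triangle (hdiff (w / 2)) (hdiff ((w + 1) / 2))). simpl pow. lra. }
  assert (Hlim : Cmod (hdiff z) <= 0).
  { apply (is_lim_seq_le (fun _ => Cmod (hdiff z)) (fun n => M * (/ 2) ^ n) (Cmod (hdiff z)) 0).
    - intros n. apply H. exact Hz. lra.
    - apply is_lim_seq_const.
    - apply is_lim_seq_scal0. apply is_lim_seq_geom. rewrite Rabs_pos_eq; lra. }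
  apply Ceq_minus, Cmod_eq_0. apply Rle_antisym; [ exact Hlim | apply Cmod_ge_0 ].
Qed.

(** * Partial fractions for the exponents 1, 3, 4 and the values zeta(2), zeta(4) *)

Lemma is_Cderive_unique (f : C -> C) (z l m : C) :
  is_Cderive f z l -> is_Cderive f z m -> l = m.
Proof.
  intros Hl Hm. rewrite is_Cderive_eps in Hl, Hm.
  apply Ceq_minus, Cmod_eq_0. apply Rle_antisym; [ | apply Cmod_ge_0 ].
  apply Rnot_lt_le. intros H.
  assert (He : 0 < Cmod (l - m) / 4) by lra.
  destruct (Hl (mkposreal _ He)) as [d1 H1]. destruct (Hm (mkposreal _ He)) as [d2 H2]. simpl in H1, H2.
  assert (Hd : 0 < Rmin d1 d2) by (apply Rmin_pos; apply cond_pos).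
  set (w := (z + RtoC (Rmin d1 d2 / 2))%C).
  assert (Hw : Cmod (w - z) = Rmin d1 d2 / 2).
  { unfold w. replace (z + RtoC (Rmin d1 d2 / 2) - z)%C with (RtoC (Rmin d1 d2 / 2)) by ring.
    rewrite Cmod_R. apply Rabs_pos_eq. lra. }
  assert (A1 := Rmin_l d1 d2). assert (A2 := Rmin_r d1 d2).
  specialize (H1 w ltac:(lra)). specialize (H2 w ltac:(lra)).
  assert (A : Cmod ((l - m) * (w - z)) <= Cmod (l - m) / 2 * Cmod (w - z)).
  { replace ((l - m) * (w - z))%C with ((f w - f z - m * (w - z)) - (f w - f z - l * (w - z)))%C by ring.
    eapply Rle_trans. apply Cmod_minus_le. lra. }
  rewrite Cmod_mult in A. rewrite Hw in A. nra.
Qed.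

(** This is pi cot(pi z) in terms of q, with derivative [- L2]; [L3] and [L4] are the first and
    second derivatives of [L2]. *)
Definition L1 (z : C) : C := (- (tpi / 2) * (1 + nome z) / (1 - nome z))%C.
Definition L3 (z : C) : C :=
  (tpi * tpi * tpi * nome z * (1 + nome z) / ((1 - nome z) * (1 - nome z) * (1 - nome z)))%C.
Definition L4 (z : C) : C :=
  (tpi * tpi * tpi * tpi * nome z * (1 + 4 * nome z + nome z * nome z) /
    ((1 - nome z) * (1 - nome z) * (1 - nome z) * (1 - nome z)))%C.

Ltac Cderiv_nome :=
  lazymatch goal with
  | |- is_Cderive (fun w => Cminus (@?f w) (@?g w)) _ _ =>
      apply (is_Cderive_minus f g); Cderiv_nome
  | |- is_Cderive (fun w => Cplus (@?f w) (@?g w)) _ _ =>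
      apply (is_Cderive_plus f g); Cderiv_nome
  | |- is_Cderive (fun w => Cmult (@?f w) (@?g w)) _ _ =>
      apply (is_Cderive_mult f g); Cderiv_nome
  | |- is_Cderive (fun w => nome w) _ _ => apply is_Cderive_nome
  | |- is_Cderive nome _ _ => apply is_Cderive_nome
  | |- is_Cderive (fun _ => ?c) _ _ => apply (is_Cderive_const c)
  end.

Lemma is_Cderive_L1 (z : C) : (1 - nome z)%C <> 0 -> is_Cderive L1 z (- L2 z).
Proof.
  intros H. eapply is_Cderive_eq.
  - apply (is_Cderive_div (fun z => - (tpi / 2) * (1 + nome z))%C (fun z => 1 - nome z)%C).
    exact H. Cderiv_nome. Cderiv_nome.
  - cbv beta. unfold L2. field. exact H.
Qed.

Lemma is_Cderive_L2 (z : C) : (1 - nome z)%C <> 0 -> is_Cderive L2 z (L3 z).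
Proof.
  intros H. eapply is_Cderive_eq.
  - apply (is_Cderive_div (fun z => tpi * tpi * nome z)%C (fun z => (1 - nome z) * (1 - nome z))%C).
    now apply Cmult_neq_0. Cderiv_nome. Cderiv_nome.
  - cbv beta. unfold L3. field. exact H.
Qed.

Lemma is_Cderive_L3 (z : C) : (1 - nome z)%C <> 0 -> is_Cderive L3 z (L4 z).
Proof.
  intros H. eapply is_Cderive_eq.
  - apply (is_Cderive_div (fun z => tpi * tpi * tpi * nome z * (1 + nome z))%C
      (fun z => (1 - nome z) * (1 - nome z) * (1 - nome z))%C).
    repeat apply Cmult_neq_0; exact H. Cderiv_nome. Cderiv_nome.
  - cbv beta. unfold L4. field. exact H.
Qed.

Lemma NtoC_2 : NtoC 2 = 2.
Proof. rewrite !NtoC_S, NtoC_0. rewrite <- !RtoC_plus. f_equal. ring. Qed.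

Lemma NtoC_3 : NtoC 3 = 3.
Proof. rewrite !NtoC_S, NtoC_0. rewrite <- !RtoC_plus. f_equal. ring. Qed.

Lemma Phi3_nome (z : C) : nonint z -> (- 2 * Phi 3 z)%C = L3 z.
Proof.
  intros Hz. destruct (nonint_open z Hz) as [r [Hr [Hn _]]].
  replace (- 2 * Phi 3 z)%C with (- NtoC 2 * Phi 3 z)%C by (rewrite NtoC_2; ring).
  apply (is_Cderive_unique (Phi 2) z).
  - now apply Phi_derive.
  - apply (is_Cderive_ext_loc L2 _ _ _ r Hr).
    + intros w Hw. symmetry. apply Phi2_nome. auto.
    + apply is_Cderive_L2. now apply one_minus_nome_nz.
Qed.

Lemma Phi4_nome (z : C) : nonint z -> (6 * Phi 4 z)%C = L4 z.
Proof.
  intros Hz. destruct (nonint_open z Hz) as [r [Hr [Hn _]]].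
  replace (6 * Phi 4 z)%C with (- 2 * (- NtoC 3 * Phi 4 z))%C
    by (rewrite NtoC_3; ring).
  apply (is_Cderive_unique (fun z => - 2 * Phi 3 z)%C z).
  - apply is_Cderive_scal. now apply Phi_derive.
  - apply (is_Cderive_ext_loc L3 _ _ _ r Hr).
    + intros w Hw. symmetry. apply Phi3_nome. auto.
    + apply is_Cderive_L3. now apply one_minus_nome_nz.
Qed.

Lemma H_nonint (z : C) : upper_half_plane z -> nonint z.
Proof.
  intros Hz n. unfold upper_half_plane in Hz.
  split; intros E; apply (f_equal Im) in E; revert E; unfold Cminus, NtoC;
    [ rewrite im_plus | rewrite im_plus, im_opp ]; rewrite !im_RtoC; lra.
Qed.

Lemma nonint_half_pt : nonint (RtoC (/ 2)).
Proof.
  intros n. split; intros E; apply (f_equal Re) in E; revert E; unfold Cminus, NtoC;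
    [ rewrite re_plus | rewrite re_plus, re_opp ]; rewrite !re_RtoC; intros E.
  - generalize (pos_INR n). lra.
  - assert (E2 : INR (2 * n) = 1) by (rewrite mult_INR; simpl (INR 2); lra).
    apply (INR_eq _ 1) in E2. lia.
Qed.

Lemma strip_nonint (z : C) : 0 < Re z < 1 -> nonint z.
Proof.
  intros Hz n. split; intros E; apply (f_equal Re) in E; revert E; unfold Cminus, NtoC;
    [ rewrite re_plus | rewrite re_plus, re_opp ]; rewrite !re_RtoC; intros E.
  - generalize (pos_INR n). lra.
  - assert (E0 : INR 0 < INR n < INR 1) by (simpl; lra).
    destruct E0 as [E0 E1]. apply INR_lt in E0. apply INR_lt in E1. lia.
Qed.

Lemma Cconvex_strip : Cconvex (fun z => 0 < Re z < 1).
Proof.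
  intros a b t Ha Hb Ht. unfold Cminus. rewrite re_plus, re_scal_l, re_plus, re_opp.
  replace (Re a + t * (Re b + - Re a)) with ((1 - t) * Re a + t * Re b) by ring.
  destruct (Req_dec t 0) as [-> | H0]. lra.
  destruct (Req_dec t 1) as [-> | H1]. lra.
  assert (0 < t * Re b) by (apply Rmult_lt_0_compat; lra).
  assert (0 < (1 - t) * Re a) by (apply Rmult_lt_0_compat; lra).
  assert (0 < t * (1 - Re b)) by (apply Rmult_lt_0_compat; lra).
  assert (0 < (1 - t) * (1 - Re a)) by (apply Rmult_lt_0_compat; lra). lra.
Qed.

Lemma is_Cderive_Phi1_L1 (z : C) : nonint z -> is_Cderive (fun w => Phi 1 w - L1 w)%C z 0.
Proof.
  intros Hz. eapply is_Cderive_eq.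
  - apply is_Cderive_minus. now apply Phi_derive. apply is_Cderive_L1. now apply one_minus_nome_nz.
  - rewrite (Phi2_nome z Hz), NtoC_S, NtoC_0. ring.
Qed.

(** At 1/2 the terms for n and -(n+1) are opposite, so the symmetric sum over |n| <= K collapses to
    1/(1/2 + K). *)
Lemma Phi1_half : Phi 1 (RtoC (/ 2)) = 0.
Proof.
  apply (Cconv_unique (partialPhi 1 (RtoC (/ 2)))).
  - apply partialPhi_conv, nonint_half_pt.
  - apply (Cconv_ext (fun n => / (RtoC (/ 2) + NtoC n))%C).
    + intros n. induction n as [|n IH].
      * unfold partialPhi. simpl csum. rewrite NtoC_0. simpl Cpow. rewrite !Cplus_0_r, Cmult_1_r. reflexivity.
      * unfold partialPhi in *. simpl csum. rewrite Cplus_assoc, <- IH. unfold pterm.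
        destruct (nonint_half_pt n) as [A _]. destruct (nonint_half_pt (S n)) as [B B'].
        rewrite NtoC_S in *.
        assert (E : (RtoC (/ 2) - (NtoC n + 1))%C = (- (RtoC (/ 2) + NtoC n))%C).
        { rewrite RtoC_inv by lra. field. }
        rewrite E. simpl Cpow. field. tauto.
    + apply Cconv_inv_INR. intros n; apply nonint_half_pt. exists 1. intros n.
      eapply Rle_trans. 2: apply Rplus_le_compat_r; eapply Rle_trans; [ apply Rle_abs | apply re_le_Cmod ].
      rewrite re_plus. unfold NtoC. rewrite !re_RtoC, S_INR. lra.
Qed.

(** The derivatives agree by [Phi2_nome]. The constant is known at 1/2, outside the half-plane, so
    it is carried first through the strip 0 < Re z < 1, then from 1/2 + i to all of the
    half-plane. *)
Lemma Phi1_nome (z : C) : upper_half_plane z -> Phi 1 z = L1 z.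
Proof.
  intros Hz.
  assert (E1 : forall w, 0 < Re w < 1 -> (Phi 1 w - L1 w)%C = 0).
  { intros w Hw.
    rewrite (is_Cderive_zero_const _ (fun w => Phi 1 w - L1 w)%C Cconvex_strip
      (fun z Hz => is_Cderive_Phi1_L1 z (strip_nonint z Hz)) w (RtoC (/ 2)) Hw ltac:(simpl; lra)).
    rewrite Phi1_half. unfold L1. rewrite nome_half. field. }
  apply Ceq_minus.
  set (w := (/ 2, 1) : C).
  rewrite (is_Cderive_zero_const _ (fun w => Phi 1 w - L1 w)%C Cconvex_H
      (fun z Hz => is_Cderive_Phi1_L1 z (H_nonint z Hz)) z w Hz ltac:(unfold upper_half_plane; simpl; lra)).
  apply E1. simpl. lra.
Qed.

Lemma zeta_sums (k : nat) : exists l, Csums (fun n => / Cpow (NtoC (S n)) (S (S k)))%C l.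
Proof.
  apply (Csums_dominated _ invsq); [ | apply ex_series_invsq ]. intros n.
  eapply Rle_trans. apply (inv_pow_sep_le 1 _ n k). lra. rewrite Cmod_NtoC; lra.
  rewrite Rinv_1, pow1. lra.
Qed.

(* The terms 2^k / (2n+1)^k of Phi k (1/2) are the odd terms of the zeta series. *)
Lemma Phi_half_zeta (i : nat) (l : C) :
  Csums (fun n => / Cpow (NtoC (S n)) (2 * S i))%C l ->
  (Phi (2 * S i) (RtoC (/ 2)) + 2 * l)%C = (2 * Cpow 2 (2 * S i) * l)%C.
Proof.
  intros Hl. assert (H2 := C2_nz). assert (Hn := nonint_half_pt).
  set (k := (2 * S i)%nat) in *.
  (* The numbers 1/2 + n with |n| <= K are halves of odd numbers: 1, ..., 2K-1 occur twice up to
     sign, 2K+1 once. Adding twice the even terms completes the sum to 2K. *)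
  assert (E : forall K, (partialPhi k (RtoC (/ 2)) K + 2 * csum (fun n => / Cpow (NtoC (S n)) k) K)%C
    = (2 * Cpow 2 k * csum (fun n => / Cpow (NtoC (S n)) k) (K + K) + / Cpow (RtoC (/ 2) + NtoC K) k)%C).
  { induction K as [|K IH].
    - unfold partialPhi. cbn [csum Nat.add]. rewrite NtoC_0, (Cplus_0_r (RtoC (/ 2))). ring.
    - unfold partialPhi in *. rewrite Nat.add_succ_r, Nat.add_succ_l. cbn [csum].
      set (U := csum (pterm k (RtoC (/ 2))) K) in *.
      set (V := csum (fun n : nat => / NtoC (S n) ^ k)%C K) in *.
      set (W := csum (fun n : nat => / NtoC (S n) ^ k)%C (K + K)) in *.
      transitivity ((/ RtoC (/ 2) ^ k + U + 2 * V) + (pterm k (RtoC (/ 2)) K + 2 * / NtoC (S K) ^ k))%C; [ ring | ].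
      rewrite IH. unfold pterm.
      destruct (Hn K) as [A _]. assert (B := NtoC_S_nz K).
      set (h := (RtoC (/ 2) + NtoC K)%C) in *.
      assert (EK : NtoC (K + K) = (NtoC K + NtoC K)%C) by (unfold NtoC; now rewrite plus_INR, RtoC_plus).
      assert (E1 : NtoC (S (K + K)) = (2 * h)%C).
      { unfold h. rewrite NtoC_S, EK, RtoC_inv by lra. field. }
      assert (E2 : NtoC (S (S (K + K))) = (2 * NtoC (S K))%C) by (rewrite !NtoC_S, EK; ring).
      assert (E3 : Cpow (RtoC (/ 2) - NtoC (S K)) k = Cpow h k).
      { unfold k. rewrite !Cpow_mult_r. f_equal. unfold h. rewrite NtoC_S, RtoC_inv by lra. simpl Cpow. field. }
      rewrite E1, E2, E3, !Cpow_mult_l.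
      assert (A' := Cpow_nz h k A). assert (B' := Cpow_nz _ k B). assert (T' := Cpow_nz 2 k H2).
      set (X := (/ Cpow (RtoC (/ 2) + NtoC (S K)) k)%C).
      set (a := Cpow h k) in *. set (b := Cpow (NtoC (S K)) k) in *. set (t := Cpow 2 k) in *.
      field. tauto. }
  apply (Cconv_unique (fun K => partialPhi k (RtoC (/ 2)) K + 2 * csum (fun n => / Cpow (NtoC (S n)) k) K)%C).
  - apply Cconv_plus. now apply (partialPhi_conv (i + (S i + 0))). now apply Cconv_scal.
  - apply (Cconv_ext _ _ _ (fun K => eq_sym (E K))).
    rewrite <- (Cplus_0_r (2 * Cpow 2 k * l)). apply Cconv_plus.
    + apply Cconv_scal. apply (Cconv_subseq (csum (fun n => / Cpow (NtoC (S n)) k)%C)). intros n; lia. exact Hl.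
    + apply (Cconv_inv_pow_INR (i + (S i + 0))). intros n; apply Hn. exists 1. intros n.
      eapply Rle_trans. 2: apply Rplus_le_compat_r; eapply Rle_trans; [ apply Rle_abs | apply re_le_Cmod ].
      rewrite re_plus. unfold NtoC. rewrite !re_RtoC, S_INR. lra.
Qed.

(** Since [tpi] is 2 pi i, the value is pi^2/6; the one for exponent 4 is pi^4/90. Both come from
    evaluating [L2] and [L4] at 1/2, where q = -1. *)
Lemma zeta2_value : Csums (fun n => / Cpow (NtoC (S n)) 2)%C (- (tpi * tpi) / 24).
Proof.
  destruct (zeta_sums 0) as [l Hl]. replace (- (tpi * tpi) / 24)%C with l. exact Hl.
  assert (E := Phi_half_zeta 0 l Hl). cbn [Nat.mul Nat.add] in E.
  rewrite (Phi2_nome _ nonint_half_pt) in E. unfold L2 in E. rewrite nome_half in E.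
  (* 6 = 2 * 2^2 - 2 is the multiple of l that remains. *)
  apply (f_equal (fun x => (x - 2 * l) / 6)%C) in E.
  transitivity ((2 * Cpow 2 2 * l - 2 * l) / 6)%C. simpl Cpow; field. rewrite <- E. field.
Qed.

Lemma zeta4_value : Csums (fun n => / Cpow (NtoC (S n)) 4)%C (tpi * tpi * tpi * tpi / 1440).
Proof.
  destruct (zeta_sums 2) as [l Hl]. replace (tpi * tpi * tpi * tpi / 1440)%C with l. exact Hl.
  assert (E := Phi_half_zeta 1 l Hl). cbn [Nat.mul Nat.add] in E.
  assert (EP := Phi4_nome _ nonint_half_pt). unfold L4 in EP. rewrite nome_half in EP.
  (* 180 = 6 (2 * 2^4 - 2), where the 6 is the factor in [Phi4_nome]. *)
  apply (f_equal (fun x => 6 * (x - 2 * l) / 180)%C) in E.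
  transitivity (6 * (2 * Cpow 2 4 * l - 2 * l) / 180)%C. simpl Cpow; field. rewrite <- E.
  replace (6 * (Phi 4 (RtoC (/ 2)) + 2 * l - 2 * l))%C with (6 * Phi 4 (RtoC (/ 2)))%C by ring.
  rewrite EP. field.
Qed.

(** * Divisor sums, Delta and E4 as q-series *)

Lemma nome_NtoC (z : C) (n : nat) : nome (NtoC n * z) = Cpow (nome z) n.
Proof. unfold NtoC. now rewrite nome_pow. Qed.

Lemma NtoC_mult_H (z : C) (n : nat) : upper_half_plane z -> upper_half_plane (NtoC (S n) * z).
Proof.
  unfold upper_half_plane, NtoC. intros Hz. rewrite im_scal_l.
  apply Rmult_lt_0_compat. apply INR_S_pos. exact Hz.
Qed.

(* Divisors d of N are paired with the complementary divisor N / d. *)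
Definition divisor_sum (f : nat -> nat -> R) (N : nat) : R :=
  rsum (fun d => if Nat.eqb (N mod (S d)) 0 then f (S d) (N / S d)%nat else 0) N.

Lemma rsum_ext_lt (u v : nat -> R) (n : nat) :
  (forall k, (k < n)%nat -> u k = v k) -> rsum u n = rsum v n.
Proof.
  induction n as [|n IH]; intros H; simpl. reflexivity.
  rewrite IH, (H n) by (intros; try apply H; lia). reflexivity.
Qed.

Lemma sigma_divisor_sum (k N : nat) : INR (Defs.sigma k N) = divisor_sum (fun d _ => INR d ^ k) N.
Proof.
  (* N is both the length of the list and part of the divisibility test; the two roles are separated
     so that induction runs on the length only. *)
  unfold Defs.sigma, divisor_sum. cut (forall (p : nat -> bool) L, INR (list_sum (map (fun d => Nat.pow d k) (filter p (seq 1 L))))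
    = rsum (fun d => if p (S d) then INR (S d) ^ k else 0) L). { intros H. apply (H (fun d => Nat.eqb (N mod d) 0)). }
  intros p. induction L as [|L IH]. reflexivity.
  rewrite seq_S, filter_app, map_app, list_sum_app, plus_INR, IH.
  change (rsum (fun d : nat => if p (S d) then INR (S d) ^ k else 0) (S L)) with
    (rsum (fun d : nat => if p (S d) then INR (S d) ^ k else 0) L + (if p (S L) then INR (S L) ^ k else 0)).
  f_equal. change (1 + L)%nat with (S L). cbn [filter]. destruct (p (S L)).
  - cbn [map list_sum fold_right]. rewrite Nat.add_0_r. apply pow_INR.
  - reflexivity.
Qed.

Lemma divisor_split (N d : nat) : Nat.eqb (N mod (S d)) 0 = true -> (0 < N)%nat ->
  exists m, (N / S d)%nat = S m /\ N = (S d * S m)%nat.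
Proof.
  intros H HN. apply Nat.eqb_eq in H.
  assert (E : N = (S d * (N / S d))%nat) by (apply Nat.Div0.div_exact; exact H).
  destruct (N / S d)%nat as [|m]. lia. exists m. split. reflexivity. exact E.
Qed.

(** At most N divisors, each contributing at most N^3, give growth N^4. The cube is what sigma_3
    requires. *)
Lemma divisor_sum_bound (f : nat -> nat -> R) :
  (forall d m, Rabs (f (S d) (S m)) <= INR (S d * S m) ^ 3) -> poly_bounded (divisor_sum f).
Proof.
  intros Hf. exists 1, 4%nat. split. lra. intros N. rewrite Rmult_1_l.
  unfold divisor_sum.
  assert (G : forall L, Rabs (rsum (fun d => if Nat.eqb (S N mod (S d)) 0 then f (S d) (S N / S d)%nat else 0) L)
     <= INR L * INR (S N) ^ 3).
  { induction L as [|L IH].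
    - simpl rsum. rewrite Rabs_R0. simpl INR. lra.
    - cbn [rsum]. eapply Rle_trans. apply Rabs_triang. rewrite (S_INR L), Rmult_plus_distr_r, Rmult_1_l.
      apply Rplus_le_compat. exact IH.
      destruct (Nat.eqb (S N mod S L) 0) eqn:E.
      + destruct (divisor_split (S N) L E ltac:(lia)) as [m [-> EN]]. rewrite EN. apply Hf.
      + rewrite Rabs_R0. apply pow_le, pos_INR. }
  eapply Rle_trans. apply G. rewrite <- (tech_pow_Rmult _ 3). apply Rle_refl.
Qed.

Lemma csum_zero_from (u : nat -> C) (n k : nat) :
  (forall i, (n <= i)%nat -> u i = 0) -> csum u (n + k) = csum u n.
Proof.
  intros H. induction k as [|k IH].
  - now rewrite Nat.add_0_r.
  - rewrite Nat.add_succ_r. cbn [csum]. rewrite IH, H by lia. ring.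
Qed.

Lemma Csums_finite (u : nat -> C) (n : nat) :
  (forall i, (n <= i)%nat -> u i = 0) -> Csums u (csum u n).
Proof.
  intros H. unfold Csums, Cconv. apply (is_lim_seq_incr_n _ n).
  apply (is_lim_seq_ext (fun _ => 0)); [ | apply is_lim_seq_const ].
  intros k. rewrite Nat.add_comm, csum_zero_from by exact H.
  unfold Cminus. now rewrite Cplus_opp_r, Cmod_0.
Qed.

Lemma csum_RtoC (u : nat -> R) (c : C) (n : nat) :
  csum (fun k => RtoC (u k) * c)%C n = (RtoC (rsum u n) * c)%C.
Proof. induction n as [|n IH]; cbn [csum rsum]; [ ring | rewrite IH, RtoC_plus; ring ]. Qed.

(* A sum over the multiples of S d, indexed by N with S N in place of N. *)
Lemma csum_multiples (d : nat) (u : nat -> C) (M : nat) :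
  csum (fun N => if Nat.eqb (S N mod (S d)) 0 then u (S N) else RtoC 0) (S d * M)
  = csum (fun m => u (S d * S m)%nat) M.
Proof.
  induction M as [|M IH].
  - rewrite Nat.mul_0_r. reflexivity.
  - cbn [csum]. rewrite <- IH.
    replace (S d * S M)%nat with (S d * M + S d)%nat by lia.
    assert (G : forall k, (k <= d)%nat ->
      csum (fun N => if Nat.eqb (S N mod (S d)) 0 then u (S N) else RtoC 0) (S d * M + k)
      = csum (fun N => if Nat.eqb (S N mod (S d)) 0 then u (S N) else RtoC 0) (S d * M)).
    { induction k as [|k IHk]; intros Hk.
      - now rewrite Nat.add_0_r.
      - rewrite Nat.add_succ_r. cbn [csum]. rewrite IHk by lia.
        replace (S (S d * M + k))%nat with (S k + M * S d)%nat by lia.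
        rewrite Nat.Div0.mod_add, Nat.mod_small by lia. simpl Nat.eqb. cbv iota. ring. }
    rewrite Nat.add_succ_r. cbn [csum]. rewrite (G d) by lia.
    replace (S (S d * M + d))%nat with (S M * S d)%nat by lia.
    rewrite Nat.Div0.mod_mul. simpl Nat.eqb. cbv iota. reflexivity.
Qed.

Section Regroup.
Variables (f : nat -> nat -> R) (z : C).
Hypothesis Hf : forall d m, Rabs (f (S d) (S m)) <= INR (S d * S m) ^ 3.
Hypothesis Hz : upper_half_plane z.

Let q := nome z.
Let Sterm (d m : nat) : C := (RtoC (f (S d) (S m)) * Cpow q (S d * S m))%C.

(** Here r = |q|^(1/4). Half of |q|^N absorbs the cube; the other half is r^N r^N, and for N = dm
    the two factors are at most r^d and r^m, which yields a product majorant. *)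
Lemma qpow_cubic_bound : exists K r, 0 < K /\ 0 < r < 1 /\
  (forall N, INR N ^ 3 * Cmod q ^ N <= K * (r ^ N * r ^ N)).
Proof.
  assert (Hq : 0 < Cmod q < 1) by (split; [ apply Cmod_nome_pos | now apply nome_lt_1 ]).
  destruct (sqrt_lt_1_pos _ Hq) as [Ht Htt]. set (t := sqrt (Cmod q)) in *.
  destruct (sqrt_lt_1_pos _ Ht) as [Hr Hrr]. set (r := sqrt t) in *.
  destruct (pow_poly_bounded 3 t Ht) as [K [HK0 HK]].
  exists K, r. split; [ exact HK0 | split; [ exact Hr | ] ]. intros N.
  rewrite <- Rpow_mult_distr, Hrr, <- Htt, Rpow_mult_distr, <- Rmult_assoc.
  apply Rmult_le_compat_r. apply pow_le; lra. apply HK.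
Qed.

Lemma pow_le_anti (r : R) (m n : nat) : 0 < r < 1 -> (m <= n)%nat -> r ^ n <= r ^ m.
Proof.
  intros Hr H. replace n with (m + (n - m))%nat by lia. rewrite pow_add.
  rewrite <- (Rmult_1_r (r ^ m)) at 2. apply Rmult_le_compat_l. apply pow_le; lra.
  now apply pow_lt_1_pos.
Qed.

Lemma Sterm_bound : exists K r, 0 < K /\ 0 < r < 1 /\
  forall d m, Cmod (Sterm d m) <= K * r ^ S d * r ^ S m.
Proof.
  destruct qpow_cubic_bound as [K [r [HK [Hr H]]]]. exists K, r.
  split; [ exact HK | split; [ exact Hr | ] ]. intros d m. unfold Sterm.
  rewrite Cmod_mult, Cmod_R, Cmod_pow.
  apply Rle_trans with (INR (S d * S m) ^ 3 * Cmod q ^ (S d * S m)).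
  { apply Rmult_le_compat_r. apply pow_le, Cmod_ge_0. apply Hf. }
  eapply Rle_trans. apply H. rewrite Rmult_assoc. apply Rmult_le_compat_l. lra.
  apply Rmult_le_compat; try (apply pow_le; lra); apply pow_le_anti; trivial; nia.
Qed.

Lemma Sterm_row (d : nat) : exists l, Csums (Sterm d) l.
Proof.
  destruct Sterm_bound as [K [r [HK [Hr H]]]].
  apply (Csums_dominated _ _ (H d)). apply ex_series_scal_R. now apply ex_series_geom_S.
Qed.

(** Summation over pairs (d, m) is regrouped by N = dm. The family [b N d], zero unless d divides N,
    turns this into an exchange of the order of summation over a rectangular double sequence. *)
Lemma divisor_sum_regroup (F : nat -> C) : (forall d, Csums (Sterm d) (F d)) ->
  Csums F (qseries (divisor_sum f) z).
Proof.
  intros HF.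
  set (b := fun N d => if Nat.eqb (S N mod (S d)) 0
    then (RtoC (f (S d) (S N / S d)%nat) * Cpow q (S N))%C else RtoC 0).
  destruct qpow_cubic_bound as [K [r [HK [Hr H]]]].
  assert (Hb : forall N d, Cmod (b N d) <= K * r ^ S N * r ^ S d).
  { intros N d. unfold b. destruct (Nat.eqb (S N mod S d) 0) eqn:E.
    - destruct (divisor_split (S N) d E ltac:(lia)) as [m [-> EN]].
      rewrite Cmod_mult, Cmod_R, Cmod_pow.
      apply Rle_trans with (INR (S N) ^ 3 * Cmod q ^ S N).
      { apply Rmult_le_compat_r. apply pow_le, Cmod_ge_0. rewrite EN. apply Hf. }
      eapply Rle_trans. apply H. rewrite Rmult_assoc. apply Rmult_le_compat_l. lra.
      apply Rmult_le_compat_l. apply pow_le; lra. apply pow_le_anti; trivial. nia.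
    - rewrite Cmod_0. apply Rmult_le_pos. apply Rmult_le_pos. lra. apply pow_le; lra. apply pow_le; lra. }
  assert (Hrow : forall N, Csums (b N) (qterm (divisor_sum f) z N)).
  { intros N. unfold qterm, divisor_sum.
    replace (RtoC (rsum (fun d => if Nat.eqb (S N mod S d) 0 then f (S d) (S N / S d)%nat else 0) (S N)) * nome z ^ S N)%C
      with (csum (b N) (S N)).
    (* Past the diagonal the remainder of N+1 is N+1 itself, which is nonzero, so each row is a
       finite sum. *)
    - apply Csums_finite. intros i Hi. unfold b. rewrite Nat.mod_small by lia. reflexivity.
    - rewrite <- csum_RtoC. apply csum_ext. intros d. unfold b.
      destruct (Nat.eqb (S N mod S d) 0); [ reflexivity | ring ]. }
  assert (Hcol : forall d, exists l, Csums (fun N => b N d) l).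
  { intros d. apply (Csums_dominated _ (fun N => K * r ^ S d * r ^ S N)).
    - intros N. eapply Rle_trans. apply Hb. right; ring.
    - apply ex_series_scal_R. now apply ex_series_geom_S. }
  assert (Hcol' : forall d, Csums (fun N => b N d) (F d)).
  { intros d. destruct (Hcol d) as [l Hl]. replace (F d) with l. exact Hl.
    (* The column sum exists by domination; it is identified along the lengths (d+1)M, where exactly
       M multiples of d+1 have been met. *)
    apply (Cconv_unique (fun M => csum (fun N => b N d) (S d * M))).
    - apply (Cconv_subseq (csum (fun N => b N d)) l (fun M => (S d * M)%nat)). intros; lia. exact Hl.
    - apply (Cconv_ext (csum (Sterm d))); [ | apply HF ]. intros M.
      unfold b.
      set (u := fun N => (RtoC (f (S d) (N / S d)%nat) * Cpow q N)%C).
      transitivity (csum (fun m => u (S d * S m)%nat) M).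
      + apply csum_ext. intros m. unfold u, Sterm. rewrite (Nat.mul_comm (S d) (S m)), Nat.div_mul by lia. reflexivity.
      + symmetry. apply (csum_multiples d u). }
  destruct (Csums_Fubini b (fun N => K * r ^ S N) (fun d => r ^ S d) (qterm (divisor_sum f) z) F Hb) as [s [H1 H2]]; trivial.
  - intros N. apply Rmult_le_pos. lra. apply pow_le; lra.
  - intros d. apply pow_le; lra.
  - apply ex_series_scal_R. now apply ex_series_geom_S.
  - now apply ex_series_geom_S.
  - unfold qseries. now rewrite (Csums_series _ _ H1).
Qed.

(** For sigma_k the weight depends on d only, so the natural inner sum runs over d at fixed m; for
    log [Delta] it is the other one. Both orders are therefore provided. *)
Lemma divisor_sum_regroup_swap (G : nat -> C) : (forall m, Csums (fun d => Sterm d m) (G m)) ->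
  Csums G (qseries (divisor_sum f) z).
Proof.
  intros HG. destruct Sterm_bound as [K [r [HK [Hr H]]]].
  assert (HF : forall d, Csums (Sterm d) (C_series (Sterm d))).
  { intros d. destruct (Sterm_row d) as [l Hl]. now rewrite (Csums_series _ _ Hl). }
  destruct (Csums_Fubini Sterm (fun N => K * r ^ S N) (fun d => r ^ S d) (fun d => C_series (Sterm d)) G H) as [s [H1 H2]]; trivial.
  - intros N. apply Rmult_le_pos. lra. apply pow_le; lra.
  - intros d. apply pow_le; lra.
  - apply ex_series_scal_R. now apply ex_series_geom_S.
  - now apply ex_series_geom_S.
  - replace (qseries (divisor_sum f) z) with s. exact H2.
    apply (Csums_unique _ _ _ H1). now apply divisor_sum_regroup.
Qed.

End Regroup.

Lemma poly_bounded_pow (k : nat) : poly_bounded (fun n => (INR n ^ k)%R).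
Proof.
  exists 1, k. split. lra. intros n. rewrite Rabs_pos_eq by apply pow_le, pos_INR. lra.
Qed.

Lemma qseries_ext (a b : nat -> R) (z : C) : (forall n, a (S n) = b (S n)) -> qseries a z = qseries b z.
Proof.
  intros H. unfold qseries, C_series, qterm. f_equal; apply Series_ext; intros n; now rewrite H.
Qed.

Lemma qseries_pow_derive (k : nat) (z : C) : upper_half_plane z ->
  is_Cderive (qseries (fun n => (INR n ^ k)%R)) z (tpi * qseries (fun n => (INR n ^ S k)%R) z).
Proof. intros Hz. apply qseries_derive. apply poly_bounded_pow. exact Hz. Qed.

Lemma one_minus_nome_nz_H (z : C) : upper_half_plane z -> (1 - nome z)%C <> 0.
Proof. intros Hz. now apply one_minus_nome_nz, H_nonint. Qed.

(** A geometric series. The next three values follow by differentiating it; combined with the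
    partial fractions they are Lipschitz' formula, relating sums of 1/(z+n)^k to sums of n^(k-1)
    q^n. *)
Lemma qseries_0_value (z : C) : upper_half_plane z ->
  qseries (fun n => (INR n ^ 0)%R) z = (nome z / (1 - nome z))%C.
Proof.
  intros Hz. assert (Hn := one_minus_nome_nz_H z Hz).
  apply (Cconv_unique (csum (qterm (fun n => (INR n ^ 0)%R) z))).
  - apply qseries_sums; [ apply (poly_bounded_pow 0) | exact Hz ].
  - set (q := nome z) in *.
    apply (Cconv_ext (fun n => q / (1 - q) + (- (q / (1 - q))) * Cpow q n)%C).
    + intros n. induction n as [|n IH]. simpl. ring.
      cbn [csum]. rewrite <- IH. unfold qterm. fold q. rewrite Cpow_S. simpl pow. field. exact Hn.
    + cut (Cconv (fun n => q / (1 - q) + (- (q / (1 - q))) * Cpow q n)%C (q / (1 - q) + (- (q / (1 - q))) * 0)).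
      { now rewrite Cmult_0_r, Cplus_0_r. }
      apply (Cconv_plus (fun _ => q / (1 - q))%C). apply Cconv_const. apply Cconv_scal.
      unfold Cconv. apply (is_lim_seq_ext (fun n => Cmod q ^ n)).
      intros n. rewrite <- Cmod_pow. f_equal. ring.
      apply is_lim_seq_geom. rewrite Rabs_pos_eq by apply Cmod_ge_0. now apply nome_lt_1.
Qed.

Lemma H_open (z : C) : upper_half_plane z -> forall w, Cmod (w - z) < Im z -> upper_half_plane w.
Proof. intros Hz w Hw. apply Im_near in Hw. unfold upper_half_plane. lra. Qed.

Lemma qseries_1_value (z : C) : upper_half_plane z ->
  (tpi * tpi * qseries (fun n => (INR n ^ 1)%R) z)%C = L2 z.
Proof.
  intros Hz. assert (Hn := one_minus_nome_nz_H z Hz).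
  apply (is_Cderive_unique (fun w => tpi * (nome w / (1 - nome w)))%C z).
  - apply (is_Cderive_ext_loc (fun w => tpi * qseries (fun n => (INR n ^ 0)%R) w)%C _ _ _ (Im z) Hz).
    + intros w Hw. now rewrite qseries_0_value by (now apply (H_open z)).
    + eapply is_Cderive_eq. apply is_Cderive_scal. now apply qseries_pow_derive. ring.
  - eapply is_Cderive_eq.
    + apply is_Cderive_scal. apply is_Cderive_div. exact Hn. Cderiv_nome. Cderiv_nome.
    + cbv beta. unfold L2. field. exact Hn.
Qed.

Lemma qseries_2_value (z : C) : upper_half_plane z ->
  (tpi * tpi * tpi * qseries (fun n => (INR n ^ 2)%R) z)%C = L3 z.
Proof.
  intros Hz. apply (is_Cderive_unique L2 z).
  - apply (is_Cderive_ext_loc (fun w => tpi * tpi * qseries (fun n => (INR n ^ 1)%R) w)%C _ _ _ (Im z) Hz).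
    + intros w Hw. now rewrite qseries_1_value by (now apply (H_open z)).
    + eapply is_Cderive_eq. apply is_Cderive_scal. now apply qseries_pow_derive. ring.
  - apply is_Cderive_L2. now apply one_minus_nome_nz_H.
Qed.

Lemma qseries_3_value (z : C) : upper_half_plane z ->
  (tpi * tpi * tpi * tpi * qseries (fun n => (INR n ^ 3)%R) z)%C = L4 z.
Proof.
  intros Hz. apply (is_Cderive_unique L3 z).
  - apply (is_Cderive_ext_loc (fun w => tpi * tpi * tpi * qseries (fun n => (INR n ^ 2)%R) w)%C _ _ _ (Im z) Hz).
    + intros w Hw. now rewrite qseries_2_value by (now apply (H_open z)).
    + eapply is_Cderive_eq. apply is_Cderive_scal. now apply qseries_pow_derive. ring.
  - apply is_Cderive_L3. now apply one_minus_nome_nz_H.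
Qed.

Lemma pow_k_le_cube (k d m : nat) : (k <= 3)%nat -> Rabs (INR (S d) ^ k) <= INR (S d * S m) ^ 3.
Proof.
  intros Hk. rewrite Rabs_pos_eq by apply pow_le, pos_INR.
  apply Rle_trans with (INR (S d) ^ 3).
  - apply Rle_pow. apply INR_S_ge1. exact Hk.
  - apply pow_incr. split. apply pos_INR. apply le_INR. nia.
Qed.

Definition sigmaR (k n : nat) : R := INR (Defs.sigma k n).

Lemma sigmaR_poly_bounded (k : nat) : (k <= 3)%nat -> poly_bounded (sigmaR k).
Proof.
  intros Hk. destruct (divisor_sum_bound (fun d _ => INR d ^ k)) as [K [e [HK H]]].
  { intros d m. now apply pow_k_le_cube. }
  exists K, e. split. exact HK. intros n. unfold sigmaR. rewrite sigma_divisor_sum. apply H.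
Qed.

(** The Lambert series: sum over m and d of d^k q^(md), where the sum over d is a q-series evaluated
    at m z. *)
Lemma sigma_qseries (k : nat) (z : C) : (k <= 3)%nat -> upper_half_plane z ->
  Csums (fun m => qseries (fun n => (INR n ^ k)%R) (NtoC (S m) * z)) (qseries (sigmaR k) z).
Proof.
  intros Hk Hz.
  rewrite (qseries_ext _ (divisor_sum (fun d _ => INR d ^ k)) z) by (intros n; apply sigma_divisor_sum).
  apply divisor_sum_regroup_swap; trivial.
  - intros d m. now apply pow_k_le_cube.
  - intros m. apply (Csums_ext (qterm (fun n => (INR n ^ k)%R) (NtoC (S m) * z))).
    + intros d. unfold qterm. rewrite nome_NtoC, <- Cpow_mult_r. now rewrite Nat.mul_comm.
    + apply qseries_sums. apply poly_bounded_pow. now apply NtoC_mult_H.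
Qed.

(* -log(1 - q) = sum q^n / n *)
Definition inv_nat (n : nat) : R := / INR n.

Lemma inv_nat_poly_bounded : poly_bounded inv_nat.
Proof.
  exists 1, O. split. lra. intros n. unfold inv_nat. assert (H := INR_S_ge1 n).
  rewrite Rabs_pos_eq by (left; apply Rinv_0_lt_compat; lra). simpl pow.
  rewrite <- Rinv_1 at 1. rewrite Rmult_1_r. apply Rinv_le_contravar; lra.
Qed.

Lemma qseries_inv_derive (z : C) : upper_half_plane z ->
  is_Cderive (qseries inv_nat) z (tpi * (nome z / (1 - nome z))).
Proof.
  intros Hz. rewrite <- qseries_0_value by trivial.
  replace (qseries (fun n => (INR n ^ 0)%R) z) with (qseries (fun n => (INR n * inv_nat n)%R) z).
  - now apply qseries_derive; [ apply inv_nat_poly_bounded | ].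
  - apply qseries_ext. intros n. unfold inv_nat. simpl pow. field. assert (H := INR_S_pos n). lra.
Qed.

Lemma is_Cderive_exp_comp (g : C -> C) (z l : C) : is_Cderive g z l ->
  is_Cderive (fun w => C_exp (g w)) z (C_exp (g z) * l).
Proof. intros H. apply (is_Cderive_comp C_exp g). apply is_Cderive_exp. exact H. Qed.

Lemma exp_lim_imag : is_lim_seq (fun n => exp (- (2 * PI * INR (S n)))) 0.
Proof.
  apply (is_lim_seq_ext (fun n => exp (- (2 * PI)) ^ S n)).
  - intros n. induction n as [|n IH].
    + simpl pow. rewrite Rmult_1_r. f_equal. simpl INR. ring.
    + rewrite <- tech_pow_Rmult, IH, <- exp_plus. f_equal. rewrite (S_INR (S n)). ring.
  - apply (is_lim_seq_incr_1 (fun n => exp (- (2 * PI)) ^ n)). apply is_lim_seq_geom.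
    rewrite Rabs_pos_eq by (left; apply exp_pos). rewrite <- exp_0. apply exp_increasing.
    generalize PI_RGT_0. lra.
Qed.

(** A sequence of points going up to the cusp, used to evaluate constants of integration as
    limits. *)
Definition iy (n : nat) : C := (0, INR (S n)).

Lemma Cmod_nome_iy (n : nat) : Cmod (nome (iy n)) = exp (- (2 * PI * INR (S n))).
Proof. rewrite Cmod_nome. reflexivity. Qed.

Lemma nome_iy_lim : Cconv (fun n => nome (iy n)) 0.
Proof.
  unfold Cconv. generalize exp_lim_imag. apply is_lim_seq_ext. intros n.
  rewrite <- Cmod_nome_iy. f_equal. ring.
Qed.

Lemma qseries_iy_lim (a : nat -> R) : poly_bounded a -> Cconv (fun n => qseries a (iy n)) 0.
Proof.
  intros Ha. destruct (qseries_first_order a Ha) as [K [HK H]].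
  apply (Cconv_squeeze _ _ (fun n => (K + Rabs (a 1%nat)) * exp (- (2 * PI * INR (S n))))).
  - intros n. assert (Hn := INR_S_ge1 n). specialize (H (iy n) Hn).
    rewrite Cmod_nome_iy in H. set (e := exp (- (2 * PI * INR (S n)))) in *.
    assert (He : 0 < e <= 1).
    { unfold e. destruct (exp_Im_lt_1 (INR (S n))). lra. lra. }
    replace (qseries a (iy n) - 0)%C with ((qseries a (iy n) - a 1%nat * nome (iy n)) + a 1%nat * nome (iy n))%C by ring.
    eapply Rle_trans. apply Cmod_triangle. rewrite Cmod_mult, Cmod_R, Cmod_nome_iy. fold e.
    assert (K * (e * e) <= K * e) by (apply Rmult_le_compat_l; nra). lra.
  - apply is_lim_seq_scal0, exp_lim_imag.
Qed.

Lemma H_iy (n : nat) : upper_half_plane (iy n).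
Proof. apply INR_S_pos. Qed.

(** The product of 1 - q and exp(sum q^n / n) has zero derivative and tends to 1 at the cusp; no
    branch of the logarithm has to be chosen. *)
Lemma one_minus_nome_exp (z : C) : upper_half_plane z ->
  (1 - nome z)%C = C_exp (- qseries inv_nat z).
Proof.
  intros Hz.
  set (g := fun w => ((1 - nome w) * C_exp (qseries inv_nat w))%C).
  assert (Hg : forall w, upper_half_plane w -> is_Cderive g w 0).
  { intros w Hw. assert (Hn := one_minus_nome_nz_H w Hw). eapply is_Cderive_eq.
    - apply is_Cderive_mult. Cderiv_nome. apply is_Cderive_exp_comp. now apply qseries_inv_derive.
    - cbv beta. field. exact Hn. }
  assert (Hlim : Cconv (fun n => g (iy n)) 1).
  { replace (RtoC 1) with ((1 + - (1) * 0) * C_exp 0)%C by (rewrite C_exp_0; ring).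
    apply Cconv_mult.
    - apply (Cconv_ext (fun n => 1 + - (1) * nome (iy n))%C). intros; ring.
      apply Cconv_plus. apply Cconv_const. apply Cconv_scal, nome_iy_lim.
    - apply (Cconv_continuous C_exp _ _ _ (is_Cderive_exp 0)).
      apply qseries_iy_lim, inv_nat_poly_bounded. }
  assert (E : g z = 1).
  { apply (Cconv_unique (fun n => g (iy n))); [ | exact Hlim ].
    apply (Cconv_ext (fun _ => g z)); [ | apply Cconv_const ].
    intros n. apply (is_Cderive_zero_const _ g Cconvex_H Hg); trivial. apply H_iy. }
  rewrite C_exp_opp. assert (He := C_exp_nz (qseries inv_nat z)).
  transitivity (g z / C_exp (qseries inv_nat z))%C. unfold g; field; trivial. rewrite E. field; trivial.
Qed.

(* The coefficients sigma_1(n) / n of -log prod (1 - q^n) *)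
Definition logcoef : nat -> R := divisor_sum (fun _ m => inv_nat m).

Lemma inv_le_cube (d m : nat) : Rabs (inv_nat (S m)) <= INR (S d * S m) ^ 3.
Proof.
  apply Rle_trans with 1.
  - unfold inv_nat. assert (H := INR_S_ge1 m).
    rewrite Rabs_pos_eq by (left; apply Rinv_0_lt_compat; lra).
    rewrite <- Rinv_1. apply Rinv_le_contravar; lra.
  - rewrite <- (pow1 3). apply pow_incr. split. lra. replace (S d * S m)%nat with (S (d * S m + m)) by lia. apply INR_S_ge1.
Qed.

Lemma logcoef_poly_bounded : poly_bounded logcoef.
Proof. apply divisor_sum_bound. intros; apply inv_le_cube. Qed.

Lemma logcoef_sigma (n : nat) : INR (S n) * logcoef (S n) = sigmaR 1 (S n).
Proof.
  unfold sigmaR, logcoef. rewrite sigma_divisor_sum. unfold divisor_sum. rewrite <- rsum_scal.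
  apply rsum_ext_lt. intros d _. destruct (Nat.eqb (S n mod S d) 0) eqn:E; [ | ring ].
  destruct (divisor_split (S n) d E ltac:(lia)) as [m [-> EN]]. rewrite EN.
  unfold inv_nat. rewrite mult_INR. assert (H := INR_S_pos m). rewrite pow_1. field. lra.
Qed.

Lemma log_product_sums (z : C) : upper_half_plane z ->
  Csums (fun d => qseries inv_nat (NtoC (S d) * z)) (qseries logcoef z).
Proof.
  intros Hz. apply divisor_sum_regroup; trivial.
  - intros; apply inv_le_cube.
  - intros d. apply (Csums_ext (qterm inv_nat (NtoC (S d) * z))).
    + intros m. unfold qterm. now rewrite nome_NtoC, <- Cpow_mult_r.
    + apply qseries_sums. apply inv_nat_poly_bounded. now apply NtoC_mult_H.
Qed.

(** Finite products of the (1 - q^n)^24 are exponentials of finite sums, so convergence of the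
    product follows from continuity of exp. Non-vanishing and the logarithmic derivative come for
    free. *)
Lemma Delta_exp (z : C) : upper_half_plane z ->
  Defs.Delta z = C_exp (tpi * z - 24 * qseries logcoef z).
Proof.
  intros Hz. unfold Defs.Delta.
  assert (E : forall n, C_prod (fun n => Cpow (1 - Cpow (nome z) (S n)) 24) n
    = C_exp (- 24 * csum (fun d => qseries inv_nat (NtoC (S d) * z)) n)).
  { induction n as [|n IH].
    - cbn [C_prod csum]. rewrite Cmult_0_r. symmetry; apply C_exp_0.
    - cbn [C_prod csum]. rewrite IH, <- nome_NtoC, one_minus_nome_exp by now apply NtoC_mult_H.
      rewrite C_exp_pow, <- C_exp_plus. f_equal. replace (INR 24) with 24 by (simpl; ring). ring. }
  rewrite (C_lim_seq_unique _ (C_exp (- 24 * qseries logcoef z))).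
  - rewrite nome_exp, <- C_exp_plus. f_equal. ring.
  - apply (Cconv_ext _ _ _ (fun n => eq_sym (E n))).
    apply (Cconv_continuous C_exp _ _ _ (is_Cderive_exp _)).
    apply Cconv_scal. now apply log_product_sums.
Qed.

Lemma Delta_nz (z : C) : upper_half_plane z -> Defs.Delta z <> 0.
Proof. intros Hz. rewrite Delta_exp by trivial. apply C_exp_nz. Qed.

Definition E2 (z : C) : C := (1 - 24 * qseries (sigmaR 1) z)%C.

(** n times the coefficient sigma_1(n)/n is sigma_1(n): the logarithmic derivative of [Delta] is 2
    pi i [E2]. *)
Lemma Delta_derive (z : C) : upper_half_plane z -> is_Cderive Defs.Delta z (tpi * E2 z * Defs.Delta z).
Proof.
  intros Hz.
  apply (is_Cderive_ext_loc (fun w => C_exp (tpi * w - 24 * qseries logcoef w))%C _ _ _ (Im z) Hz).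
  { intros w Hw. symmetry. apply Delta_exp. now apply (H_open z). }
  eapply is_Cderive_eq.
  - apply is_Cderive_exp_comp. apply is_Cderive_minus.
    + apply is_Cderive_scal, is_Cderive_id.
    + apply is_Cderive_scal. apply qseries_derive. apply logcoef_poly_bounded. exact Hz.
  - cbv beta. rewrite <- Delta_exp by trivial. unfold E2.
    rewrite (qseries_ext _ (sigmaR 1)) by (intros n; apply logcoef_sigma). ring.
Qed.

Lemma E4_qseries (z : C) : E4 z = (1 + 240 * qseries (sigmaR 3) z)%C.
Proof. reflexivity. Qed.

(** * Transformation under z |-> -1/z *)

Definition Sz (z : C) : C := (- / z)%C.

Lemma H_nz (z : C) : upper_half_plane z -> z <> 0.
Proof. intros Hz. now apply nonint_nz, H_nonint. Qed.

Lemma Sz_H (z : C) : upper_half_plane z -> upper_half_plane (Sz z).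
Proof.
  intros Hz. unfold Sz, upper_half_plane in *. rewrite im_opp.
  destruct z as [x y]. unfold Cinv, Im in *. simpl in *.
  assert (0 < x * (x * 1) + y * (y * 1)) by nra.
  replace (- (- y / (x * (x * 1) + y * (y * 1)))) with (y / (x * (x * 1) + y * (y * 1))) by (field; lra).
  now apply Rdiv_lt_0_compat.
Qed.

(** The imaginary part of xz + y is x Im z, which controls x; then |y| <= |xz + y| + x|z| controls
    y. *)
Lemma lattice_lower_bound (z : C) : upper_half_plane z -> exists c, 0 < c /\ forall x y : R, 0 <= x ->
  c * x <= Cmod (RtoC x * z + RtoC y) /\ c * Rabs y <= Cmod (RtoC x * z + RtoC y).
Proof.
  intros Hz. unfold upper_half_plane in Hz. assert (Hm := Cmod_ge_0 z).
  set (c2 := Im z / (Im z + Cmod z)).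
  assert (Hc2 : 0 < c2) by (apply Rdiv_lt_0_compat; lra).
  exists (Rmin (Im z) c2). split. now apply Rmin_pos. intros x y Hx.
  assert (A1 : Im z * x <= Cmod (RtoC x * z + RtoC y)).
  { eapply Rle_trans; [ | apply im_le_Cmod ]. rewrite im_plus, im_scal_l, im_RtoC.
    rewrite Rabs_pos_eq by nra. lra. }
  split.
  - eapply Rle_trans; [ apply Rmult_le_compat_r; [ exact Hx | apply Rmin_l ] | exact A1 ].
  - eapply Rle_trans; [ apply Rmult_le_compat_r; [ apply Rabs_pos | apply Rmin_r ] | ].
    generalize (Cmod_minus_le (RtoC x * z + RtoC y) (RtoC x * z)).
    replace (x * z + y - x * z)%C with (RtoC y) by ring.
    rewrite Cmod_mult, !Cmod_R, (Rabs_pos_eq x) by exact Hx.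
    intros A2. set (P := Cmod (x * z + y)) in *.
    apply Rmult_le_reg_r with (Im z + Cmod z). lra.
    replace (c2 * Rabs y * (Im z + Cmod z)) with (Im z * Rabs y) by (unfold c2; field; lra).
    nra.
Qed.

(** Four factors are shared between two lower bounds, one in m and one in n. This is how a product
    majorant 1/(m^2 n^2) arises from lattice terms of order 4. *)
Lemma Cmod_inv4_le (w1 w2 w3 w4 : C) (a b : R) : 0 < a -> 0 < b ->
  a <= Cmod w1 -> a <= Cmod w2 -> b <= Cmod w3 -> b <= Cmod w4 ->
  Cmod (/ (w1 * w2 * w3 * w4)) <= / (a * a) * / (b * b).
Proof.
  intros Ha Hb H1 H2 H3 H4.
  assert (A : a * a * (b * b) <= Cmod (w1 * w2 * w3 * w4)).
  { rewrite !Cmod_mult, (Rmult_assoc (Cmod w1 * Cmod w2)).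
    apply Rmult_le_compat; try (apply Rmult_le_compat; lra); nra. }
  assert (B : 0 < a * a * (b * b)) by (apply Rmult_lt_0_compat; nra).
  rewrite Cmod_inv by (apply Cmod_gt_0; lra).
  rewrite <- Rinv_mult. apply Rinv_le_contravar; lra.
Qed.

Lemma invsq_scal (c : R) (m : nat) : 0 < c -> / (c * INR (S m) * (c * INR (S m))) = / (c * c) * invsq m.
Proof. intros Hc. assert (H := INR_S_pos m). unfold invsq. field. lra. Qed.

Lemma pterm4_lattice_bound (z : C) : upper_half_plane z -> exists K, 0 < K /\ forall m n,
  Cmod (pterm 4 (NtoC (S m) * z) n) <= K * invsq m * invsq n.
Proof.
  intros Hz. destruct (lattice_lower_bound z Hz) as [c [Hc H]].
  assert (HK : 0 < / (c * c) * / (c * c)) by (apply Rmult_lt_0_compat; apply Rinv_0_lt_compat; nra).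
  exists (2 * (/ (c * c) * / (c * c))). split. lra. intros m n.
  assert (Hm := INR_S_pos m). assert (Hn := INR_S_pos n).
  assert (G : forall w, c * INR (S m) <= Cmod w -> c * INR (S n) <= Cmod w ->
    Cmod (/ Cpow w 4) <= (/ (c * c) * / (c * c)) * invsq m * invsq n).
  { intros w H1 H2. replace (Cpow w 4) with (w * w * w * w)%C by (simpl; ring).
    eapply Rle_trans. apply (Cmod_inv4_le w w w w (c * INR (S m)) (c * INR (S n))); trivial; nra.
    rewrite !invsq_scal by exact Hc. right; ring. }
  unfold pterm. eapply Rle_trans. apply Cmod_triangle.
  destruct (H (INR (S m)) (INR (S n)) ltac:(lra)) as [A1 A2].
  destruct (H (INR (S m)) (- INR (S n)) ltac:(lra)) as [B1 B2].
  rewrite Rabs_Ropp in B2. rewrite Rabs_pos_eq in A2, B2 by lra.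
  rewrite RtoC_opp in B1, B2. fold (NtoC (S m)) (NtoC (S n)) in *.
  assert (G1 := G _ A1 A2). assert (G2 := G _ B1 B2). unfold Cminus. lra.
Qed.

(** mz + n = -z (n(-1/z) - m) and mz - n = z (n(-1/z) + m): rows of the lattice of z are columns of
    that of -1/z, and the even exponent removes the sign. *)
Lemma pterm_swap (k : nat) (z : C) (m n : nat) : upper_half_plane z ->
  pterm (2 * k) (NtoC (S m) * z) n = (/ Cpow z (2 * k) * pterm (2 * k) (NtoC (S n) * Sz z) m)%C.
Proof.
  intros Hz. assert (Hz0 := H_nz z Hz).
  assert (N1 := H_nonint _ (NtoC_mult_H (Sz z) n (Sz_H z Hz)) (S m)).
  assert (N2 := H_nonint _ (NtoC_mult_H z m Hz) (S n)).
  unfold pterm. destruct N1 as [N1 N1']. destruct N2 as [N2 N2'].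
  rewrite Cmult_plus_distr_l, (Cplus_comm (/ Cpow z (2 * k) * _)).
  f_equal.
  - replace (NtoC (S m) * z + NtoC (S n))%C with (- (z * (NtoC (S n) * Sz z - NtoC (S m))))%C
      by (unfold Sz; field; trivial).
    replace (Cpow (- (z * (NtoC (S n) * Sz z - NtoC (S m)))) (2 * k))
      with (Cpow (z * (NtoC (S n) * Sz z - NtoC (S m))) (2 * k)).
    + rewrite Cpow_mult_l. field. split; now apply Cpow_nz.
    + rewrite !Cpow_mult_r. f_equal. simpl; ring.
  - replace (NtoC (S m) * z - NtoC (S n))%C with (z * (NtoC (S n) * Sz z + NtoC (S m)))%C
      by (unfold Sz; field; trivial).
    rewrite Cpow_mult_l. field. split; now apply Cpow_nz.
Qed.

Lemma inv_multiples_sums (k : nat) (z l : C) : z <> 0 ->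
  Csums (fun n => / Cpow (NtoC (S n)) k)%C l ->
  Csums (fun n => / Cpow (NtoC (S n) * z) k)%C (/ Cpow z k * l).
Proof.
  intros Hz Hl. apply (Csums_ext (fun n => / Cpow z k * / Cpow (NtoC (S n)) k)%C).
  - intros n. rewrite Cpow_mult_l. field. split; apply Cpow_nz; trivial. apply NtoC_S_nz.
  - now apply Csums_scal.
Qed.

Ltac Cnz := repeat split;
  repeat first [ assumption | apply Cmult_neq_0 | apply Cpow_nz | apply NtoC_S_nz ].

Definition tpi4 : C := (tpi * tpi * tpi * tpi)%C.

(** The factor 1440 / [tpi4] is 1/zeta(4): this is the usual normalization of the Eisenstein
    series. *)
Lemma E4_lattice (z s : C) : upper_half_plane z ->
  Csums (fun m => Phi 4 (NtoC (S m) * z)) s -> E4 z = (1 + 1440 / tpi4 * s)%C.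
Proof.
  intros Hz Hs. assert (Ht := tpi_nz).
  assert (A := sigma_qseries 3 z (le_n 3) Hz). apply (Csums_scal tpi4) in A.
  apply (Csums_scal 6) in Hs.
  assert (E : (tpi4 * qseries (sigmaR 3) z)%C = (6 * s)%C).
  { apply (Csums_unique _ _ _ A). revert Hs. apply Csums_ext. intros m.
    assert (Hm := NtoC_mult_H z m Hz).
    rewrite Phi4_nome by now apply H_nonint. unfold tpi4. now rewrite qseries_3_value. }
  rewrite E4_qseries. replace (1440 / tpi4 * s)%C with (240 * (6 * s) / tpi4)%C
    by (unfold tpi4; field; trivial).
  rewrite <- E. unfold tpi4. field. trivial.
Qed.

(** Only terms with m and n both nonzero are exchanged. The axis n = 0 contributes z^-4 to E4(z),
    and multiplication by z^4 exchanges this with the constant term 1. *)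
Theorem E4_modular (z : C) : upper_half_plane z -> E4 (Sz z) = (Cpow z 4 * E4 z)%C.
Proof.
  intros Hz. assert (Hz0 := H_nz z Hz). assert (HS := Sz_H z Hz). assert (HS0 := H_nz _ HS).
  destruct (pterm4_lattice_bound z Hz) as [K [HK Hb]].
  set (r := fun m => (Phi 4 (NtoC (S m) * z) - / Cpow (NtoC (S m) * z) 4)%C).
  set (c := fun n => (Phi 4 (NtoC (S n) * Sz z) - / Cpow (NtoC (S n) * Sz z) 4)%C).
  destruct (Csums_Fubini (fun m n => pterm 4 (NtoC (S m) * z) n) (fun m => K * invsq m) invsq r
    (fun n => / Cpow z 4 * c n)%C Hb) as [s [H1 H2]].
  - intros m. assert (A := invsq_pos m). nra.
  - intros n. assert (A := invsq_pos n). lra.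
  - apply ex_series_scal_R, ex_series_invsq.
  - apply ex_series_invsq.
  - intros m. apply (pterm_sums 3). now apply H_nonint, NtoC_mult_H.
  - intros n. apply (Csums_ext (fun m => / Cpow z 4 * pterm 4 (NtoC (S n) * Sz z) m)%C).
    + intros m. symmetry. now apply (pterm_swap 2).
    + apply Csums_scal. apply (pterm_sums 3). now apply H_nonint, NtoC_mult_H.
  - assert (Z4 := zeta4_value). fold tpi4 in Z4.
    assert (A1 : Csums (fun m => Phi 4 (NtoC (S m) * z)) (s + / Cpow z 4 * (tpi4 / 1440))).
    { apply (Csums_ext (fun m => r m + / Cpow (NtoC (S m) * z) 4)%C). intros m; unfold r; ring.
      apply Csums_plus. exact H1. now apply inv_multiples_sums. }
    assert (A2 : Csums (fun m => Phi 4 (NtoC (S m) * Sz z)) (Cpow z 4 * s + / Cpow (Sz z) 4 * (tpi4 / 1440))).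
    { apply (Csums_ext (fun m => Cpow z 4 * (/ Cpow z 4 * c m) + / Cpow (NtoC (S m) * Sz z) 4)%C).
      intros m; unfold c. field. Cnz.
      apply Csums_plus. now apply Csums_scal. now apply inv_multiples_sums. }
    rewrite (E4_lattice _ _ Hz A1), (E4_lattice _ _ HS A2).
    assert (Ht := tpi_nz). unfold Sz, tpi4. simpl Cpow. field. tauto.
Qed.

(** * Weight 2: conditional convergence and the quasimodular correction *)

Lemma E2_lattice (z s : C) : upper_half_plane z ->
  Csums (fun m => Phi 2 (NtoC (S m) * z)) s -> E2 z = (1 - 24 / (tpi * tpi) * s)%C.
Proof.
  intros Hz Hs. assert (Ht := tpi_nz).
  assert (A := sigma_qseries 1 z (le_S _ _ (le_S _ _ (le_n 1))) Hz). apply (Csums_scal (tpi * tpi)%C) in A.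
  assert (E : (tpi * tpi * qseries (sigmaR 1) z)%C = s).
  { apply (Csums_unique _ _ _ A). revert Hs. apply Csums_ext. intros m.
    assert (Hm := NtoC_mult_H z m Hz).
    rewrite Phi2_nome by now apply H_nonint. now rewrite qseries_1_value. }
  unfold E2. rewrite <- E. field. trivial.
Qed.

(* Telescoping approximation of pterm 2: its double sum is conditionally convergent in the
   same way, but both iterated sums are explicit. *)
Definition aterm (Z : C) (n : nat) : C :=
  ((/ (Z + (NtoC n + RtoC (/ 2))) - / (Z - (NtoC n + RtoC (/ 2))))
   - (/ (Z + (NtoC (S n) + RtoC (/ 2))) - / (Z - (NtoC (S n) + RtoC (/ 2)))))%C.

(** For real y > 0 this is the integral of 1/(Z+t)^2 over |t| > y, with Z = (m+1) z. Hence [aterm]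
    integrates over two unit intervals centred at +-(n+1), the midpoint approximation of
    [pterm 2]. *)
Definition tdiff (z y : C) (m : nat) : C :=
  (/ (NtoC (S m) * z + y) - / (NtoC (S m) * z - y))%C.

Lemma aterm_tdiff (z : C) (m n : nat) :
  aterm (NtoC (S m) * z) n = (tdiff z (NtoC n + RtoC (/ 2)) m - tdiff z (NtoC (S n) + RtoC (/ 2)) m)%C.
Proof. reflexivity. Qed.

Lemma H_plus_real_nz (z : C) (x : R) : upper_half_plane z -> (z + RtoC x)%C <> 0 /\ (z - RtoC x)%C <> 0.
Proof.
  intros Hz. unfold upper_half_plane in Hz.
  split; intros E; apply (f_equal Im) in E; revert E; unfold Cminus;
    [ rewrite im_plus | rewrite im_plus, im_opp ]; rewrite !im_RtoC; lra.
Qed.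

Definition Tsum (z y : C) : C := (- / z * (Phi 1 (y * Sz z) - / (y * Sz z)))%C.

Lemma real_mult_H (z : C) (y : R) : 0 < y -> upper_half_plane z -> upper_half_plane (RtoC y * z).
Proof. unfold upper_half_plane. intros Hy Hz. rewrite im_scal_l. nra. Qed.

(** With v = -y/z, mz + y = -z(v - m) and mz - y = z(v + m), so the sum over m is the cotangent
    series at v without its term 1/v. *)
Lemma tdiff_sums (z : C) (y : R) : 0 < y -> upper_half_plane z ->
  Csums (tdiff z (RtoC y)) (Tsum z (RtoC y)).
Proof.
  intros Hy Hz. assert (Hz0 := H_nz z Hz).
  assert (Hv := real_mult_H _ y Hy (Sz_H z Hz)).
  assert (A := pterm_sums 0 _ (H_nonint _ Hv)).
  apply (Csums_scal (- / z)) in A. unfold Tsum.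
  replace (/ (y * Sz z))%C with (/ Cpow (y * Sz z) 1)%C by (simpl; now rewrite Cmult_1_r).
  revert A. apply Csums_ext. intros m. unfold tdiff, pterm.
  destruct (H_nonint _ Hv (S m)) as [N1 N1'].
  destruct (H_plus_real_nz _ y (NtoC_mult_H z m Hz)) as [N2 N2'].
  replace (y * Sz z + NtoC (S m))%C with ((NtoC (S m) * z - y) / z)%C by (unfold Sz; field; trivial).
  replace (y * Sz z - NtoC (S m))%C with (- (NtoC (S m) * z + y) / z)%C by (unfold Sz; field; trivial).
  simpl Cpow. field. tauto.
Qed.

Lemma NtoC_half (n : nat) : (NtoC n + RtoC (/ 2))%C = RtoC (INR n + / 2).
Proof. unfold NtoC. now rewrite RtoC_plus. Qed.

Lemma INR_half_pos (n : nat) : 0 < INR n + / 2.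
Proof. generalize (pos_INR n). lra. Qed.

Lemma csum_telescope (u : nat -> C) (n : nat) : csum (fun k => u k - u (S k))%C n = (u O - u n)%C.
Proof. induction n as [|n IH]; cbn [csum]; [ ring | rewrite IH; ring ]. Qed.

Lemma Csums_telescope (u : nat -> C) (l : C) : Cconv u l -> Csums (fun k => u k - u (S k))%C (u O - l).
Proof.
  intros H. apply (Cconv_ext (fun n => u O + - (1) * u n)%C).
  - intros n. rewrite csum_telescope. ring.
  - replace (u O - l)%C with (u O + - (1) * l)%C by ring.
    apply Cconv_plus. apply Cconv_const. now apply Cconv_scal.
Qed.

Lemma aterm_sums (Z : C) : upper_half_plane Z ->
  Csums (aterm Z) (/ (Z + RtoC (/ 2)) - / (Z - RtoC (/ 2))).
Proof.
  intros HZ.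
  set (u := fun n => (/ (Z + (NtoC n + RtoC (/ 2))) - / (Z - (NtoC n + RtoC (/ 2))))%C).
  replace (/ (Z + RtoC (/ 2)) - / (Z - RtoC (/ 2)))%C with (u O - 0)%C
    by (unfold u; rewrite NtoC_0, Cplus_0_l; ring).
  apply (Csums_telescope u). unfold u.
  apply (Cconv_ext (fun n => / (Z + (NtoC n + RtoC (/ 2))) + - (1) * / (Z - (NtoC n + RtoC (/ 2))))%C).
  { intros n; ring. }
  replace (RtoC 0) with (0 + - (1) * 0)%C by ring.
  assert (Hn : forall n, INR (S n) <= Cmod (NtoC n + RtoC (/ 2)) + 1).
  { intros n. rewrite NtoC_half, Cmod_R, Rabs_pos_eq by (left; apply INR_half_pos). rewrite S_INR. lra. }
  apply Cconv_plus; [ | apply Cconv_scal ]; apply Cconv_inv_INR.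
  - intros n. rewrite NtoC_half. now apply H_plus_real_nz.
  - exists (Cmod Z + 1). intros n. specialize (Hn n).
    generalize (Cmod_triangle_sub (NtoC n + RtoC (/ 2)) (- Z)).
    replace (NtoC n + RtoC (/ 2) - - Z)%C with (Z + (NtoC n + RtoC (/ 2)))%C by ring.
    rewrite Cmod_opp. lra.
  - intros n. rewrite NtoC_half. now apply H_plus_real_nz.
  - exists (Cmod Z + 1). intros n. specialize (Hn n).
    generalize (Cmod_triangle_sub (NtoC n + RtoC (/ 2)) Z). rewrite Cmod_sub_sym. lra.
Qed.

(** 1/w^2 - (1/(w - 1/2) - 1/(w + 1/2)) = -1 / (4 w^2 (w^2 - 1/4)): the midpoint error has order 4,
    so [Cmod_inv4_le] applies, with the factors w bounded through m and the shifted ones through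
    n. *)
Lemma aterm_close (z : C) : upper_half_plane z -> exists K, 0 < K /\ forall m n,
  Cmod (pterm 2 (NtoC (S m) * z) n - aterm (NtoC (S m) * z) n) <= K * invsq m * invsq n.
Proof.
  intros Hz. destruct (lattice_lower_bound z Hz) as [c [Hc H]].
  (* The halves in c/2 come from n + 1 - 1/2 >= (n + 1)/2 at the shifted points. *)
  set (k := / (c * c) * / (c / 2 * (c / 2))).
  assert (HK : 0 < k) by (apply Rmult_lt_0_compat; apply Rinv_0_lt_compat; nra).
  exists k. split. exact HK. intros m n.
  assert (Hm := INR_S_pos m). assert (Hn := INR_S_ge1 n).
  set (Z := (NtoC (S m) * z)%C).
  assert (HZ : upper_half_plane Z) by now apply NtoC_mult_H.
  assert (B : forall y, c / 2 * INR (S n) <= c * Rabs y -> (Z + RtoC y)%C <> 0 /\ c * INR (S m) <= Cmod (Z + RtoC y)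
     /\ c / 2 * INR (S n) <= Cmod (Z + RtoC y)).
  { intros y Hy. split. now apply H_plus_real_nz. destruct (H (INR (S m)) y ltac:(lra)). split. exact H0. fold (NtoC (S m)) Z in H1. lra. }
  assert (G : forall y, c * INR (S n) <= c * Rabs y ->
     c / 2 * INR (S n) <= c * Rabs (y - / 2) -> c / 2 * INR (S n) <= c * Rabs (y + / 2) ->
     Cmod (/ Cpow (Z + RtoC y) 2 - (/ (Z + RtoC (y - / 2)) - / (Z + RtoC (y + / 2)))) <= / 4 * k * invsq m * invsq n).
  { intros y Y1 Y2 Y3.
    destruct (B y) as [N1 [P1 _]]. nra.
    destruct (B (y - / 2) Y2) as [N2 [P2 Q2]]. destruct (B (y + / 2) Y3) as [N3 [P3 Q3]].
    set (w := (Z + RtoC y)%C) in *.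
    replace (/ Cpow w 2 - (/ (Z + RtoC (y - / 2)) - / (Z + RtoC (y + / 2))))%C
      with (- RtoC (/ 4) * / (w * w * (Z + RtoC (y - / 2)) * (Z + RtoC (y + / 2))))%C.
    - rewrite Cmod_mult, Cmod_opp, Cmod_R, Rabs_pos_eq by lra.
      rewrite !(Rmult_assoc (/ 4)). apply Rmult_le_compat_l. lra.
      eapply Rle_trans. apply (Cmod_inv4_le _ _ _ _ (c * INR (S m)) (c / 2 * INR (S n))); trivial; nra.
      rewrite !invsq_scal by lra. unfold k. right; ring.
    - rewrite RtoC_minus, RtoC_plus in *.
      replace (Z + (y - RtoC (/ 2)))%C with (w - RtoC (/ 2))%C in * by (unfold w; ring).
      replace (Z + (y + RtoC (/ 2)))%C with (w + RtoC (/ 2))%C in * by (unfold w; ring).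
      assert (E : (w - RtoC (/ 2) - w)%C = (- RtoC (/ 2))%C) by ring.
      simpl Cpow. rewrite (RtoC_inv 4) by lra. rewrite (RtoC_inv 2) in * by lra.
      assert (M1 : (w * 2 - 1)%C <> 0).
      { intros E1. apply N2. replace (w - / 2)%C with ((w * 2 - 1) / 2)%C by field. rewrite E1. field. }
      assert (M2 : (w * 2 + 1)%C <> 0).
      { intros E1. apply N3. replace (w + / 2)%C with ((w * 2 + 1) / 2)%C by field. rewrite E1. field. }
      field. cbv beta; tauto. }
  assert (G1 := G (INR (S n))). assert (G2 := G (- INR (S n))).
  rewrite Rabs_Ropp in G2. rewrite (Rabs_pos_eq (INR (S n))) in G1, G2 by lra.
  assert (E1 : Rabs (INR (S n) - / 2) = INR (S n) - / 2) by (apply Rabs_pos_eq; lra).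
  assert (E2 : Rabs (INR (S n) + / 2) = INR (S n) + / 2) by (apply Rabs_pos_eq; lra).
  assert (E3 : Rabs (- INR (S n) - / 2) = INR (S n) + / 2) by (rewrite <- Rabs_Ropp, Rabs_pos_eq; lra).
  assert (E4 : Rabs (- INR (S n) + / 2) = INR (S n) - / 2) by (rewrite <- Rabs_Ropp, Rabs_pos_eq; lra).
  rewrite E1, E2 in G1. rewrite E3, E4 in G2.
  specialize (G1 ltac:(lra) ltac:(nra) ltac:(nra)). specialize (G2 ltac:(lra) ltac:(nra) ltac:(nra)).
  replace (pterm 2 Z n - aterm Z n)%C with
    ((/ Cpow (Z + RtoC (INR (S n))) 2 - (/ (Z + RtoC (INR (S n) - / 2)) - / (Z + RtoC (INR (S n) + / 2))))
    + (/ Cpow (Z + RtoC (- INR (S n))) 2 - (/ (Z + RtoC (- INR (S n) - / 2)) - / (Z + RtoC (- INR (S n) + / 2)))))%C.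
  - eapply Rle_trans. apply Cmod_triangle.
    assert (P : 0 < k * invsq m * invsq n) 
      by (apply Rmult_lt_0_compat; [ apply Rmult_lt_0_compat; [ exact HK | apply invsq_pos ] | apply invsq_pos ]). lra.
  - unfold pterm, aterm. rewrite !NtoC_half.
    replace (INR n + / 2) with (INR (S n) - / 2) by (rewrite S_INR; lra).
    replace (Z + RtoC (- INR (S n)))%C with (Z - NtoC (S n))%C by (unfold NtoC; rewrite RtoC_opp; ring).
    replace (Z + RtoC (- INR (S n) - / 2))%C with (Z - RtoC (INR (S n) + / 2))%C
      by (rewrite RtoC_minus, RtoC_opp, RtoC_plus; ring).
    replace (Z + RtoC (- INR (S n) + / 2))%C with (Z - RtoC (INR (S n) - / 2))%C
      by (rewrite RtoC_minus, RtoC_plus, RtoC_opp; ring).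
    fold (NtoC (S n)). ring.
Qed.

(** As y grows, -y/z goes up to the cusp, where pi cot tends to -pi i. The limit pi i / z is
    nonzero, and it is the whole failure of the exchange of sums in weight 2. *)
Lemma Tsum_lim (z : C) : upper_half_plane z ->
  Cconv (fun n => Tsum z (RtoC (INR n + / 2))) (tpi / (2 * z)).
Proof.
  intros Hz. assert (Hz0 := H_nz z Hz). assert (HS := Sz_H z Hz).
  set (v := fun n => (RtoC (INR n + / 2) * Sz z)%C).
  assert (Hv : forall n, upper_half_plane (v n)) by (intros n; apply real_mult_H; [ apply INR_half_pos | exact HS ]).
  assert (HI : forall n, Im (v n) = (INR n + / 2) * Im (Sz z)) by (intros n; unfold v; apply im_scal_l).
  assert (H0 : Cconv (fun n => / v n)%C 0).
  { apply (Cconv_ext (fun n => / Sz z * / (RtoC (INR n + / 2)))%C).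
    - intros n. unfold v. field. split. now apply H_nz.
      intros E. apply RtoC_inj in E. generalize (INR_half_pos n). lra.
    - replace (RtoC 0) with (/ Sz z * 0)%C by ring. apply Cconv_scal. apply Cconv_inv_INR.
      + intros n E. apply RtoC_inj in E. generalize (INR_half_pos n). lra.
      + exists 1. intros n. rewrite Cmod_R, Rabs_pos_eq by (left; apply INR_half_pos). rewrite S_INR. lra. }
  assert (Hq : Cconv (fun n => nome (v n)) 0).
  { unfold Cconv.
    set (s := exp (- (2 * PI * Im (Sz z)))).
    assert (Hs : 0 < s < 1) by now apply exp_Im_lt_1.
    apply (is_lim_seq_le_le (fun _ => 0) _ (fun n => s ^ n)).
    - intros n. split. apply Cmod_ge_0. replace (nome (v n) - 0)%C with (nome (v n)) by ring.
      eapply Rle_trans. apply (nome_le_Im _ (INR n * Im (Sz z))).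
      { rewrite HI. unfold upper_half_plane in HS. nra. }
      right. unfold s. clear. induction n as [|n IH].
      + simpl. rewrite <- exp_0. f_equal. ring.
      + rewrite <- tech_pow_Rmult, <- IH, <- exp_plus. f_equal. rewrite S_INR. ring.
    - apply is_lim_seq_const.
    - apply is_lim_seq_geom. rewrite Rabs_pos_eq; lra. }
  assert (HL : Cconv (fun n => L1 (v n)) (- (tpi / 2))).
  { set (F := fun q => (- (tpi / 2) * (1 + q) / (1 - q))%C).
    replace (- (tpi / 2))%C with (F 0) by (unfold F; field).
    assert (D : exists d, is_Cderive F 0 d).
    { eexists. apply (is_Cderive_div (fun q => - (tpi / 2) * (1 + q))%C (fun q => 1 - q)%C).
      replace (1 - 0)%C with (RtoC 1) by ring. apply C1_nz.
      apply is_Cderive_scal, is_Cderive_plus; [ apply is_Cderive_const | apply is_Cderive_id ].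
      apply is_Cderive_minus; [ apply is_Cderive_const | apply is_Cderive_id ]. }
    destruct D as [d D]. exact (Cconv_continuous F _ _ d D Hq). }
  apply (Cconv_ext (fun n => - / z * (L1 (v n) + - (1) * / v n))%C).
  - intros n. unfold Tsum. rewrite Phi1_nome by apply Hv. unfold v. ring.
  - replace (tpi / (2 * z))%C with (- / z * (- (tpi / 2) + - (1) * 0))%C by (field; trivial).
    apply Cconv_scal. apply Cconv_plus. exact HL. now apply Cconv_scal.
Qed.

(** Fubini applies to [pterm 2] minus [aterm]. The removed terms sum to T 0 by rows but to T 0 - lim
    T by columns; multiplied by z^2 and by -24/[tpi]^2, this gap becomes 12 z / [tpi]. *)
Theorem E2_quasimodular (z : C) : upper_half_plane z ->
  E2 (Sz z) = (Cpow z 2 * E2 z + 12 * z / tpi)%C.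
Proof.
  intros Hz. assert (Hz0 := H_nz z Hz). assert (HS := Sz_H z Hz). assert (HS0 := H_nz _ HS).
  destruct (aterm_close z Hz) as [K [HK Hb]].
  set (Z := fun m => (NtoC (S m) * z)%C) in *.
  assert (HZ : forall m, upper_half_plane (Z m)) by (intros m; now apply NtoC_mult_H).
  set (A := fun m => (/ (Z m + RtoC (/ 2)) - / (Z m - RtoC (/ 2)))%C).
  set (T := fun n => Tsum z (RtoC (INR n + / 2))).
  set (r := fun m => (Phi 2 (Z m) - / Cpow (Z m) 2 - A m)%C).
  set (c := fun n => (/ Cpow z 2 * (Phi 2 (NtoC (S n) * Sz z) - / Cpow (NtoC (S n) * Sz z) 2) - (T n - T (S n)))%C).
  destruct (Csums_Fubini _ (fun m => K * invsq m) invsq r c Hb) as [s [H1 H2]].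
  - intros m. assert (P := invsq_pos m). nra.
  - intros n. assert (P := invsq_pos n). lra.
  - apply ex_series_scal_R, ex_series_invsq.
  - apply ex_series_invsq.
  - intros m. apply Csums_minus. apply (pterm_sums 1). apply H_nonint, HZ. apply aterm_sums, HZ.
  - intros n. apply Csums_minus.
    + apply (Csums_ext (fun m => / Cpow z 2 * pterm 2 (NtoC (S n) * Sz z) m)%C).
      * intros m. symmetry. now apply (pterm_swap 1).
      * apply Csums_scal. apply (pterm_sums 1). now apply H_nonint, NtoC_mult_H.
    + apply (Csums_ext (fun m => tdiff z (RtoC (INR n + / 2)) m - tdiff z (RtoC (INR (S n) + / 2)) m)%C).
      * intros m. rewrite <- !NtoC_half. symmetry. apply aterm_tdiff.
      * apply Csums_minus; apply tdiff_sums; trivial; apply INR_half_pos.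
  - assert (HA : Csums A (T O)).
    { apply (Csums_ext (tdiff z (RtoC (INR 0 + / 2)))).
      - intros m. unfold tdiff, A, Z. replace (INR 0 + / 2) with (/ 2) by (simpl; ring). reflexivity.
      - apply tdiff_sums; trivial. apply INR_half_pos. }
    assert (HT := Csums_telescope T _ (Tsum_lim z Hz)).
    assert (A1 : Csums (fun m => Phi 2 (Z m)) (s + / Cpow z 2 * (- (tpi * tpi) / 24) + T O)).
    { apply (Csums_ext (fun m => r m + / Cpow (NtoC (S m) * z) 2 + A m)%C).
      - intros m; unfold r, Z; ring.
      - apply Csums_plus; [ apply Csums_plus; [ exact H1 | ] | exact HA ]. apply inv_multiples_sums; trivial. apply zeta2_value. }
    assert (A2 : Csums (fun m => Phi 2 (NtoC (S m) * Sz z))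
       (Cpow z 2 * (s + (T O - tpi / (2 * z))) + / Cpow (Sz z) 2 * (- (tpi * tpi) / 24))).
    { apply (Csums_ext (fun m => Cpow z 2 * (c m + (T m - T (S m))) + / Cpow (NtoC (S m) * Sz z) 2)%C).
      - intros m; unfold c. field. Cnz.
      - apply Csums_plus.
        + apply Csums_scal. now apply Csums_plus.
        + apply inv_multiples_sums; trivial. apply zeta2_value. }
    rewrite (E2_lattice _ _ Hz A1), (E2_lattice _ _ HS A2).
    assert (Ht := tpi_nz). unfold Sz. simpl Cpow. field. tauto.
Qed.

(** * Delta and j under inversion *)

Lemma is_Cderive_Sz (z : C) : z <> 0 -> is_Cderive Sz z (/ (z * z)).
Proof.
  intros Hz. eapply is_Cderive_eq. apply is_Cderive_opp. now apply is_Cderive_Cinv. ring.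
Qed.

(** The correction term of E2 is exactly the logarithmic derivative 12/z of z^12, so the quotient of
    the two sides is constant; it equals 1 at the fixed point i because i^12 = 1. *)
Theorem Delta_modular (z : C) : upper_half_plane z -> Defs.Delta (Sz z) = (Cpow z 12 * Defs.Delta z)%C.
Proof.
  intros Hz.
  set (g := fun w => (Defs.Delta (Sz w) / (Cpow w 12 * Defs.Delta w))%C).
  assert (Hg : forall w, upper_half_plane w -> is_Cderive g w 0).
  { intros w Hw. assert (Hw0 := H_nz w Hw). assert (HD := Delta_nz w Hw). assert (Ht := tpi_nz).
    eapply is_Cderive_eq.
    - apply is_Cderive_div. apply Cmult_neq_0; trivial. now apply Cpow_nz.
      + apply (is_Cderive_comp Defs.Delta Sz). apply Delta_derive. now apply Sz_H. now apply is_Cderive_Sz.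
      + apply is_Cderive_mult. apply (is_Cderive_pow (fun w => w)). apply is_Cderive_id. now apply Delta_derive.
    - cbv beta. rewrite E2_quasimodular by trivial.
      replace (INR 12) with 12 by (simpl; ring).
      rewrite (Cpow_S w 11). assert (Hw11 := Cpow_nz w 11 Hw0).
      set (p := Cpow w 11) in *. simpl Cpow. field. tauto. }
  assert (Hi : upper_half_plane Ci) by (unfold upper_half_plane; simpl; lra).
  assert (E : g z = 1).
  { rewrite (is_Cderive_zero_const _ g Cconvex_H Hg z Ci Hz Hi). unfold g.
    assert (ES : Sz Ci = Ci) by (unfold Sz; rewrite Ci_inv; ring).
    assert (EP : Cpow Ci 12 = 1) 
    by (change 12%nat with (2 * 6)%nat; rewrite Cpow_mult_r; replace (Cpow Ci 2) with (- (1))%C;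
      [ ring | apply C_ext; simpl; ring ]).
    rewrite ES, EP. field. now apply Delta_nz. }
  assert (Hz0 := H_nz z Hz). assert (HD := Delta_nz z Hz).
  transitivity (g z * (Cpow z 12 * Defs.Delta z))%C.
  - assert (Hp := Cpow_nz z 12 Hz0). unfold g. set (p := Cpow z 12) in *. field. tauto.
  - rewrite E. ring.
Qed.

Theorem j_inversion (z : C) : upper_half_plane z -> j (Sz z) = j z.
Proof.
  intros Hz. unfold j. rewrite E4_modular, Delta_modular by trivial.
  assert (Hz0 := H_nz z Hz). assert (HD := Delta_nz z Hz).
  rewrite Cpow_mult_l, <- Cpow_mult_r. change (4 * 3)%nat with 12%nat.
  assert (Hp := Cpow_nz z 12 Hz0). field. tauto.
Qed.

(** * Primitives and path integrals *)

Definition cont2 (f : C -> R -> C) (z0 : C) (s0 : R) : Prop :=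
  forall eps, 0 < eps -> exists del, 0 < del /\ forall w s,
    Cmod (w - z0) < del -> Rabs (s - s0) < del -> Cmod (f w s - f z0 s0) < eps.

Lemma cont2_const (c z0 : C) (s0 : R) : cont2 (fun _ _ => c) z0 s0.
Proof.
  intros e He. exists 1. split. lra. intros. unfold Cminus. now rewrite Cplus_opp_r, Cmod_0.
Qed.

Lemma cont2_fst (z0 : C) (s0 : R) : cont2 (fun w _ => w) z0 s0.
Proof. intros e He. exists e. split; trivial. Qed.

Lemma cont2_snd (z0 : C) (s0 : R) : cont2 (fun _ s => RtoC s) z0 s0.
Proof. intros e He. exists e. split; trivial. intros w s _ H. now rewrite <- RtoC_minus, Cmod_R. Qed.

Lemma cont2_plus (f g : C -> R -> C) (z0 : C) (s0 : R) :
  cont2 f z0 s0 -> cont2 g z0 s0 -> cont2 (fun w s => f w s + g w s)%C z0 s0.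
Proof.
  intros Hf Hg e He. destruct (Hf (e / 2) ltac:(lra)) as [d1 [D1 H1]]. destruct (Hg (e / 2) ltac:(lra)) as [d2 [D2 H2]].
  exists (Rmin d1 d2). split. now apply Rmin_pos. intros w s Hw Hs.
  specialize (H1 w s (Rlt_le_trans _ _ _ Hw (Rmin_l _ _)) (Rlt_le_trans _ _ _ Hs (Rmin_l _ _))).
  specialize (H2 w s (Rlt_le_trans _ _ _ Hw (Rmin_r _ _)) (Rlt_le_trans _ _ _ Hs (Rmin_r _ _))).
  replace (f w s + g w s - (f z0 s0 + g z0 s0))%C with ((f w s - f z0 s0) + (g w s - g z0 s0))%C by ring.
  eapply Rle_lt_trans. apply Cmod_triangle. lra.
Qed.

Lemma cont2_mult (f g : C -> R -> C) (z0 : C) (s0 : R) :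
  cont2 f z0 s0 -> cont2 g z0 s0 -> cont2 (fun w s => f w s * g w s)%C z0 s0.
Proof.
  intros Hf Hg e He. set (a := Cmod (f z0 s0)). set (b := Cmod (g z0 s0)).
  assert (Ha : 0 <= a) by apply Cmod_ge_0. assert (Hb : 0 <= b) by apply Cmod_ge_0.
  set (e1 := e / (2 * (b + 1))). set (e2 := Rmin 1 (e / (2 * (a + 1)))).
  assert (He1 : 0 < e1) by (apply Rdiv_lt_0_compat; lra).
  assert (He2 : 0 < e2) by (apply Rmin_pos; [ lra | apply Rdiv_lt_0_compat; lra ]).
  destruct (Hf e1 He1) as [d1 [D1 H1]]. destruct (Hg e2 He2) as [d2 [D2 H2]].
  exists (Rmin d1 d2). split. now apply Rmin_pos. intros w s Hw Hs.
  specialize (H1 w s (Rlt_le_trans _ _ _ Hw (Rmin_l _ _)) (Rlt_le_trans _ _ _ Hs (Rmin_l _ _))).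
  specialize (H2 w s (Rlt_le_trans _ _ _ Hw (Rmin_r _ _)) (Rlt_le_trans _ _ _ Hs (Rmin_r _ _))).
  assert (L1 := Rmin_l 1 (e / (2 * (a + 1)))). assert (L2 := Rmin_r 1 (e / (2 * (a + 1)))). fold e2 in L1, L2.
  replace (f w s * g w s - f z0 s0 * g z0 s0)%C
    with ((f w s - f z0 s0) * ((g w s - g z0 s0) + g z0 s0) + f z0 s0 * (g w s - g z0 s0))%C by ring.
  eapply Rle_lt_trans. apply Cmod_triangle. rewrite !Cmod_mult.
  assert (T := Cmod_triangle (g w s - g z0 s0) (g z0 s0)). fold a. fold b in T.
  set (X := Cmod (f w s - f z0 s0)) in *. set (Y := Cmod (g w s - g z0 s0)) in *.
  set (U := Cmod (g w s - g z0 s0 + g z0 s0)) in *.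
  assert (HX : 0 <= X) by apply Cmod_ge_0. assert (HY : 0 <= Y) by apply Cmod_ge_0.
  assert (A1 : X * U <= X * (b + 1)) by (apply Rmult_le_compat_l; lra).
  assert (A2 : X * (b + 1) < e1 * (b + 1)) by (apply Rmult_lt_compat_r; lra).
  assert (A3 : e1 * (b + 1) = e / 2) by (unfold e1; field; lra).
  assert (A4 : a * Y <= (a + 1) * (e / (2 * (a + 1)))) by (apply Rmult_le_compat; lra).
  assert (A5 : (a + 1) * (e / (2 * (a + 1))) = e / 2) by (field; lra). lra.
Qed.

Lemma cont2_comp (h : C -> C) (f : C -> R -> C) (z0 d : C) (s0 : R) :
  is_Cderive h (f z0 s0) d -> cont2 f z0 s0 -> cont2 (fun w s => h (f w s)) z0 s0.
Proof.
  intros Hh Hf e He. destruct (is_Cderive_continuous _ _ _ Hh (mkposreal e He)) as [d1 H1].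
  destruct (Hf d1 (cond_pos d1)) as [d2 [D2 H2]]. exists d2. split. exact D2.
  intros w s Hw Hs. apply H1. now apply H2.
Qed.

(** Tube lemma: joint continuity at each point of [0,1] chooses a gauge, and compactness of the
    interval turns it into one radius. *)
Lemma cont2_uniform (f : C -> R -> C) (z0 : C) : (forall s, 0 <= s <= 1 -> cont2 f z0 s) ->
  forall eps, 0 < eps -> exists del, 0 < del /\ forall w s, 0 <= s <= 1 ->
    Cmod (w - z0) < del -> Cmod (f w s - f z0 s) <= eps.
Proof.
  intros Hf e He.
  assert (H : forall t, exists d : posreal, 0 <= t <= 1 -> forall w s,
    Cmod (w - z0) < d -> Rabs (s - t) < d -> Cmod (f w s - f z0 t) < e / 2).
  { intros t. destruct (Rle_dec 0 t) as [A1 | A1]; [ destruct (Rle_dec t 1) as [A2 | A2] | ].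
    - destruct (Hf t (conj A1 A2) (e / 2) ltac:(lra)) as [d [D Hd]]. exists (mkposreal d D). intros _. exact Hd.
    - exists (mkposreal 1 Rlt_0_1). intros [_ A]. contradiction.
    - exists (mkposreal 1 Rlt_0_1). intros [A _]. contradiction. }
  destruct (functional_choice _ H) as [delta Hdelta].
  destruct (compactness_value_1d 0 1 delta) as [d Hd].
  exists d. split. apply cond_pos. intros w s Hs Hw.
  (* Compactness yields its centre t under a double negation, so the inequality is proved by
     contradiction. *)
  apply Rnot_lt_le. intros Hlt. apply (Hd s Hs). intros [t [Ht [Hst Hdt]]].
  assert (B1 := Hdelta t Ht w s (Rlt_le_trans _ _ _ Hw Hdt) Hst).
  assert (B2 := Hdelta t Ht z0 s). 
  assert (B3 : Cmod (z0 - z0) < delta t) by (unfold Cminus; rewrite Cplus_opp_r, Cmod_0; apply cond_pos).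
  specialize (B2 B3 Hst).
  replace (f w s - f z0 s)%C with ((f w s - f z0 t) - (f z0 s - f z0 t))%C in Hlt by ring.
  assert (B4 := Cmod_minus_le (f w s - f z0 t) (f z0 s - f z0 t)). lra.
Qed.

Lemma continuous_C_eps (f : R -> C) (s : R) :
  (forall eps, 0 < eps -> exists del, 0 < del /\ forall t, Rabs (t - s) < del -> Cmod (f t - f s) < eps) ->
  continuous (T := R_UniformSpace) (U := C_UniformSpace) f s.
Proof.
  intros H P [eps HP]. destruct (H eps (cond_pos eps)) as [del [D Hd]].
  exists (mkposreal del D). intros t Ht. apply HP.
  apply C_NormedModule_mixin_compat1. apply Hd. exact Ht.
Qed.

Lemma continuous_C_eps_inv (f : R -> C) (s : R) :
  continuous (T := R_UniformSpace) (U := C_UniformSpace) f s ->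
  forall eps, 0 < eps -> exists del, 0 < del /\ forall t, Rabs (t - s) < del -> Cmod (f t - f s) < eps.
Proof.
  intros H e He.
  assert (H2 : 0 < e / sqrt 2) by (apply Rdiv_lt_0_compat; [ exact He | apply sqrt_lt_R0; lra ]).
  destruct (H (ball (M := C_UniformSpace) (f s) (e / sqrt 2))) as [d Hd].
  { exists (mkposreal _ H2). intros y Hy. exact Hy. }
  exists d. split. apply cond_pos. intros t Ht.
  assert (A := C_NormedModule_mixin_compat2 (f s) (f t) (mkposreal _ H2) (Hd t Ht)). simpl in A.
  replace (sqrt 2 * (e / sqrt 2)) with e in A. exact A.
  field. apply Rgt_not_eq, sqrt_lt_R0. lra.
Qed.

Lemma cont2_continuous (f : C -> R -> C) (z : C) (s : R) : cont2 f z s ->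
  continuous (T := R_UniformSpace) (U := C_UniformSpace) (f z) s.
Proof.
  intros H. apply continuous_C_eps. intros e He. destruct (H e He) as [d [D Hd]].
  exists d. split. exact D. intros t Ht. apply Hd; trivial.
  unfold Cminus. now rewrite Cplus_opp_r, Cmod_0.
Qed.

Notation is_CRInt := (is_RInt (V := C_R_CompleteNormedModule)).

Lemma is_derive_RtoC_mult (g : R -> C) (s : R) (l : C) :
  is_derive (K := R_AbsRing) (V := C_R_NormedModule) g s l ->
  is_derive (K := R_AbsRing) (V := C_R_NormedModule) (fun t => RtoC t * g t)%C s (g s + RtoC s * l)%C.
Proof.
  intros Hg. apply is_derive_C_eps. intros eps. assert (He := cond_pos eps).
  assert (Hc := is_derive_C_continuous g s l Hg).
  rewrite is_derive_C_eps in Hg.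
  set (e1 := eps / (2 * (1 + Rabs s))).
  assert (Hs := Rabs_pos s).
  assert (He1 : 0 < e1) by (apply Rdiv_lt_0_compat; lra).
  destruct (Hg (mkposreal _ He1)) as [d1 H1]. destruct (Hc (pos_div_2 eps)) as [d2 H2]. simpl in H1, H2.
  assert (Hd : 0 < Rmin d1 d2) by (apply Rmin_pos; apply cond_pos).
  exists (mkposreal _ Hd). intros t Ht; simpl in Ht.
  specialize (H1 t (Rlt_le_trans _ _ _ Ht (Rmin_l _ _))). specialize (H2 t (Rlt_le_trans _ _ _ Ht (Rmin_r _ _))).
  replace (t * g t - s * g s - (t - s)%R * (g s + s * l))%C
    with (RtoC s * (g t - g s - (t - s)%R * l) + (t - s)%R * (g t - g s))%C by (rewrite RtoC_minus; ring).
  eapply Rle_trans. apply Cmod_triangle. rewrite !Cmod_mult, !Cmod_R.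
  set (T := Rabs (t - s)) in *. assert (HT : 0 <= T) by apply Rabs_pos.
  assert (A1 : Rabs s * Cmod (g t - g s - (t - s)%R * l) <= (1 + Rabs s) * (e1 * T)).
  { apply Rmult_le_compat; try lra. apply Cmod_ge_0. }
  replace ((1 + Rabs s) * (e1 * T)) with (eps / 2 * T) in A1 by (unfold e1; field; lra).
  assert (A2 : T * Cmod (g t - g s) <= T * (eps / 2)) by (apply Rmult_le_compat_l; lra). lra.
Qed.

(* Integrating along the segments issued from i: differentiation under the integral sign
   gives d/dz (h(i + s (z - i)) (z - i)) = d/ds (s h(i + s (z - i))). *)
Theorem primitive_on_H (h h' : C -> C) :
  (forall z, upper_half_plane z -> is_Cderive h z (h' z)) ->
  (forall z, upper_half_plane z -> exists d, is_Cderive h' z d) ->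
  exists F, forall z, upper_half_plane z -> is_Cderive F z (h z).
Proof.
  intros Hh Hh'.
  assert (Hi : upper_half_plane Ci) by (unfold upper_half_plane; simpl; lra).
  set (ga := fun (z : C) (s : R) => (Ci + RtoC s * (z - Ci))%C).
  assert (Hga : forall z s, upper_half_plane z -> 0 <= s <= 1 -> upper_half_plane (ga z s)).
  { intros z s Hz Hs. now apply Cconvex_H. }
  assert (Cga : forall z s, cont2 ga z s).
  { intros z s. apply cont2_plus. apply cont2_const. apply cont2_mult. apply cont2_snd.
    apply (cont2_plus (fun w _ => w) (fun _ _ => - Ci)%C). apply cont2_fst. apply cont2_const. }
  set (k := fun (z : C) (s : R) => (h (ga z s) * (z - Ci))%C).
  set (K := fun (z : C) (s : R) => (h (ga z s) + RtoC s * (h' (ga z s) * (z - Ci)))%C).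
  assert (Ch : forall z s, upper_half_plane z -> 0 <= s <= 1 -> cont2 (fun w t => h (ga w t)) z s).
  { intros z s Hz Hs. apply (cont2_comp h ga z (h' (ga z s))). now apply Hh, Hga. apply Cga. }
  assert (Ch' : forall z s, upper_half_plane z -> 0 <= s <= 1 -> cont2 (fun w t => h' (ga w t)) z s).
  { intros z s Hz Hs. destruct (Hh' (ga z s)) as [d Hd]. now apply Hga. apply (cont2_comp h' ga z d); trivial. }
  assert (Cid : forall z s, cont2 (fun w _ => w - Ci)%C z s).
  { intros z s. apply (cont2_plus (fun w _ => w) (fun _ _ => - Ci)%C). apply cont2_fst. apply cont2_const. }
  assert (Ck : forall z s, upper_half_plane z -> 0 <= s <= 1 -> cont2 k z s).
  { intros z s Hz Hs. apply (cont2_mult (fun w t => h (ga w t)) (fun w _ => w - Ci)%C). now apply Ch. apply Cid. }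
  assert (CK : forall z s, upper_half_plane z -> 0 <= s <= 1 -> cont2 K z s).
  { intros z s Hz Hs. apply (cont2_plus (fun w t => h (ga w t))). now apply Ch.
    apply (cont2_mult (fun _ t => RtoC t)). apply cont2_snd.
    apply (cont2_mult (fun w t => h' (ga w t)) (fun w _ => w - Ci)%C). now apply Ch'. apply Cid. }
  set (F := fun z => RInt (V := C_R_CompleteNormedModule) (k z) 0 1).
  assert (HF : forall z, upper_half_plane z -> is_CRInt (k z) 0 1 (F z)).
  { intros z Hz. apply (RInt_correct (V := C_R_CompleteNormedModule)).
    apply (ex_RInt_continuous (V := C_R_CompleteNormedModule)).
    intros s. rewrite Rmin_left, Rmax_right by lra. intros Hs.
    apply (cont2_continuous k). now apply Ck. }
  assert (HK : forall z, upper_half_plane z -> is_CRInt (K z) 0 1 (h z)).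
  { intros z Hz.
    assert (A : is_CRInt (K z) 0 1 (minus (G := C_R_CompleteNormedModule) ((fun s => RtoC s * h (ga z s))%C 1) ((fun s => RtoC s * h (ga z s))%C 0))).
    { apply (is_RInt_derive (V := C_R_CompleteNormedModule) (fun s => RtoC s * h (ga z s))%C (K z));
        intros s; rewrite Rmin_left, Rmax_right by lra; intros Hs.
      - apply is_derive_RtoC_mult. apply is_derive_C_comp. now apply Hh, Hga. apply is_derive_segment.
      - apply (cont2_continuous K). now apply CK. }
    replace (h z) with (minus (G := C_R_CompleteNormedModule) ((fun s => RtoC s * h (ga z s))%C 1) ((fun s => RtoC s * h (ga z s))%C 0)).
    exact A. cbv beta. unfold ga.
    replace (Ci + 1 * (z - Ci))%C with z by ring.
    change ((1 * h z + - (0 * h (Ci + 0 * (z - Ci))))%C = h z). ring. }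
  exists F. intros z0 Hz0. apply is_Cderive_eps. intros eps.
  destruct (cont2_uniform K z0 (fun s Hs => CK z0 s Hz0 Hs) eps (cond_pos eps)) as [del [D Hd]].
  assert (Hp : 0 < Rmin del (Im z0)) by (apply Rmin_pos; trivial).
  exists (mkposreal _ Hp). intros z Hz; simpl in Hz.
  assert (Hz1 := Rlt_le_trans _ _ _ Hz (Rmin_l _ _)). assert (Hz2 := Rlt_le_trans _ _ _ Hz (Rmin_r _ _)).
  assert (HzH := H_open z0 Hz0 z Hz2).
  set (r := fun s => (k z s - k z0 s - (z - z0) * K z0 s)%C).
  assert (Hr : forall s, 0 <= s <= 1 -> Cmod (r s) <= eps * Cmod (z - z0)).
  { intros s Hs. unfold r.
    replace (k z s - k z0 s - (z - z0) * K z0 s)%C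
      with ((k z s - K z0 s * z) - (k z0 s - K z0 s * z0))%C by ring.
    (* The derivative [K w s - K z0 s] is at most eps uniformly in s, which makes the remainder
       uniform before it is integrated. *)
    apply (mean_value_segment (fun w => k w s - K z0 s * w)%C (fun w => K w s - K z0 s)%C).
    intros t Ht. set (w := (z0 + t * (z - z0))%C).
    assert (Hw : Cmod (w - z0) <= Cmod (z - z0)).
    { unfold w. replace (z0 + t * (z - z0) - z0)%C with (RtoC t * (z - z0))%C by ring. now apply Cmod_scal_le. }
    assert (HwH : upper_half_plane w) by (apply (H_open z0 Hz0); lra).
    split.
    - eapply is_Cderive_eq.
      + apply is_Cderive_minus.
        * apply is_Cderive_mult.
          -- apply (is_Cderive_comp h (fun w => ga w s)). now apply Hh, Hga.
             apply is_Cderive_plus. apply is_Cderive_const. apply is_Cderive_scal.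
             apply is_Cderive_minus. apply is_Cderive_id. apply is_Cderive_const.
          -- apply is_Cderive_minus. apply is_Cderive_id. apply is_Cderive_const.
        * apply is_Cderive_scal, is_Cderive_id.
      + unfold K. cbv beta. ring.
    - apply Hd; trivial. lra. }
  assert (Hint : is_CRInt r 0 1 (F z - F z0 - h z0 * (z - z0))%C).
  { unfold r. replace (F z - F z0 - h z0 * (z - z0))%C with (F z - F z0 - (z - z0) * h z0)%C by ring.
    (* A complex factor is not a scalar of the real module in which the integral lives, so the
       product is integrated by components. *)
    assert (HS : is_CRInt (fun s => (z - z0) * K z0 s)%C 0 1 ((z - z0) * h z0)%C).
    { assert (HKz := HK z0 Hz0).
      assert (R1 := is_RInt_fct_extend_fst (U := R_NormedModule) (V := R_NormedModule) _ _ _ _ HKz).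
      assert (R2 := is_RInt_fct_extend_snd (U := R_NormedModule) (V := R_NormedModule) _ _ _ _ HKz).
      apply (is_RInt_fct_extend_pair (U := R_NormedModule) (V := R_NormedModule)
         (fun s => (z - z0) * K z0 s)%C 0 1 (fst ((z - z0) * h z0)%C) (snd ((z - z0) * h z0)%C)).
      - exact (is_RInt_minus _ _ _ _ _ _ (is_RInt_scal _ _ _ (fst (z - z0)%C) _ R1) (is_RInt_scal _ _ _ (snd (z - z0)%C) _ R2)).
      - exact (is_RInt_plus _ _ _ _ _ _ (is_RInt_scal _ _ _ (fst (z - z0)%C) _ R2) (is_RInt_scal _ _ _ (snd (z - z0)%C) _ R1)). }
    exact (is_RInt_minus (V := C_R_CompleteNormedModule) _ _ _ _ _ _
       (is_RInt_minus (V := C_R_CompleteNormedModule) _ _ _ _ _ _ (HF z HzH) (HF z0 Hz0)) HS). }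
  rewrite <- (Rmult_1_l (eps * _)). replace 1 with (1 - 0) by ring.
  rewrite (Cmod_norm (F z - F z0 - h z0 * (z - z0))).
  apply (norm_RInt_le_const (V := C_R_CompleteNormedModule) r 0 1); [ lra | | exact Hint ].
  intros s Hs. simpl norm. rewrite <- Cmod_norm. now apply Hr.
Qed.

(** The fundamental theorem along a path; the differentiability of h supplies the continuity of the
    integrand. *)
Lemma is_path_integral_primitive (h F : C -> C) (h' : C -> C) (z0 z1 : C) (g dg : R -> C) :
  (forall z, upper_half_plane z -> is_Cderive F z (h z)) ->
  (forall z, upper_half_plane z -> is_Cderive h z (h' z)) ->
  C1_path_in_H z0 z1 g dg -> is_path_integral h g dg (F z1 - F z0).
Proof.
  intros HF Hh [H0 [H1 Hg]]. unfold is_path_integral. rewrite <- H0, <- H1.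
  apply (is_RInt_derive (V := C_R_CompleteNormedModule) (fun s => F (g s)));
    intros s; rewrite Rmin_left, Rmax_right by lra; intros Hs; destruct (Hg s Hs) as [A1 [A2 A3]].
  - apply is_derive_C_comp; auto.
  - assert (B1 := is_derive_C_continuous _ _ _ (is_derive_C_comp h g s _ _ (Hh _ A1) A2)).
    assert (B2 := continuous_C_eps_inv _ _ A3).
    apply (cont2_continuous (fun _ s => h (g s) * dg s)%C 0).
    apply (cont2_mult (fun _ s => h (g s)) (fun _ s => dg s)); intros e He.
    + destruct (B1 (mkposreal e He)) as [d Hd]. exists d. split. apply cond_pos. intros w t _ Ht. now apply Hd.
    + destruct (B2 e He) as [d [D Hd]]. exists d. split. exact D. intros w t _ Ht. now apply Hd.
Qed.

Lemma is_path_integral_unique (f : C -> C) (g dg : R -> C) (u v : C) :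
  is_path_integral f g dg u -> is_path_integral f g dg v -> u = v.
Proof.
  intros Hu Hv.
  rewrite <- (is_RInt_unique (V := C_R_CompleteNormedModule) _ _ _ _ Hu).
  apply (is_RInt_unique (V := C_R_CompleteNormedModule) _ _ _ _ Hv).
Qed.

Lemma segment_path (a b : C) : upper_half_plane a -> upper_half_plane b ->
  C1_path_in_H a b (fun t => a + RtoC t * (b - a))%C (fun _ => (b - a)%C).
Proof.
  intros Ha Hb. split; [ ring | split; [ ring | ] ]. intros s Hs. split; [ | split ].
  - now apply Cconvex_H.
  - apply is_derive_segment.
  - apply continuous_C_eps. intros e He. exists 1. split. lra. intros t _.
    unfold Cminus at 1. rewrite Cplus_opp_r, Cmod_0. exact He.
Qed.

(** * Analytic properties of j *)

(** Explicit derivatives are recorded because [primitive_on_H] wants h' as a function that is again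
    differentiable. *)
Definition dE4 (z : C) : C := (240 * (tpi * qseries (fun n => (INR n * sigmaR 3 n)%R) z))%C.

Lemma E4_derive (z : C) : upper_half_plane z -> is_Cderive E4 z (dE4 z).
Proof.
  intros Hz. apply (is_Cderive_ext (fun z => 1 + 240 * qseries (sigmaR 3) z)%C). reflexivity.
  eapply is_Cderive_eq. apply is_Cderive_plus. apply is_Cderive_const.
  apply is_Cderive_scal. apply qseries_derive; trivial. apply sigmaR_poly_bounded; lia.
  unfold dE4. ring.
Qed.

Lemma dE4_derive (z : C) : upper_half_plane z -> exists d, is_Cderive dE4 z d.
Proof.
  intros Hz. eexists. apply is_Cderive_scal, is_Cderive_scal. apply qseries_derive; trivial.
  apply poly_bounded_scal_n. apply sigmaR_poly_bounded; lia.
Qed.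

Lemma E2_derive (z : C) : upper_half_plane z -> exists d, is_Cderive E2 z d.
Proof.
  intros Hz. eexists. apply is_Cderive_minus. apply is_Cderive_const.
  apply is_Cderive_scal. apply qseries_derive; trivial. apply sigmaR_poly_bounded; lia.
Qed.

Definition dj (z : C) : C :=
  ((3 * Cpow (E4 z) 2 * dE4 z - Cpow (E4 z) 3 * (tpi * E2 z)) / Defs.Delta z)%C.

Lemma j_derive (z : C) : upper_half_plane z -> is_Cderive j z (dj z).
Proof.
  intros Hz. assert (HD := Delta_nz z Hz). eapply is_Cderive_eq.
  - apply (is_Cderive_div (fun z => Cpow (E4 z) 3) Defs.Delta). exact HD.
    apply is_Cderive_pow. now apply E4_derive. now apply Delta_derive.
  - cbv beta. unfold dj. replace (INR 3) with 3 by (simpl; ring). field. exact HD.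
Qed.

Lemma dj_derive (z : C) : upper_half_plane z -> exists d, is_Cderive dj z d.
Proof.
  intros Hz. assert (HD := Delta_nz z Hz).
  destruct (dE4_derive z Hz) as [d1 H1]. destruct (E2_derive z Hz) as [d2 H2].
  assert (H4 := E4_derive z Hz). eexists.
  apply (is_Cderive_div (fun z => 3 * Cpow (E4 z) 2 * dE4 z - Cpow (E4 z) 3 * (tpi * E2 z))%C Defs.Delta).
  exact HD.
  - apply is_Cderive_minus; apply is_Cderive_mult.
    + apply is_Cderive_scal. apply is_Cderive_pow. exact H4.
    + exact H1.
    + apply is_Cderive_pow. exact H4.
    + apply is_Cderive_scal. exact H2.
  - now apply Delta_derive.
Qed.

(** * Symmetries of j and its expansion at the cusp *)

Lemma H_incr (z : C) (x : R) : upper_half_plane z -> upper_half_plane (z + RtoC x).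
Proof. unfold upper_half_plane. rewrite im_plus, im_RtoC. lra. Qed.

Lemma j_periodic (z : C) : j (z + 1) = j z.
Proof.
  assert (E : E4 (z + 1) = E4 z) by (rewrite !E4_qseries; now rewrite qseries_periodic).
  assert (D : Defs.Delta (z + 1) = Defs.Delta z) by (unfold Defs.Delta; now rewrite nome_periodic).
  unfold j. now rewrite E, D.
Qed.

Lemma j_periodic_n (z : C) (n : nat) : j (z + NtoC n) = j z.
Proof.
  induction n as [|n IH]. now rewrite NtoC_0, Cplus_0_r.
  now rewrite NtoC_S, Cplus_assoc, j_periodic.
Qed.

Lemma j_conj (z : C) : upper_half_plane z -> j (- Cconj z) = Cconj (j z).
Proof.
  intros Hz. assert (Hr := reflect_H z Hz). unfold j.
  rewrite Cdiv_conj by now apply Delta_nz. rewrite Cpow_conj. f_equal.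
  - f_equal. rewrite !E4_qseries, qseries_conj by (trivial; apply sigmaR_poly_bounded; lia).
    now rewrite Cplus_conj, Cmult_conj, !RtoC_conj.
  - rewrite !Delta_exp by trivial. rewrite <- C_exp_conj, Cminus_conj, !Cmult_conj, RtoC_conj.
    rewrite qseries_conj by (trivial; apply logcoef_poly_bounded).
    f_equal. replace (Cconj tpi) with (- tpi)%C. ring.
    unfold tpi, Cconj, Copp. simpl. f_equal. ring.
Qed.

(** f = 1 + alpha q + o(q) at the cusp, uniformly in Re z. Under products the alphas add, which is
    enough to find the constant term of j. *)
Definition first_order (f : C -> C) (alpha : C) : Prop :=
  forall eps, 0 < eps -> exists Y, 1 <= Y /\ forall z, Y <= Im z ->
    Cmod (f z - 1 - alpha * nome z) <= eps * Cmod (nome z).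

Lemma nome_small (eps : R) : 0 < eps -> exists Y, 1 <= Y /\ forall z, Y <= Im z ->
  Cmod (nome z) <= eps.
Proof.
  intros He. exists (Rmax 1 (/ eps)). split. apply Rmax_l. intros z Hz.
  eapply Rle_trans. apply (nome_le_Im z _ Hz).
  set (Y := Rmax 1 (/ eps)). assert (H1 : 1 <= Y) by apply Rmax_l. assert (H2 : / eps <= Y) by apply Rmax_r.
  rewrite exp_Ropp. rewrite <- (Rinv_inv eps). apply Rinv_le_contravar. now apply Rinv_0_lt_compat.
  assert (H3 := exp_ineq1_le (2 * PI * Y)). assert (H4 := PI2_1).
  assert (Y <= PI * Y) by nra. lra.
Qed.

Lemma first_order_qseries (a : nat -> R) (c : R) : poly_bounded a ->
  first_order (fun z => 1 + RtoC c * qseries a z)%C (RtoC c * RtoC (a 1%nat)).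
Proof.
  intros Ha eps He. destruct (qseries_first_order a Ha) as [K [HK H]].
  assert (Hc := Rabs_pos c).
  assert (He1 : 0 < eps / (K * (Rabs c + 1))) by (apply Rdiv_lt_0_compat; nra).
  destruct (nome_small _ He1) as [Y [HY HYs]]. exists Y. split. exact HY.
  intros z Hz. specialize (HYs z Hz). specialize (H z ltac:(lra)).
  replace (1 + c * qseries a z - 1 - c * a 1%nat * nome z)%C
    with (RtoC c * (qseries a z - a 1%nat * nome z))%C by ring.
  rewrite Cmod_mult, Cmod_R. set (x := Cmod (nome z)) in *. assert (Hx : 0 <= x) by apply Cmod_ge_0.
  apply Rle_trans with ((Rabs c + 1) * (K * (x * x))).
  { apply Rmult_le_compat; trivial. apply Cmod_ge_0. lra. }
  replace ((Rabs c + 1) * (K * (x * x))) with ((K * (Rabs c + 1) * x) * x) by ring.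
  apply Rmult_le_compat_r. exact Hx.
  apply Rle_trans with (K * (Rabs c + 1) * (eps / (K * (Rabs c + 1)))).
  apply Rmult_le_compat_l. nra. exact HYs. right. field. lra.
Qed.

Lemma first_order_mult (f g : C -> C) (a b : C) :
  first_order f a -> first_order g b -> first_order (fun z => f z * g z)%C (a + b).
Proof.
  intros Hf Hg eps He.
  set (A := Cmod a). set (B := Cmod b). assert (HA : 0 <= A) by apply Cmod_ge_0. assert (HB : 0 <= B) by apply Cmod_ge_0.
  (* Three errors get eps/3 each: those of f and of g times a bounded factor, and the product term
     ab q^2, which is small because q is. *)
  set (e := Rmin 1 (eps / (3 * (2 + A + B)))).
  assert (He0 : 0 < e) by (apply Rmin_pos; [ lra | apply Rdiv_lt_0_compat; lra ]).
  assert (e1 : e <= 1) by apply Rmin_l.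
  assert (e2 : e * (2 + A + B) <= eps / 3).
  { apply Rle_trans with (eps / (3 * (2 + A + B)) * (2 + A + B)).
    apply Rmult_le_compat_r. lra. apply Rmin_r. right; field. lra. }
  destruct (Hf e He0) as [Y1 [H1 F1]]. destruct (Hg e He0) as [Y2 [H2 F2]].
  assert (He3 : 0 < Rmin 1 (eps / (3 * (A * B + 1)))) by (apply Rmin_pos; [ lra | apply Rdiv_lt_0_compat; nra ]).
  destruct (nome_small _ He3) as [Y3 [H3 F3]].
  exists (Rmax Y1 (Rmax Y2 Y3)). assert (M1 := Rmax_l Y1 (Rmax Y2 Y3)). assert (M2 := Rmax_r Y1 (Rmax Y2 Y3)).
  assert (M3 := Rmax_l Y2 Y3). assert (M4 := Rmax_r Y2 Y3).
  split. lra. intros z Hz. specialize (F1 z ltac:(lra)). specialize (F2 z ltac:(lra)). specialize (F3 z ltac:(lra)).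
  assert (F4 := Rle_trans _ _ _ F3 (Rmin_l _ _)). assert (F5 := Rle_trans _ _ _ F3 (Rmin_r _ _)). clear F3.
  set (q := nome z) in *. set (x := Cmod q) in *. assert (Hx : 0 <= x) by apply Cmod_ge_0.
  set (p := (f z - 1 - a * q)%C) in *. set (r := (g z - 1 - b * q)%C) in *.
  replace (f z * g z - 1 - (a + b) * q)%C with (p * (r + 1 + b * q) + ((1 + a * q) * r + a * b * (q * q)))%C
    by (unfold p, r; ring).
  assert (Hp := Cmod_ge_0 p). assert (Hr := Cmod_ge_0 r).
  assert (T1 : Cmod (r + 1 + b * q) <= 2 + B).
  { eapply Rle_trans. apply Cmod_triangle. assert (T := Cmod_triangle r 1). rewrite Cmod_1 in T.
    rewrite Cmod_mult. fold x B. nra. }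
  assert (T2 : Cmod (1 + a * q) <= 1 + A).
  { eapply Rle_trans. apply Cmod_triangle. rewrite Cmod_1, Cmod_mult. fold x A. nra. }
  eapply Rle_trans. apply Cmod_triangle.
  assert (T3 := Cmod_triangle ((1 + a * q) * r) (a * b * (q * q))).
  rewrite !Cmod_mult in *. fold x A B in T3.
  assert (S1 : Cmod p * Cmod (r + 1 + b * q) <= e * x * (2 + A + B)).
  { apply Rmult_le_compat; trivial. apply Cmod_ge_0. lra. }
  assert (S2 : Cmod (1 + a * q) * Cmod r <= (2 + A + B) * (e * x)).
  { apply Rmult_le_compat; trivial. apply Cmod_ge_0. lra. }
  assert (S3 : A * B * (x * x) <= eps / 3 * x).
  { replace (A * B * (x * x)) with (A * B * x * x) by ring. apply Rmult_le_compat_r. exact Hx.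
    apply Rle_trans with ((A * B + 1) * (eps / (3 * (A * B + 1)))).
    apply Rmult_le_compat; nra. right; field. nra. }
  assert (S4 : e * (2 + A + B) * x <= eps / 3 * x) by (apply Rmult_le_compat_r; trivial).
  nra.
Qed.

Lemma first_order_exp (f : C -> C) (a : C) : first_order f a ->
  first_order (fun z => C_exp (f z - 1)) a.
Proof.
  intros Hf eps He. set (A := Cmod a). assert (HA : 0 <= A) by apply Cmod_ge_0.
  set (e1 := Rmin 1 (eps / 2)). assert (He1 : 0 < e1) by (apply Rmin_pos; lra).
  set (e2 := eps / (2 * (1 + A))). assert (He2 : 0 < e2) by (apply Rdiv_lt_0_compat; lra).
  destruct (Hf e1 He1) as [Y1 [H1 F1]].
  assert (D := is_Cderive_exp_0). rewrite is_Cderive_eps in D. destruct (D (mkposreal e2 He2)) as [d Hd]. simpl in Hd.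
  assert (He3 : 0 < d / (2 * (1 + A))) by (apply Rdiv_lt_0_compat; [ apply cond_pos | lra ]).
  destruct (nome_small _ He3) as [Y2 [H2 F2]].
  exists (Rmax Y1 Y2). assert (M1 := Rmax_l Y1 Y2). assert (M2 := Rmax_r Y1 Y2). split. lra.
  intros z Hz. specialize (F1 z ltac:(lra)). specialize (F2 z ltac:(lra)).
  set (q := nome z) in *. set (x := Cmod q) in *. assert (Hx : 0 <= x) by apply Cmod_ge_0.
  set (u := (f z - 1)%C) in *.
  assert (E1 : e1 <= 1) by apply Rmin_l. assert (E2 : e1 <= eps / 2) by apply Rmin_r.
  assert (Hu : Cmod u <= (1 + A) * x).
  { replace u with ((u - a * q) + a * q)%C by ring. eapply Rle_trans. apply Cmod_triangle.
    rewrite Cmod_mult. fold x A. nra. }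
  assert (Hud : Cmod (u - 0) < d).
  { replace (u - 0)%C with u by ring.
    assert (Hd0 := cond_pos d).
    assert ((1 + A) * x <= (1 + A) * (d / (2 * (1 + A)))) by (apply Rmult_le_compat_l; lra).
    replace ((1 + A) * (d / (2 * (1 + A)))) with (d / 2) in H by (field; lra). lra. }
  specialize (Hd u Hud). rewrite C_exp_0 in Hd. replace (u - 0)%C with u in Hd by ring.
  replace (C_exp u - 1 - a * q)%C with ((C_exp u - 1 - 1 * u) + (u - a * q))%C by ring.
  eapply Rle_trans. apply Cmod_triangle.
  assert (S1 : e2 * Cmod u <= eps / 2 * x).
  { apply Rle_trans with (e2 * ((1 + A) * x)). apply Rmult_le_compat_l; lra.
    right. unfold e2. field. lra. }
  assert (S2 : e1 * x <= eps / 2 * x) by (apply Rmult_le_compat_r; trivial). lra.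
Qed.

Lemma first_order_ext (f g : C -> C) (a b : C) : (forall z, f z = g z) -> a = b ->
  first_order f a -> first_order g b.
Proof. intros H <- Hf eps He. destruct (Hf eps He) as [Y [HY F]]. exists Y. split; trivial. intros z Hz. rewrite <- H. now apply F. Qed.

Lemma sigmaR_1 (k : nat) : sigmaR k 1 = 1.
Proof. unfold sigmaR. rewrite sigma_divisor_sum. unfold divisor_sum. simpl. rewrite pow1. ring. Qed.

Lemma logcoef_1 : logcoef 1 = 1.
Proof. assert (H := logcoef_sigma 0). rewrite sigmaR_1 in H. simpl INR in H. lra. Qed.

(** q j = E4^3 exp(24 sum sigma_1(n)/n q^n) = 1 + (3 * 240 + 24) q + o(q), and 720 + 24 = 744. *)
Lemma j_asymptotics (eps : R) : 0 < eps -> exists Y, 1 <= Y /\ forall z, Y <= Im z ->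
  Cmod (j z - 744 - / nome z) <= eps.
Proof.
  intros He.
  set (f := fun z => (E4 z * (E4 z * E4 z) * C_exp (24 * qseries logcoef z))%C).
  assert (H4 : first_order E4 240).
  { eapply first_order_ext; [ | | apply (first_order_qseries (sigmaR 3) 240); apply sigmaR_poly_bounded; lia ].
    reflexivity. rewrite sigmaR_1. ring. }
  assert (HL : first_order (fun z => C_exp (24 * qseries logcoef z)) 24).
  { eapply first_order_ext; [ | | apply first_order_exp, (first_order_qseries logcoef 24), logcoef_poly_bounded ].
    intros z. cbv beta. f_equal. ring. rewrite logcoef_1. ring. }
  assert (Hf : first_order f 744).
  { eapply first_order_ext; [ | | apply first_order_mult; [ apply first_order_mult; [ exact H4 | apply first_order_mult; [ exact H4 | exact H4 ] ] | exact HL ] ].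
    reflexivity. ring. }
  destruct (Hf eps He) as [Y [HY F]]. exists Y. split. exact HY. intros z Hz. specialize (F z Hz).
  assert (HzH : upper_half_plane z) by (unfold upper_half_plane; lra).
  assert (Hq := nome_nz z). assert (Hq' := Cmod_nome_pos z).
  assert (Ej : j z = (f z / nome z)%C).
  { unfold j, f. rewrite Delta_exp by trivial.
    replace (tpi * z - 24 * qseries logcoef z)%C with (tpi * z + - (24 * qseries logcoef z))%C by ring.
    rewrite C_exp_plus, C_exp_opp, <- nome_exp.
    assert (He' := C_exp_nz (24 * qseries logcoef z)). simpl Cpow. field. tauto. }
  rewrite Ej. replace (f z / nome z - 744 - / nome z)%C with ((f z - 1 - 744 * nome z) * / nome z)%C by (field; trivial).
  rewrite Cmod_mult, Cmod_inv by trivial.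
  apply Rmult_le_reg_r with (1 := Hq'). rewrite Rmult_assoc, Rinv_l by lra. lra.
Qed.

(* The constant term 744 of j makes the primitive of j - 744 periodic. *)
Lemma periodic_primitive : exists P, (forall z, upper_half_plane z -> is_Cderive P z (j z - 744)) /\
  (forall z, upper_half_plane z -> P (z + 1)%C = P z).
Proof.
  destruct (primitive_on_H (fun z => j z - 744)%C dj) as [P HP].
  - intros z Hz. eapply is_Cderive_eq. apply is_Cderive_minus. now apply j_derive. apply is_Cderive_const. ring.
  - apply dj_derive.
  - exists P. split. exact HP.
    assert (Hconst : forall z w, upper_half_plane z -> upper_half_plane w ->
      (P (z + 1) - P z)%C = (P (w + 1) - P w)%C).
    { apply (is_Cderive_zero_const _ (fun z => P (z + 1) - P z)%C Cconvex_H).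
      intros z Hz. eapply is_Cderive_eq.
      - apply is_Cderive_minus; [ | apply HP, Hz ].
        apply (is_Cderive_comp P (fun z => z + 1)%C). apply HP, (H_incr z 1 Hz).
        apply is_Cderive_plus. apply is_Cderive_id. apply is_Cderive_const.
      - rewrite j_periodic. ring. }
    intros z Hz. apply Ceq_minus, Cmod_eq_0. apply Rle_antisym; [ | apply Cmod_ge_0 ].
    apply le_epsilon. intros eps He. rewrite Rplus_0_l.
    destruct (j_asymptotics eps He) as [Y [HY F]].
    set (w := (0, Y) : C). assert (Hw : upper_half_plane w) by (unfold upper_half_plane, w; simpl; lra).
    rewrite (Hconst z w Hz Hw).
    (* The added term is periodic, so G has the same increment as P, and its derivative -1/q removes
       the pole: high up, G' is at most eps, so the constant increment is at most eps. *)
    set (G := fun z => (P z + / tpi * / nome z)%C).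
    replace (P (w + 1) - P w)%C with (G (w + 1)%C - G w)%C by (unfold G; rewrite nome_periodic; ring).
    apply Rle_trans with (eps * Cmod (w + 1 - w)).
    + apply (mean_value_segment G (fun z => j z - 744 - / nome z)%C). intros t Ht.
      replace (w + t * (w + 1 - w))%C with (w + RtoC t)%C by ring.
      assert (Hwt := H_incr w t Hw). split.
      * assert (Hq := nome_nz (w + RtoC t)). assert (Ht' := tpi_nz). eapply is_Cderive_eq.
        -- apply is_Cderive_plus. apply HP, Hwt. apply is_Cderive_scal. apply is_Cderive_inv. exact Hq. apply is_Cderive_nome.
        -- cbv beta. field. tauto.
      * apply F. rewrite im_plus, im_RtoC. unfold w. simpl. lra.
    + replace (w + 1 - w)%C with (RtoC 1) by ring. rewrite Cmod_1. lra.
Qed.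

Definition hline (x : R) : C := (RtoC x + Ci)%C.

Lemma hline_H (x : R) : upper_half_plane (hline x).
Proof. unfold upper_half_plane, hline. rewrite im_plus, im_RtoC. simpl. lra. Qed.

Lemma is_derive_hline (x : R) :
  is_derive (K := R_AbsRing) (V := C_R_NormedModule) hline x (RtoC 1).
Proof.
  apply is_derive_C_eps. intros eps. exists eps. intros t _. unfold hline.
  replace (t + Ci - (x + Ci) - (t - x)%R * 1)%C with (RtoC 0) by (rewrite RtoC_minus; ring).
  rewrite Cmod_0. apply Rmult_le_pos. left; apply cond_pos. apply Rabs_pos.
Qed.

(** Continuity gives a maximum on one period; the integer part of x brings every other point back to
    it. *)
Lemma periodic_bounded (P p : C -> C) : (forall z, upper_half_plane z -> is_Cderive P z (p z)) ->
  (forall z, upper_half_plane z -> P (z + 1)%C = P z) ->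
  exists B, 0 < B /\ forall x, 0 <= x -> Cmod (P (hline x)) <= B.
Proof.
  intros HP Hper.
  destruct (continuity_ab_maj (fun x => Cmod (P (hline x))) 0 1) as [M [HM _]]. lra.
  { intros x _ e He.
    assert (A := is_derive_C_continuous _ _ _ (is_derive_C_comp P hline x _ _ (HP _ (hline_H x)) (is_derive_hline x))).
    destruct (A (mkposreal e He)) as [d Hd]. exists d. split. apply cond_pos. intros t [_ Ht].
    simpl in Ht |- *. unfold R_dist in *. specialize (Hd t Ht). simpl in Hd.
    eapply Rle_lt_trans; [ | exact Hd ].
    assert (T1 := Cmod_triangle_sub (P (hline t)) (P (hline x))).
    assert (T2 := Cmod_triangle_sub (P (hline x)) (P (hline t))). rewrite Cmod_sub_sym in T2.
    apply Rabs_le; lra. }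
  exists (Cmod (P (hline M)) + 1). split. generalize (Cmod_ge_0 (P (hline M))); lra.
  assert (Hn : forall n z, upper_half_plane z -> P (z + NtoC n)%C = P z).
  { induction n as [|n IH]; intros z Hz. now rewrite NtoC_0, Cplus_0_r.
    rewrite NtoC_S, Cplus_assoc, Hper, IH; trivial. now apply H_incr. }
  intros x Hx. destruct (nfloor_ex x Hx) as [n Hxn].
  replace (hline x) with (hline (x - INR n) + NtoC n)%C by (unfold hline, NtoC; rewrite RtoC_minus; ring).
  rewrite Hn by apply hline_H.
  specialize (HM (x - INR n) ltac:(lra)). lra.
Qed.

(** * The cycle integral at w = (N, N, N, ...) *)

Definition discN (N : nat) : R := INR N ^ 2 - 4.
Definition wN (N : nat) : R := (INR N + sqrt (discN N)) / 2.
Definition wN' (N : nat) : R := (INR N - sqrt (discN N)) / 2.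

Lemma INR_ge_3 (N : nat) : (2 < N)%nat -> 3 <= INR N.
Proof. intros H. replace 3 with (INR 3) by (simpl; ring). apply le_INR. lia. Qed.

Lemma wN_sum (N : nat) : wN N + wN' N = INR N.
Proof. unfold wN, wN'. field. Qed.

Lemma wN_diff (N : nat) : wN N - wN' N = sqrt (discN N).
Proof. unfold wN, wN'. field. Qed.

Lemma wN_prod (N : nat) : (2 < N)%nat -> wN N * wN' N = 1.
Proof.
  intros H. assert (H3 := INR_ge_3 N H). unfold wN, wN'.
  assert (E : sqrt (discN N) * sqrt (discN N) = discN N) by (apply sqrt_sqrt; unfold discN; nra).
  transitivity ((INR N ^ 2 - sqrt (discN N) * sqrt (discN N)) / 4). field. rewrite E. unfold discN. field.
Qed.

Lemma wN_gt (N : nat) : (2 < N)%nat -> INR N / 2 < wN N.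
Proof.
  intros H. assert (H3 := INR_ge_3 N H). unfold wN.
  assert (0 < sqrt (discN N)) by (apply sqrt_lt_R0; unfold discN; nra). lra.
Qed.

Lemma wN_bounds (N : nat) : (2 < N)%nat -> 1 < wN N /\ 0 < wN' N < 1.
Proof.
  intros H. assert (H1 := wN_gt N H). assert (H3 := INR_ge_3 N H). assert (E := wN_prod N H).
  split. lra. split; nra.
Qed.

Lemma disc_N (N : nat) : IZR (Defs.disc 1 (- Z.of_nat N) 1) = discN N.
Proof.
  unfold Defs.disc, discN. rewrite minus_IZR, !mult_IZR, opp_IZR, <- INR_IZR_INZ. ring.
Qed.

(* Descent on the denominator: w = p / q gives w = 1 / (N - w) = q / (N q - p). *)
Lemma wN_irrational (N : nat) : (2 < N)%nat -> irrational (wN N).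
Proof.
  intros HN. destruct (wN_bounds N HN) as [H1 H2]. assert (E := wN_prod N HN). assert (S0 := wN_sum N).
  assert (G : forall n : nat, forall p q : Z, (Z.of_nat n = q)%Z -> (0 < q)%Z -> wN N <> IZR p / IZR q).
  { induction n as [n IH] using (well_founded_induction Wf_nat.lt_wf). intros p q Hnq Hq Hw.
    assert (Hq' : 0 < IZR q) by now apply IZR_lt.
    set (p1 := (Z.of_nat N * q - p)%Z).
    assert (Ep : IZR p1 = wN' N * IZR q).
    { unfold p1. rewrite minus_IZR, mult_IZR, <- INR_IZR_INZ, <- S0, Hw. field. lra. }
    assert (P1 : (0 < p1)%Z) by (apply lt_IZR; nra).
    assert (P2 : (p1 < q)%Z) by (apply lt_IZR; nra).
    apply (IH (Z.to_nat p1) ltac:(lia) q p1); [ lia | exact P1 | ].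
    rewrite Ep. apply Rmult_eq_reg_r with (wN' N * IZR q); [ | nra ].
    unfold Rdiv. rewrite Rmult_assoc, Rinv_l, <- Rmult_assoc, E by nra. ring. }
  intros p q Hq Hw. destruct (Z_lt_le_dec 0 q) as [H | H].
  - apply (G (Z.to_nat q) p q); trivial. lia.
  - apply (G (Z.to_nat (- q)) (- p)%Z (- q)%Z); try lia. rewrite Hw, !opp_IZR. field.
    intros A. apply Hq. now apply eq_IZR.
Qed.

Lemma wN_root (N : nat) : (2 < N)%nat -> wN N ^ 2 = INR N * wN N - 1.
Proof. intros HN. rewrite <- (wN_prod N HN), <- (wN_sum N). ring. Qed.

Lemma quadratic_coefs_wN (N : nat) : (2 < N)%nat -> quadratic_coefs (wN N) 1 (- Z.of_nat N) 1.
Proof.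
  intros HN. assert (H3 := INR_ge_3 N HN). split; [ now apply wN_irrational | ]. split; [ lia | ].
  split; [ apply Z.gcd_1_r | ]. split.
  - rewrite (wN_root N HN), opp_IZR, <- INR_IZR_INZ. ring.
  - split.
    + apply lt_IZR. rewrite disc_N. unfold discN. nra.
    + rewrite disc_N, opp_IZR, <- INR_IZR_INZ. unfold wN. field.
Qed.

(** Substituting w^2 = N w - 1 leaves (aN + b) w = a - c. Irrationality kills both sides,
    coprimality leaves +-(1, -N, 1), and the choice of root fixes the sign. *)
Lemma quadratic_coefs_unique (N : nat) (a b c : Z) : (2 < N)%nat -> quadratic_coefs (wN N) a b c ->
  a = 1%Z /\ b = (- Z.of_nat N)%Z /\ c = 1%Z.
Proof.
  intros HN [Hirr [Ha [Hg [Hroot [_ Hw]]]]].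
  assert (E1 : (a * Z.of_nat N + b = 0)%Z).
  { destruct (Z.eq_dec (a * Z.of_nat N + b) 0) as [E | E]; trivial. exfalso.
    apply (Hirr (a - c)%Z (a * Z.of_nat N + b)%Z E).
    assert (E' : IZR (a * Z.of_nat N + b) <> 0) by (intros A; apply E; now apply eq_IZR).
    apply Rmult_eq_reg_r with (IZR (a * Z.of_nat N + b)); trivial.
    unfold Rdiv. rewrite Rmult_assoc, Rinv_l by trivial.
    rewrite (wN_root N HN) in Hroot.
    rewrite minus_IZR, plus_IZR, mult_IZR, <- INR_IZR_INZ. lra. }
  assert (Eb : b = (- (a * Z.of_nat N))%Z) by lia.
  assert (Ec : c = a).
  { apply eq_IZR. rewrite (wN_root N HN), Eb, opp_IZR, mult_IZR, <- INR_IZR_INZ in Hroot. lra. }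
  assert (Ha1 : (a | 1)%Z).
  { rewrite <- Hg. apply Z.gcd_greatest. apply Z.gcd_greatest. apply Z.divide_refl.
    rewrite Eb. exists (- Z.of_nat N)%Z. ring. rewrite Ec. apply Z.divide_refl. }
  apply Z.divide_1_r in Ha1. destruct Ha1 as [-> | ->].
  - repeat split; lia.
  (* For (-1, N, -1) the root with + sqrt D is the conjugate w', which differs from w. *)
  - exfalso. change (Z.opp 1) with (-1)%Z in *. assert (Ed : Defs.disc (-1) b c = Defs.disc 1 (- Z.of_nat N) 1) by (unfold Defs.disc; subst b c; ring).
    rewrite Ed, disc_N, Eb in Hw. replace (- (-1 * Z.of_nat N))%Z with (Z.of_nat N) in Hw by lia.
    rewrite <- INR_IZR_INZ in Hw.
    assert (Hw' : wN N = wN' N) by (rewrite Hw at 1; unfold wN'; field).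
    destruct (wN_bounds N HN). lra.
Qed.

Lemma smallest_pell4_N (N : nat) : (2 < N)%nat ->
  smallest_pell4 (Defs.disc 1 (- Z.of_nat N) 1) (Z.of_nat N) 1.
Proof.
  intros HN. unfold smallest_pell4, pell4, Defs.disc. split.
  - repeat split; lia.
  - intros t u [Ht [Hu E]]. split; [ | lia ].
    set (M := Z.of_nat N) in *. assert (HM : (2 < M)%Z) by lia.
    assert (Hu2 : (1 <= u * u)%Z) by nia.
    assert (A : ((M * M - 4) * 1 <= (M * M - 4) * (u * u))%Z) by (apply Z.mul_le_mono_nonneg_l; nia).
    replace (- M * - M - 4 * 1 * 1)%Z with (M * M - 4)%Z in E by ring. nia.
Qed.

Lemma epsilon_N (N : nat) : epsilon (Defs.disc 1 (- Z.of_nat N) 1) (Z.of_nat N) 1 = wN N.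
Proof. unfold epsilon, wN. rewrite disc_N, <- INR_IZR_INZ. field. Qed.

(** Both c(k+1) = N - 1/c(k) and w = N - 1/w, so c(k+1) - w = (c(k) - w)/(w c(k)): convergents stay
    above w > 1 and the error, initially w', contracts by 1/w at least. *)
Lemma ncf_wN (N : nat) : (2 < N)%nat -> ncf (fun _ => Z.of_nat N) = wN N.
Proof.
  intros HN. destruct (wN_bounds N HN) as [H1 H2]. assert (E := wN_prod N HN). assert (S0 := wN_sum N).
  set (c := ncf_convergent (fun _ => Z.of_nat N)).
  assert (Hc : forall k, wN N <= c k /\ c k - wN N <= (/ wN N) ^ k * wN' N).
  { induction k as [|k [IH1 IH2]].
    - unfold c. simpl ncf_convergent. rewrite <- INR_IZR_INZ. simpl pow. lra.
    - assert (Es : c (S k) - wN N = (c k - wN N) * (/ wN N * / c k)).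
      { unfold c at 1. simpl ncf_convergent. rewrite <- INR_IZR_INZ. fold c.
        replace (INR N) with (wN N + / wN N). field. lra.
        rewrite <- S0. f_equal. apply Rmult_eq_reg_l with (wN N); [ rewrite E; field | ]; lra. }
      assert (Hi : 0 < / c k <= 1).
      { split. apply Rinv_0_lt_compat; lra. rewrite <- Rinv_1. apply Rinv_le_contravar; lra. }
      assert (Hiw : 0 < / wN N) by (apply Rinv_0_lt_compat; lra).
      split.
      + apply Rminus_le_0. rewrite Es. apply Rmult_le_pos. lra. nra.
      + rewrite Es, <- tech_pow_Rmult.
        apply Rle_trans with ((/ wN N) ^ k * wN' N * (/ wN N * / c k)).
        * apply Rmult_le_compat_r. nra. exact IH2.
        * assert (0 <= (/ wN N) ^ k * wN' N) by (apply Rmult_le_pos; [ apply pow_le | ]; lra). 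
          replace (/ wN N * (/ wN N) ^ k * wN' N) with ((/ wN N) ^ k * wN' N * (/ wN N)) by ring.
          apply Rmult_le_compat_l. lra. nra. }
  unfold ncf. fold c. rewrite (is_lim_seq_unique c (wN N)). reflexivity.
  apply (is_lim_seq_le_le (fun _ => wN N) c (fun k => wN N + wN' N * (/ wN N) ^ k)).
  - intros k. destruct (Hc k). lra.
  - apply is_lim_seq_const.
  - replace (Finite (wN N)) with (Finite (wN N + 0)) by (f_equal; ring).
    apply is_lim_seq_plus'. apply is_lim_seq_const. apply is_lim_seq_scal0.
    apply is_lim_seq_geom. rewrite Rabs_pos_eq by (left; apply Rinv_0_lt_compat; lra).
    rewrite <- Rinv_1. apply Rinv_lt_contravar; lra.
Qed.

(** The kernel sqrt D / Q_w(z,1) in partial fractions; [dkap] is its derivative, needed for the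
    integration by parts. *)
Definition kap (N : nat) (z : C) : C := (/ (z - RtoC (wN N)) - / (z - RtoC (wN' N)))%C.
Definition dkap (N : nat) (z : C) : C :=
  (- / Cpow (z - RtoC (wN N)) 2 + / Cpow (z - RtoC (wN' N)) 2)%C.

Lemma kap_derive (N : nat) (z : C) : upper_half_plane z -> is_Cderive (kap N) z (dkap N z).
Proof.
  intros Hz. destruct (H_plus_real_nz z (wN N) Hz) as [_ A]. destruct (H_plus_real_nz z (wN' N) Hz) as [_ B].
  eapply is_Cderive_eq.
  - apply is_Cderive_minus; apply is_Cderive_inv; trivial;
      (apply is_Cderive_minus; [ apply is_Cderive_id | apply is_Cderive_const ]).
  - cbv beta. unfold dkap. simpl Cpow. field. tauto.
Qed.

Lemma dkap_derive (N : nat) (z : C) : upper_half_plane z -> exists d, is_Cderive (dkap N) z d.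
Proof.
  intros Hz. destruct (H_plus_real_nz z (wN N) Hz) as [_ A]. destruct (H_plus_real_nz z (wN' N) Hz) as [_ B].
  eexists. apply is_Cderive_plus; [ apply is_Cderive_opp | ]; apply is_Cderive_inv;
    try (now apply Cpow_nz); apply is_Cderive_pow;
    (apply is_Cderive_minus; [ apply is_Cderive_id | apply is_Cderive_const ]).
Qed.

Definition integrandN (N : nat) (z : C) : C :=
  Cdiv (Cmult (RtoC (sqrt (IZR (Defs.disc 1 (- Z.of_nat N) 1)))) (j z))
       (Q_form 1 (- Z.of_nat N) 1 z (RtoC 1)).

Lemma integrandN_kap (N : nat) (z : C) : (2 < N)%nat -> upper_half_plane z ->
  integrandN N z = (j z * kap N z)%C.
Proof.
  intros HN Hz. destruct (H_plus_real_nz z (wN N) Hz) as [_ A]. destruct (H_plus_real_nz z (wN' N) Hz) as [_ B].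
  unfold integrandN. rewrite disc_N, <- wN_diff.
  replace (Q_form 1 (- Z.of_nat N) 1 z 1) with ((z - RtoC (wN N)) * (z - RtoC (wN' N)))%C.
  - unfold kap. rewrite RtoC_minus. field. tauto.
  - unfold Q_form. rewrite opp_IZR, <- INR_IZR_INZ, <- wN_sum, RtoC_opp, RtoC_plus.
    assert (E := wN_prod N HN). apply (f_equal RtoC) in E. rewrite RtoC_mult in E.
    transitivity (z * z - (wN N + wN' N) * z + wN N * wN' N)%C. ring. rewrite E. simpl Cpow. ring.
Qed.

(** The differential kap(z) dz is invariant under A_w because A_w fixes both w and w'; the factor
    1/z^2 is the derivative of -1/z. *)
Lemma kap_inversion (N : nat) (z : C) : (2 < N)%nat -> upper_half_plane z ->
  (kap N (Sz z + NtoC N) * / (z * z))%C = kap N z.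
Proof.
  intros HN Hz. assert (Hz0 := H_nz z Hz).
  assert (HA := H_incr _ (INR N) (Sz_H z Hz)). fold (NtoC N) in HA.
  destruct (H_plus_real_nz z (wN N) Hz) as [_ A]. destruct (H_plus_real_nz z (wN' N) Hz) as [_ B].
  destruct (wN_bounds N HN) as [W1 [W2 _]].
  assert (E := wN_prod N HN). assert (S0 := wN_sum N).
  assert (HW : RtoC (wN N) <> 0) by (intros X; apply RtoC_inj in X; lra).
  assert (HW' : wN' N = / wN N) by (apply Rmult_eq_reg_l with (wN N); [ rewrite E; field | ]; lra).
  unfold kap, Sz, NtoC. rewrite <- S0, RtoC_plus, HW', RtoC_inv in * by lra.
  set (w := RtoC (wN N)) in *.
  assert (B' : (z * w - 1)%C <> 0).
  { intros X. apply B. replace (z - / w)%C with ((z * w - 1) / w)%C by (field; trivial). rewrite X. field. trivial. }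
  replace (- / z + (w + / w) - w)%C with ((z - w) / (z * w))%C by (field; tauto).
  replace (- / z + (w + / w) - / w)%C with ((z * w - 1) / z)%C by (field; tauto).
  replace (z - / w)%C with ((z * w - 1) / w)%C by (field; trivial).
  field. tauto.
Qed.

Lemma A_act_N (N : nat) (z : C) : upper_half_plane z ->
  A_act 1 (- Z.of_nat N) 1 (Z.of_nat N) 1 z = (Sz z + NtoC N)%C.
Proof.
  intros Hz. assert (Hz0 := H_nz z Hz). unfold A_act, moebius.
  rewrite opp_IZR, <- INR_IZR_INZ.
  replace ((INR N - - INR N * 1) / 2) with (INR N) by field.
  replace ((INR N + - INR N * 1) / 2) with 0 by field.
  replace (- (1 * 1)) with (- (1)) by ring. replace (1 * 1) with 1 by ring.
  rewrite RtoC_opp. fold (NtoC N). unfold Sz. field. trivial.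
Qed.

(** Conjugating both argument and value restores complex differentiability. *)
Lemma is_Cderive_reflect (F : C -> C) (c : R) (z l : C) : is_Cderive F (RtoC c - Cconj z)%C l ->
  is_Cderive (fun w => Cconj (F (RtoC c - Cconj w)%C)) z (- Cconj l).
Proof.
  intros H. rewrite is_Cderive_eps in H. apply is_Cderive_eps. intros eps.
  destruct (H eps) as [d Hd]. exists d. intros w Hw.
  assert (E : (RtoC c - Cconj w - (RtoC c - Cconj z))%C = (- Cconj (w - z))%C) by (rewrite Cminus_conj; ring).
  specialize (Hd (RtoC c - Cconj w)%C). rewrite E, Cmod_opp, Cmod_conj in Hd. specialize (Hd Hw).
  rewrite <- Cmod_conj in Hd. rewrite (Cminus_conj (F _ - F _)), (Cminus_conj (F _)), Cmult_conj, Copp_conj, Cconj_conj in Hd.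
  replace (Cconj (F (c - Cconj w)) - Cconj (F (c - Cconj z)) - - Cconj l * (w - z))%C
    with (Cconj (F (c - Cconj w)) - Cconj (F (c - Cconj z)) - Cconj l * - (w - z))%C by ring.
  exact Hd.
Qed.

(** As w + w' = N, the reflection exchanges the two poles; the sign from reversing the real
    direction then restores their order. *)
Lemma kap_reflect (N : nat) (z : C) : upper_half_plane z ->
  kap N (NtoC N - Cconj z) = Cconj (kap N z).
Proof.
  intros Hz. destruct (H_plus_real_nz z (wN N) Hz) as [_ A]. destruct (H_plus_real_nz z (wN' N) Hz) as [_ B].
  assert (A' : (Cconj z - RtoC (wN N))%C <> 0).
  { intros X. apply A. rewrite <- (Cconj_conj (z - RtoC (wN N))), Cminus_conj, RtoC_conj, X. apply RtoC_conj. }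
  assert (B' : (Cconj z - RtoC (wN' N))%C <> 0).
  { intros X. apply B. rewrite <- (Cconj_conj (z - RtoC (wN' N))), Cminus_conj, RtoC_conj, X. apply RtoC_conj. }
  unfold kap. rewrite Cminus_conj, !Cinv_conj, !Cminus_conj, !RtoC_conj by trivial.
  unfold NtoC. rewrite <- wN_sum, RtoC_plus.
  replace (wN N + wN' N - Cconj z - wN N)%C with (- (Cconj z - wN' N))%C by ring.
  replace (wN N + wN' N - Cconj z - wN' N)%C with (- (Cconj z - wN N))%C by ring.
  field. tauto.
Qed.

Lemma integrandN_derive (N : nat) (z : C) : (2 < N)%nat -> upper_half_plane z ->
  is_Cderive (integrandN N) z (dj z * kap N z + j z * dkap N z).
Proof.
  intros HN Hz. apply (is_Cderive_ext_loc (fun w => j w * kap N w)%C _ _ _ (Im z) Hz).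
  - intros w Hw. symmetry. apply integrandN_kap; trivial. now apply (H_open z).
  - apply is_Cderive_mult. now apply j_derive. now apply kap_derive.
Qed.

Lemma primitiveN (N : nat) : (2 < N)%nat ->
  exists F, forall z, upper_half_plane z -> is_Cderive F z (j z * kap N z).
Proof.
  intros HN. apply (primitive_on_H (fun z => j z * kap N z)%C (fun z => dj z * kap N z + j z * dkap N z)%C).
  - intros z Hz. apply is_Cderive_mult. now apply j_derive. now apply kap_derive.
  - intros z Hz. destruct (dj_derive z Hz) as [d1 D1]. destruct (dkap_derive N z Hz) as [d2 D2].
    eexists. apply is_Cderive_plus; apply is_Cderive_mult.
    exact D1. now apply kap_derive. now apply j_derive. exact D2.
Qed.

(** F(A_w z) - F(z) does not depend on z, so any base point may be traded for i, which inversion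
    fixes and A_w sends to i + N. The sign follows the orientation from A_w z to z. *)
Lemma cycle_integral_primitive (N : nat) (F : C -> C) : (2 < N)%nat ->
  (forall z, upper_half_plane z -> is_Cderive F z (j z * kap N z)) ->
  is_cycle_integral j 1 (- Z.of_nat N) 1 (Z.of_nat N) 1 (F Ci - F (Ci + NtoC N)%C).
Proof.
  intros HN HF z0 g dg Hz0 Hg.
  assert (Hi : upper_half_plane Ci) by (unfold upper_half_plane; simpl; lra).
  assert (Hconst : forall z w, upper_half_plane z -> upper_half_plane w ->
    (F (Sz z + NtoC N) - F z)%C = (F (Sz w + NtoC N) - F w)%C).
  { apply (is_Cderive_zero_const _ (fun z => F (Sz z + NtoC N) - F z)%C Cconvex_H).
    intros z Hz. assert (HA := H_incr _ (INR N) (Sz_H z Hz)). eapply is_Cderive_eq.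
    - apply is_Cderive_minus; [ | apply HF, Hz ].
      apply (is_Cderive_comp F (fun z => Sz z + NtoC N)%C). apply HF, HA.
      apply is_Cderive_plus. apply is_Cderive_Sz. now apply H_nz. apply is_Cderive_const.
    - rewrite <- (kap_inversion N z HN Hz), j_periodic_n, j_inversion by trivial. ring. }
  replace (F Ci - F (Ci + NtoC N))%C with (F z0 - F (A_act 1 (- Z.of_nat N) 1 (Z.of_nat N) 1 z0))%C.
  - change (is_path_integral (integrandN N) g dg (F z0 - F (A_act 1 (- Z.of_nat N) 1 (Z.of_nat N) 1 z0))).
    apply (is_path_integral_primitive _ F (fun z => dj z * kap N z + j z * dkap N z)%C); trivial.
    + intros z Hz. rewrite integrandN_kap by trivial. now apply HF.
    + intros z Hz. now apply integrandN_derive.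
  - rewrite A_act_N by trivial. assert (E := Hconst z0 Ci Hz0 Hi).
    replace (Sz Ci) with Ci in E by (unfold Sz; rewrite Ci_inv; ring).
    transitivity (- (F (Sz z0 + NtoC N) - F z0))%C. ring. rewrite E. ring.
Qed.

Lemma hline_0 : hline 0 = Ci.
Proof. unfold hline. ring. Qed.

(* Reflection z |-> N - conj z exchanges the two ends of the path from i + N to i. *)
Lemma primitiveN_real (N : nat) (F : C -> C) :
  (forall z, upper_half_plane z -> is_Cderive F z (j z * kap N z)) ->
  Im (F Ci - F (Ci + NtoC N)%C) = 0.
Proof.
  intros HF.
  assert (Hi : upper_half_plane Ci) by (unfold upper_half_plane; simpl; lra).
  assert (Hi2 : upper_half_plane (Ci + NtoC N)) by now apply H_incr.
  assert (E : (F Ci + Cconj (F (RtoC (INR N) - Cconj Ci)))%C = (F (Ci + NtoC N) + Cconj (F (RtoC (INR N) - Cconj (Ci + NtoC N))))%C).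
  { apply (is_Cderive_zero_const _ (fun z => F z + Cconj (F (RtoC (INR N) - Cconj z)))%C Cconvex_H); trivial.
    intros z Hz. assert (Hr := H_incr _ (INR N) (reflect_H z Hz)).
    replace (- Cconj z + INR N)%C with (INR N - Cconj z)%C in Hr by ring.
    eapply is_Cderive_eq.
    - apply is_Cderive_plus. now apply HF. apply is_Cderive_reflect. now apply HF.
    - fold (NtoC N). rewrite kap_reflect by trivial.
      replace (NtoC N - Cconj z)%C with (- Cconj z + NtoC N)%C by ring.
      rewrite j_periodic_n, j_conj, Cmult_conj, !Cconj_conj by trivial. ring. }
  replace (RtoC (INR N) - Cconj Ci)%C with (Ci + NtoC N)%C in E by (unfold NtoC; apply C_ext; simpl; ring).
  replace (RtoC (INR N) - Cconj (Ci + NtoC N))%C with Ci in E by (unfold NtoC; apply C_ext; simpl; ring).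
  apply (f_equal Im) in E. rewrite !im_plus, !im_conj in E.
  unfold Cminus. rewrite im_plus, im_opp. lra.
Qed.

(** * Estimates on the line Im z = 1, uniform in N *)

Lemma Cmod_hline_sub_sqr (x w : R) : Cmod (hline x - RtoC w) ^ 2 = (x - w) ^ 2 + 1.
Proof.
  rewrite Cmod2_alt. unfold hline, Cminus. rewrite !re_plus, !im_plus, re_opp, im_opp, !re_RtoC, !im_RtoC. simpl. ring.
Qed.

Lemma Cmod_hline_sub_ge1 (x w : R) : 1 <= Cmod (hline x - RtoC w).
Proof.
  assert (H := Cmod_hline_sub_sqr x w). assert (H0 := Cmod_ge_0 (hline x - RtoC w)).
  set (m := Cmod (hline x - RtoC w)) in *. apply Rnot_lt_le. intros Hm.
  assert (m * m < 1) by nra. assert (A := pow2_ge_0 (x - w)). lra.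
Qed.

Lemma Cmod_inv_hline_le (x w : R) : Cmod (/ (hline x - RtoC w)) <= 1.
Proof.
  assert (H := Cmod_hline_sub_ge1 x w).
  rewrite Cmod_inv by (apply Cmod_gt_0; lra). rewrite <- Rinv_1. apply Rinv_le_contravar; lra.
Qed.

Lemma Re_inv_hline (x w : R) : Re (/ (hline x - RtoC w)) = (x - w) / ((x - w) ^ 2 + 1).
Proof.
  replace (hline x - RtoC w)%C with ((x - w, 1) : C) by (unfold hline; apply C_ext; simpl; ring).
  unfold Cinv, Re; simpl. f_equal. ring.
Qed.

Lemma Cmod_kap_hline_le (N : nat) (x : R) : Cmod (kap N (hline x)) <= 2.
Proof.
  unfold kap. eapply Rle_trans. apply Cmod_minus_le.
  assert (A := Cmod_inv_hline_le x (wN N)). assert (B := Cmod_inv_hline_le x (wN' N)). lra.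
Qed.

(** The right-hand side is the derivative of atan(x - w) + atan(x - w'), whose total variation is 2
    pi whatever N. *)
Lemma Cmod_dkap_hline_le (N : nat) (x : R) :
  Cmod (dkap N (hline x)) <= / ((x - wN N) ^ 2 + 1) + / ((x - wN' N) ^ 2 + 1).
Proof.
  unfold dkap. eapply Rle_trans. apply Cmod_triangle. rewrite Cmod_opp.
  assert (E : forall w, Cmod (/ Cpow (hline x - RtoC w) 2) = / ((x - w) ^ 2 + 1)).
  { intros w. assert (H := Cmod_hline_sub_ge1 x w).
    rewrite Cmod_inv, Cmod_pow, Cmod_hline_sub_sqr. reflexivity.
    apply Cpow_nz, Cmod_gt_0. lra. }
  rewrite !E. apply Rle_refl.
Qed.

(** Both psi - G and psi + G have nonnegative derivative; this bounds the increment with no integral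
    of dG. *)
Lemma increment_le (G psi dG dpsi : R -> R) (b : R) : 0 <= b ->
  (forall x, 0 <= x <= b -> is_derive G x (dG x)) -> (forall x, 0 <= x <= b -> is_derive psi x (dpsi x)) ->
  (forall x, 0 <= x <= b -> Rabs (dG x) <= dpsi x) ->
  Rabs (G b - G 0) <= psi b - psi 0.
Proof.
  intros Hb HG Hpsi H.
  assert (A : forall s, (s = 1 \/ s = -1) -> s * (G b - G 0) <= psi b - psi 0).
  { intros s Hs.
    destruct (MVT_gen (fun x => psi x - s * G x) 0 b (fun x => dpsi x - s * dG x)) as [c [Hc E]].
    - rewrite Rmin_left, Rmax_right by lra. intros x Hx.
      apply (is_derive_minus psi (fun x => s * G x)). apply Hpsi; lra. apply is_derive_scal. apply HG; lra.
    - rewrite Rmin_left, Rmax_right by lra. intros x Hx.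
      apply derivable_continuous_pt. exists (dpsi x - s * dG x). apply is_derive_Reals.
      apply (is_derive_minus psi (fun x => s * G x)). apply Hpsi; lra. apply is_derive_scal. apply HG; lra.
    - rewrite Rmin_left, Rmax_right in Hc by lra. specialize (H c Hc). apply Rabs_le_between in H.
      assert (0 <= (dpsi c - s * dG c) * (b - 0)) by (destruct Hs as [-> | ->]; nra). lra. }
  apply Rabs_le. assert (A1 := A 1 (or_introl eq_refl)). assert (A2 := A (-1) (or_intror eq_refl)). lra.
Qed.

(** Because w w' = 1, w^2 (w'^2 + 1) = w^2 + 1. *)
Lemma ln_wN (N : nat) : (2 < N)%nat -> ln (wN' N ^ 2 + 1) - ln (wN N ^ 2 + 1) = - 2 * ln (wN N).
Proof.
  intros HN. destruct (wN_bounds N HN) as [H1 H2]. assert (E := wN_prod N HN).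
  replace (wN N ^ 2 + 1) with (wN N * (wN N * (wN' N ^ 2 + 1))).
  - rewrite !ln_mult by nra. ring.
  - transitivity ((wN N * wN' N) ^ 2 + wN N ^ 2). ring. rewrite E. ring.
Qed.

(* Integration by parts against the bounded periodic primitive P of j - 744: on Im z = 1 the
   constant term contributes 744 * 2 log w and the rest is bounded uniformly in N. *)
Lemma primitiveN_estimate : exists K, forall N F, (2 < N)%nat ->
  (forall z, upper_half_plane z -> is_Cderive F z (j z * kap N z)) ->
  Rabs (Re (F Ci - F (Ci + NtoC N)%C) - 1488 * ln (wN N)) <= K.
Proof.
  destruct periodic_primitive as [P [HP Hper]].
  destruct (periodic_bounded P _ HP Hper) as [B [HB0 HB]].
  (* Each of the two arctangents varies by less than pi; the two boundary terms P kap are at most 2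
     B each. *)
  exists (2 * PI * B + 4 * B). intros N F HN HF.
  set (w := wN N). set (w' := wN' N).
  destruct (wN_bounds N HN) as [W1 W2]. assert (S0 := wN_sum N). fold w w' in W1, W2, S0.
  assert (H3 := INR_ge_3 N HN).
  set (R0 := fun z => (F z - P z * kap N z)%C).
  (* The real part of log(x + i - w) is half of log((x - w)^2 + 1), whence 372 = 744/2: G subtracts
     the contribution of the constant term. *)
  set (G := fun x => Re (R0 (hline x)) - 372 * (ln ((x - w) ^ 2 + 1) - ln ((x - w') ^ 2 + 1))).
  set (dG := fun x => Re (- (P (hline x) * dkap N (hline x)))).
  set (psi := fun x => B * (atan (x - w) + atan (x - w'))).
  set (dpsi := fun x => B * (/ ((x - w) ^ 2 + 1) + / ((x - w') ^ 2 + 1))).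
  assert (Hpos : forall x y : R, 0 < (x - y) ^ 2 + 1) by (intros x y; generalize (pow2_ge_0 (x - y)); lra).
  assert (HG : forall x, is_derive G x (dG x)).
  { intros x. assert (Hx := hline_H x).
    assert (D1 : is_derive (fun x => Re (R0 (hline x))) x
       (Re ((j (hline x) * kap N (hline x) - ((j (hline x) - 744) * kap N (hline x) + P (hline x) * dkap N (hline x))) * 1))).
    { apply (is_derive_Re (fun x => R0 (hline x))). apply (is_derive_C_comp R0 hline).
      - apply is_Cderive_minus. now apply HF. apply is_Cderive_mult. now apply HP. now apply kap_derive.
      - apply is_derive_hline. }
    assert (D2 : is_derive (fun x => 372 * (ln ((x - w) ^ 2 + 1) - ln ((x - w') ^ 2 + 1))) x
       (744 * ((x - w) / ((x - w) ^ 2 + 1) - (x - w') / ((x - w') ^ 2 + 1)))).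
    { assert (A1 := Hpos x w). assert (A2 := Hpos x w'). auto_derive.
      - split; [ | split; [ | trivial ] ]; simpl in *; lra.
      - field. split; apply Rgt_not_eq; simpl in *; lra. }
    replace (dG x) with (Re ((j (hline x) * kap N (hline x) - ((j (hline x) - 744) * kap N (hline x) + P (hline x) * dkap N (hline x))) * 1)
      - (744 * ((x - w) / ((x - w) ^ 2 + 1) - (x - w') / ((x - w') ^ 2 + 1)))).
    - apply (is_derive_minus (fun x => Re (R0 (hline x)))); assumption.
    - unfold dG.
      replace ((j (hline x) * kap N (hline x) - ((j (hline x) - 744) * kap N (hline x) + P (hline x) * dkap N (hline x))) * 1)%C
        with (RtoC 744 * kap N (hline x) + - (P (hline x) * dkap N (hline x)))%C by ring.
      rewrite re_plus, re_scal_l. unfold kap at 1. unfold Cminus. rewrite re_plus, re_opp.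
      fold (Cminus (hline x) (RtoC (wN N))) (Cminus (hline x) (RtoC (wN' N))). rewrite !Re_inv_hline. fold w w'. ring. }
  assert (Hpsi : forall x, is_derive psi x (dpsi x)).
  { intros x. unfold psi, dpsi. assert (A1 := Hpos x w). assert (A2 := Hpos x w').
    auto_derive; trivial. unfold Rsqr. field.
    split; apply Rgt_not_eq; simpl in *; lra. }
  assert (Hinc := increment_le G psi dG dpsi (INR N) ltac:(lra) (fun x _ => HG x) (fun x _ => Hpsi x)).
  assert (Hbound : forall x, 0 <= x <= INR N -> Rabs (dG x) <= dpsi x).
  { intros x Hx. unfold dG, dpsi. eapply Rle_trans. apply re_le_Cmod. rewrite Cmod_opp, Cmod_mult.
    apply Rmult_le_compat; try apply Cmod_ge_0. apply HB; lra. apply Cmod_dkap_hline_le. }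
  specialize (Hinc Hbound).
  assert (Hpsi2 : psi (INR N) - psi 0 <= 2 * PI * B).
  { unfold psi. assert (T1 := atan_bound (INR N - w)). assert (T2 := atan_bound (INR N - w')).
    assert (T3 := atan_bound (0 - w)). assert (T4 := atan_bound (0 - w')). nra. }
  assert (HPk : forall x, 0 <= x -> Rabs (Re (P (hline x) * kap N (hline x))) <= 2 * B).
  { intros x Hx. eapply Rle_trans. apply re_le_Cmod. rewrite Cmod_mult.
    assert (T1 := HB x Hx). assert (T2 := Cmod_kap_hline_le N x).
    assert (T3 := Cmod_ge_0 (P (hline x))). assert (T4 := Cmod_ge_0 (kap N (hline x))). nra. }
  assert (Q1 := HPk 0 ltac:(lra)). assert (Q2 := HPk (INR N) ltac:(lra)).
  replace (Ci + NtoC N)%C with (hline (INR N)) by (unfold hline, NtoC; ring).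
  rewrite <- hline_0. unfold Cminus. rewrite re_plus, re_opp.
  (* At x = N the differences x - w, x - w' are w', w; at x = 0 they are -w, -w'. The logarithms
     change places, so they count twice: 372 * 2 * 2 log w = 1488 log w. *)
  assert (EG : G (INR N) - G 0 = (Re (F (hline (INR N))) - Re (F (hline 0)))
     - Re (P (hline (INR N)) * kap N (hline (INR N))) + Re (P (hline 0) * kap N (hline 0)) + 1488 * ln w).
  { unfold G, R0, Cminus. rewrite !re_plus, !re_opp.
    replace (INR N - w) with w' by lra. replace (INR N - w') with w by lra.
    replace ((0 - w) ^ 2) with (w ^ 2) by ring. replace ((0 - w') ^ 2) with (w' ^ 2) by ring.
    assert (EL := ln_wN N HN). fold w w' in EL. lra. }
  apply Rabs_le_between in Hinc. apply Rabs_le_between in Q1. apply Rabs_le_between in Q2.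
  apply Rabs_le. fold w. lra.
Qed.

Lemma cycle_integral_N : exists K, forall N, (2 < N)%nat -> exists r : R,
  is_cycle_integral j 1 (- Z.of_nat N) 1 (Z.of_nat N) 1 (RtoC r) /\
  Rabs (r - 1488 * ln (wN N)) <= K.
Proof.
  destruct primitiveN_estimate as [K HK]. exists K. intros N HN.
  destruct (primitiveN N HN) as [F HF]. exists (Re (F Ci - F (Ci + NtoC N)%C)). split.
  - replace (RtoC (Re (F Ci - F (Ci + NtoC N)%C))) with (F Ci - F (Ci + NtoC N)%C)%C.
    + now apply cycle_integral_primitive.
    + apply C_ext. reflexivity. rewrite im_RtoC. now apply primitiveN_real.
  - now apply HK.
Qed.

(** The cycle integral is a condition on all paths, which determines its value once one path exists;
    the segment from A_w i to i is one. *)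
Lemma cycle_integral_unique (N : nat) (u v : C) :
  is_cycle_integral j 1 (- Z.of_nat N) 1 (Z.of_nat N) 1 u ->
  is_cycle_integral j 1 (- Z.of_nat N) 1 (Z.of_nat N) 1 v -> u = v.
Proof.
  intros Hu Hv.
  assert (Hi : upper_half_plane Ci) by (unfold upper_half_plane; simpl; lra).
  assert (HA : upper_half_plane (A_act 1 (- Z.of_nat N) 1 (Z.of_nat N) 1 Ci)).
  { rewrite A_act_N by trivial. now apply H_incr, Sz_H. }
  assert (Hp := segment_path _ _ HA Hi).
  exact (is_path_integral_unique _ _ _ _ _ (Hu _ _ _ Hi Hp) (Hv _ _ _ Hi Hp)).
Qed.

(** Each ingredient of the normalized value is unique: the form, the smallest solution and the
    integral. So the existential definition admits exactly one value. *)
Lemma is_nor_value_N (N : nat) (r : R) : (2 < N)%nat ->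
  is_cycle_integral j 1 (- Z.of_nat N) 1 (Z.of_nat N) 1 (RtoC r) ->
  forall x : C, is_nor_value j (ncf (fun _ => Z.of_nat N)) x <-> x = RtoC (r / (2 * ln (wN N))).
Proof.
  intros HN Hr x. rewrite ncf_wN by trivial.
  destruct (wN_bounds N HN) as [W1 _].
  assert (Hln : 0 < ln (wN N)) by (rewrite <- ln_1; apply ln_increasing; lra).
  rewrite RtoC_div by lra. split.
  - intros [a [b [c [t [u [y [Hq [Hp [Hy ->]]]]]]]]].
    destruct (quadratic_coefs_unique N a b c HN Hq) as [-> [-> ->]].
    destruct (smallest_pell4_N N HN) as [HN1 HN2]. destruct Hp as [Hp1 Hp2].
    (* Two smallest solutions bound each other in both coordinates. *)
    assert (A1 := HN2 _ _ Hp1). assert (A2 := Hp2 _ _ HN1).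
    assert (Et : t = Z.of_nat N) by lia. assert (Eu : u = 1%Z) by lia. subst t u.
    rewrite epsilon_N, (cycle_integral_unique N y (RtoC r) Hy Hr). reflexivity.
  - intros ->. exists 1%Z, (- Z.of_nat N)%Z, 1%Z, (Z.of_nat N), 1%Z, (RtoC r).
    split; [ now apply quadratic_coefs_wN | split; [ now apply smallest_pell4_N | split; [ exact Hr | ] ] ].
    rewrite epsilon_N. reflexivity.
Qed.

Lemma ln_half_lim : is_lim_seq (fun N => ln (INR N / 2)) p_infty.
Proof.
  apply (is_lim_comp_seq ln (fun N => INR N / 2) p_infty p_infty).
  - apply is_lim_ln_p.
  - exists O. intros n _. discriminate.
  - apply (is_lim_seq_ext (fun N => / 2 * INR N)). intros n; field.
    replace p_infty with (Rbar_mult (/ 2) p_infty).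
    apply is_lim_seq_scal_l, is_lim_seq_INR.
    simpl. destruct (Rle_dec 0 (/ 2)) as [H | H]; [ | exfalso; lra ].
    destruct (Rle_lt_or_eq_dec 0 (/ 2) H); [ reflexivity | exfalso; lra ].
Qed.

(* The equivalence says that j^nor((N,N,N,...)) is well defined and equal to
   the real number v N. *)
Theorem theorem1p2 :
  exists v : nat -> R,
    (forall N : nat, (2 < N)%nat ->
       forall x : C,
         is_nor_value j (ncf (fun _ : nat => Z.of_nat N)) x <-> x = RtoC (v N)) /\
    is_lim_seq v (Finite 744).
Proof.
  destruct cycle_integral_N as [K HK].
  destruct (functional_choice (fun N r => (2 < N)%nat ->
    is_cycle_integral j 1 (- Z.of_nat N) 1 (Z.of_nat N) 1 (RtoC r) /\
    Rabs (r - 1488 * ln (wN N)) <= K)) as [r Hr].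
  { intros N. destruct (Nat.lt_ge_cases 2 N) as [HN | HN].
    - destruct (HK N HN) as [r Hr]. exists r. intros _. exact Hr.
    (* For N <= 2 the premise is false and 0 is a filler value. *)
    - exists 0. lia. }
  exists (fun N => r N / (2 * ln (wN N))). split.
  - intros N HN. apply is_nor_value_N; trivial. now apply Hr.
  - assert (Hlim : is_lim_seq (fun N => Rabs K * / ln (INR N / 2)) 0).
    { apply is_lim_seq_scal0. apply (is_lim_seq_inv _ p_infty); [ apply ln_half_lim | discriminate ]. }
    (* With l = log w, r/(2l) = 744 + (r - 1488 l)/(2l), and the error is at most |K|/(2l) <=
       |K|/log(N/2) because w > N/2. *)
    apply (is_lim_seq_le_le_loc (fun N => 744 - Rabs K * / ln (INR N / 2)) _ (fun N => 744 + Rabs K * / ln (INR N / 2))).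
    + exists 3%nat. intros N HN. assert (HN' : (2 < N)%nat) by lia.
      destruct (Hr N HN') as [_ H]. assert (H3 := INR_ge_3 N HN'). assert (Hw := wN_gt N HN').
      assert (L1 : 0 < ln (INR N / 2)) by (rewrite <- ln_1; apply ln_increasing; lra).
      assert (L2 : ln (INR N / 2) < ln (wN N)) by (apply ln_increasing; lra).
      set (l := ln (wN N)) in *. set (l0 := ln (INR N / 2)) in *.
      assert (HKa := Rle_abs K). apply Rabs_le_between in H.
      assert (E : r N / (2 * l) = 744 + (r N - 1488 * l) * / (2 * l)) by (field; lra).
      assert (I0 : 0 < / (2 * l)) by (apply Rinv_0_lt_compat; lra).
      assert (I1 : / (2 * l) <= / l0) by (apply Rinv_le_contravar; lra).
      assert (J1 : Rabs K * / (2 * l) <= Rabs K * / l0) by (apply Rmult_le_compat_l; [ apply Rabs_pos | exact I1 ]).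
      assert (J2 : (r N - 1488 * l) * / (2 * l) <= Rabs K * / (2 * l)) by (apply Rmult_le_compat_r; lra).
      assert (J3 : - Rabs K * / (2 * l) <= (r N - 1488 * l) * / (2 * l)) by (apply Rmult_le_compat_r; lra).
      rewrite E. lra.
    + replace (Finite 744) with (Finite (744 - 0)) by (f_equal; ring).
      apply is_lim_seq_minus'. apply is_lim_seq_const. exact Hlim.
    + replace (Finite 744) with (Finite (744 + 0)) by (f_equal; ring).
      apply is_lim_seq_plus'. apply is_lim_seq_const. exact Hlim.
Qed.
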